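(* Let $q\in\mathbb{H}_{\mathbb R}$ with $\mathrm{Sc}(q)>1$. The quaternionic B-spline $B_q$, defined by its Fourier transform $\widehat{B_q}(\xi)=\left(\frac{1-e^{-i\xi}}{i\xi}\right)^q$, has the time domain representation $$B_q(t)=\frac{1}{\Gamma(q)}\sum_{k=0}^\infty(-1)^k\binom{q}{k}(t-k)_+^{q-1},\qquad t\in\mathbb{R}.$$ This equality holds in the sense of distributions and in $L^2(\mathbb{R})$. Moreover, $B_q$ satisfies the distributional differential equation $$\mathscr{D}^qB_q=\sum_{k=0}^\infty\binom{q}{k}(-1)^k\,\delta_k,$$ where $\delta_k$ denotes the Dirac delta distribution supported at $k\in\{0,1,2,\dots\}$.
   Context: $\mathbb{H}_{\mathbb R}$ is the real quaternion algebra with basis $1,e_1,e_2,e_3$, and $\mathbb{H}_{\mathbb C}$ its complexification (the complex unit $i$ commutes with $e_1,e_2,e_3$). Write $q=a+v$ with scalar part $a=\mathrm{Sc}(q)$ and vector part $v=\sum_{j=1}^3v_je_j$. For $z\in\mathbb{C}$, $$z^q:=z^a\Big[\cos(|v|\log z)+\frac{v}{|v|}\sin(|v|\log z)\Big]\in\mathbb{H}_{\mathbb C}$$ (principal branch $-\pi<\arg z\le\pi$; second term $0$ if $v=0$; $0^q:=0$ if $\mathrm{Sc}(q)>0$). The function $\frac{1-e^{-i\xi}}{i\xi}$ is given the value $1$ at $\xi=0$. For $t\in\mathbb{R}$, $t_+^q:=t^q$ if $t>0$ and $t_+^q:=0$ otherwise; thus for each $t$ only finitely many terms of the sum are nonzero.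 $\widehat f(\xi)=\int_{\mathbb R}f(x)e^{-i\xi x}\,dx$. $\binom{q}{k}:=\frac{q(q-1)\cdots(q-k+1)}{k!}$ (equal to $1$ for $k=0$), and for $\mathrm{Sc}(q)>0$ $$\Gamma(q):=\int_0^\infty t^{q-1}e^{-t}\,dt=\int_0^\infty t^{a-1}\cos(|v|\log t)e^{-t}\,dt+\frac{v}{|v|}\int_0^\infty t^{a-1}\sin(|v|\log t)e^{-t}\,dt .$$ The integration operator of quaternionic order $q$ is $\mathscr{D}^{-q}f(t):=\frac1{\Gamma(q)}\int_0^\infty x^{q}f(t-x)\frac{dx}{x}$ on Schwartz functions, extended to distributions supported in a half-line $[c,\infty)$ as convolution with $t_+^{q-1}/\Gamma(q)$; $\mathscr{D}^q$ denotes its inverse on such distributions, so that $\mathscr{D}^qu=w$ means $u=\mathscr{D}^{-q}w$. *)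

(* Defs.v *)
From HB Require Import structures.
From mathcomp Require Import all_boot all_order all_algebra.
From mathcomp Require Import complex.
From mathcomp Require Import all_classical all_reals all_analysis.
From mathcomp Require Import ring.

Set Implicit Arguments.
Unset Strict Implicit.
Unset Printing Implicit Defensive.
Import Order.TTheory GRing.Theory Num.Theory.
Import numFieldNormedType.Exports.

Local Open Scope classical_set_scope.
Local Open Scope ring_scope.
Local Open Scope complex_scope.

(* [quat R] is the real quaternion algebra, [quat R[i]] its complexification:
   the complex unit acts through the scalars, hence commutes with e1, e2, e3. *)
Record quat (K : Type) := Quat { q0 : K; q1 : K; q2 : K; q3 : K }.
Arguments q0 {K} q.
Arguments q1 {K} q.
Arguments q2 {K} q.
Arguments q3 {K} q.

Section QuatChoice.
Variable K : Type.
Definition quat_tuple (q : quat K) := (q0 q, q1 q, q2 q, q3 q).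
Definition tuple_quat (t : K * K * K * K) :=
  let: (a, b, c, d) := t in Quat a b c d.
Lemma quat_tupleK : cancel quat_tuple tuple_quat. Proof. by case. Qed.
End QuatChoice.

HB.instance Definition _ (K : eqType) :=
  Equality.copy (quat K) (can_type (@quat_tupleK K)).
HB.instance Definition _ (K : choiceType) :=
  Choice.copy (quat K) (can_type (@quat_tupleK K)).

Section QuatRing.
Variable K : comNzRingType.
Implicit Types p q r : quat K.

Definition qadd p q :=
  Quat (q0 p + q0 q) (q1 p + q1 q) (q2 p + q2 q) (q3 p + q3 q).
Definition qopp p := Quat (- q0 p) (- q1 p) (- q2 p) (- q3 p).
Definition qmul p q := Quat
  (q0 p * q0 q - q1 p * q1 q - q2 p * q2 q - q3 p * q3 q)
  (q0 p * q1 q + q1 p * q0 q + q2 p * q3 q - q3 p * q2 q)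
  (q0 p * q2 q - q1 p * q3 q + q2 p * q0 q + q3 p * q1 q)
  (q0 p * q3 q + q1 p * q2 q - q2 p * q1 q + q3 p * q0 q).
Definition qscale (a : K) q := Quat (a * q0 q) (a * q1 q) (a * q2 q) (a * q3 q).
Definition qzero : quat K := Quat 0 0 0 0.
Definition qone : quat K := Quat 1 0 0 0.

Fact qaddA : associative qadd.
Proof. by move=> [????] [????] [????]; congr Quat; rewrite /= addrA. Qed.
Fact qaddC : commutative qadd.
Proof. by move=> [????] [????]; congr Quat; rewrite /= addrC. Qed.
Fact qadd0 : left_id qzero qadd.
Proof. by move=> [????]; congr Quat; rewrite /= add0r. Qed.
Fact qaddN : left_inverse qzero qopp qadd.
Proof. by move=> [????]; congr Quat; rewrite /= addNr. Qed.
HB.instance Definition _ := GRing.isZmodule.Build (quat K) qaddA qaddC qadd0 qaddN.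

Fact qmulA : associative qmul.
Proof. by move=> [????] [????] [????]; congr Quat => /=; ring. Qed.
Fact qmul1l : left_id qone qmul.
Proof. by move=> [????]; congr Quat => /=; ring. Qed.
Fact qmul1r : right_id qone qmul.
Proof. by move=> [????]; congr Quat => /=; ring. Qed.
Fact qmulDl : left_distributive qmul qadd.
Proof. by move=> [????] [????] [????]; congr Quat => /=; ring. Qed.
Fact qmulDr : right_distributive qmul qadd.
Proof. by move=> [????] [????] [????]; congr Quat => /=; ring. Qed.
Fact qone_neq0 : qone != 0.
Proof. by apply/eqP => -[] /eqP; rewrite oner_eq0. Qed.
HB.instance Definition _ := GRing.Zmodule_isNzRing.Build (quat K)
  qmulA qmul1l qmul1r qmulDl qmulDr qone_neq0.

Fact qscaleA a b q : qscale a (qscale b q) = qscale (a * b) q.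
Proof. by case: q => ????; congr Quat; rewrite /= mulrA. Qed.
Fact qscale1 : left_id 1 qscale.
Proof. by move=> [????]; congr Quat; rewrite /= mul1r. Qed.
Fact qscaleDr : right_distributive qscale +%R.
Proof. by move=> a [????] [????]; congr Quat; rewrite /= mulrDr. Qed.
Fact qscaleDl q : {morph qscale^~ q : a b / a + b}.
Proof. by case: q => ???? a b; congr Quat; rewrite /= mulrDl. Qed.
HB.instance Definition _ := GRing.Zmodule_isLmodule.Build K (quat K)
  qscaleA qscale1 qscaleDr qscaleDl.

Definition e1 : quat K := Quat 0 1 0 0.
Definition e2 : quat K := Quat 0 0 1 0.
Definition e3 : quat K := Quat 0 0 0 1.

Definition Sc q : K := q0 q.
Definition vec q : quat K := Quat 0 (q1 q) (q2 q) (q3 q).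
Definition qconj q : quat K := Quat (q0 q) (- q1 q) (- q2 q) (- q3 q).
Definition normsq q : K := q0 q ^+ 2 + q1 q ^+ 2 + q2 q ^+ 2 + q3 q ^+ 2.

Lemma normsqM p q : normsq (p * q) = normsq p * normsq q.
Proof. by case: p q => [????] [????]; rewrite /normsq /=; ring. Qed.
End QuatRing.

Arguments e1 {K}.
Arguments e2 {K}.
Arguments e3 {K}.

Section QuatInverse.
Variable K : fieldType.
Implicit Types p q : quat K.

Definition qunit : {pred quat K} := [pred q | normsq q != 0].
Definition qinv q :=
  if normsq q == 0 then q else (normsq q)^-1 *: qconj q.

Fact qmulVq : {in qunit, left_inverse 1 qinv *%R}.
Proof.
move=> q; rewrite inE /qinv => nz; rewrite (negPf nz).
by case: q nz => a b c d; rewrite /normsq /= => nz; congr Quat => /=; field.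
Qed.
Fact qmulqV : {in qunit, right_inverse 1 qinv *%R}.
Proof.
move=> q; rewrite inE /qinv => nz; rewrite (negPf nz).
by case: q nz => a b c d; rewrite /normsq /= => nz; congr Quat => /=; field.
Qed.
Fact qunitP q p : p * q = 1 /\ q * p = 1 -> qunit q.
Proof.
case=> _ /(congr1 (@normsq K)); rewrite normsqM => h.
rewrite /qunit /=; apply/eqP => q_0; move: h; rewrite q_0 mul0r.
rewrite /normsq /= expr1n expr0n /= !addr0 => /esym/eqP.
by rewrite oner_eq0.
Qed.
Fact qinv_out : {in [predC qunit], qinv =1 id}.
Proof. by move=> q; rewrite !inE negbK /qinv => ->. Qed.
HB.instance Definition _ := GRing.NzRing_hasMulInverse.Build (quat K)
  qmulVq qmulqV qunitP qinv_out.
End QuatInverse.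

Section ComplexFunctions.
Variable R : realType.
Implicit Types z w : R[i].

Definition cabs z : R := Num.sqrt (complex.Re z ^+ 2 + complex.Im z ^+ 2).

Definition cexp z : R[i] :=
  (expR (complex.Re z))%:C * (cos (complex.Im z) +i* sin (complex.Im z)).

(* principal argument, in ]-pi, pi] for z != 0 *)
Definition carg z : R :=
  if 0 <= complex.Im z then acos (complex.Re z / cabs z)
  else - acos (complex.Re z / cabs z).

Definition clog z : R[i] := ln (cabs z) +i* carg z.

Definition ccos w : R[i] := (cexp ('i%C * w) + cexp (- ('i%C * w))) / 2.
Definition csin w : R[i] := (cexp ('i%C * w) - cexp (- ('i%C * w))) / (2 * 'i%C).

Definition qC (q : quat R) : quat R[i] :=
  Quat (q0 q)%:C (q1 q)%:C (q2 q)%:C (q3 q)%:C.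

Definition vnorm (q : quat R) : R := Num.sqrt (normsq (vec q)).

(* The vector term vanishes for v = 0, since x / 0 = 0.
   The value at z = 0 is meaningful for Sc q > 0 only. *)
Definition cpowq z (q : quat R) : quat R[i] :=
  if z == 0 then 0 else
    cexp ((Sc q)%:C * clog z) *:
      (ccos ((vnorm q)%:C * clog z) *: (1 : quat R[i])
       + (csin ((vnorm q)%:C * clog z) / (vnorm q)%:C) *: qC (vec q)).

Definition ppowq (t : R) (q : quat R) : quat R[i] :=
  if 0 < t then cpowq t%:C q else 0.

Definition binomq (q : quat R) (k : nat) : quat R :=
  (k`!%:R)^-1 *: \prod_(i < k) (q - i%:R).

Definition Gammaq (q : quat R) : quat R :=
  (\int[lebesgue_measure]_(t in `]0, +oo[)
     (t `^ (Sc q - 1) * cos (vnorm q * ln t) * expR (- t)))%R *: (1 : quat R)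
  + ((\int[lebesgue_measure]_(t in `]0, +oo[)
     (t `^ (Sc q - 1) * sin (vnorm q * ln t) * expR (- t)))%R / vnorm q)
    *: vec q.

Definition cintegral (f : R -> R[i]) : R[i] :=
  (\int[lebesgue_measure]_x complex.Re (f x))%R
  +i* (\int[lebesgue_measure]_x complex.Im (f x))%R.

Definition qintegral (f : R -> quat R[i]) : quat R[i] :=
  Quat (cintegral (q0 \o f)) (cintegral (q1 \o f))
       (cintegral (q2 \o f)) (cintegral (q3 \o f)).

Definition qabs (q : quat R[i]) : R :=
  Num.sqrt (cabs (q0 q) ^+ 2 + cabs (q1 q) ^+ 2
            + cabs (q2 q) ^+ 2 + cabs (q3 q) ^+ 2).

Definition cL2 (f : R -> R[i]) : Prop :=
  (@complex.Re R \o f \in Lfun lebesgue_measure 2%:E)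
  /\ (@complex.Im R \o f \in Lfun lebesgue_measure 2%:E).

Definition qL2 (f : R -> quat R[i]) : Prop :=
  [/\ cL2 (q0 \o f), cL2 (q1 \o f), cL2 (q2 \o f) & cL2 (q3 \o f)].

End ComplexFunctions.

Section Distributions.
Variable R : realType.
Implicit Types (phi psi : R -> R[i]).

Definition smooth (f : R -> R) : Prop :=
  forall (n : nat) (x : R), derivable (derive1n n f) x 1.

Definition csmooth phi : Prop :=
  smooth (@complex.Re R \o phi) /\ smooth (@complex.Im R \o phi).

Definition cderiven (n : nat) phi (x : R) : R[i] :=
  derive1n n (@complex.Re R \o phi) x +i* derive1n n (@complex.Im R \o phi) x.

Definition is_test phi : Prop :=
  csmooth phi /\ exists K : R, forall x, K < `|x| -> phi x = 0.

Definition is_schwartz phi : Prop :=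
  csmooth phi /\
  forall m n : nat, exists M : R, forall x,
    `|x| ^+ m * cabs (cderiven n phi x) <= M.

Definition fourier psi (xi : R) : R[i] :=
  cintegral (fun x => psi x * cexp (- ('i%C * (xi * x)%:C))).

(* An H_C-valued distribution is a functional on arbitrary functions R -> C
   of which only the values on test functions are constrained and compared. *)
Definition functional := (R -> R[i]) -> quat R[i].
Implicit Types (u w : functional).

Definition is_distribution u : Prop :=
  (forall (a : R[i]) phi psi, is_test phi -> is_test psi ->
     u (fun x => a * phi x + psi x) = a *: u phi + u psi)
  /\
  (forall K : R, exists C : R, exists N : nat, forall phi (M : R),
     is_test phi -> (forall x, K < `|x| -> phi x = 0) ->
     (forall n x, (n <= N)%N -> cabs (cderiven n phi x) <= M) ->
     qabs (u phi) <= C * M).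

Definition dist_eq u w : Prop := forall phi, is_test phi -> u phi = w phi.

Definition regular (f : R -> quat R[i]) : functional :=
  fun phi => qintegral (fun x => phi x *: f x).

Definition delta (x : R) : functional := fun phi => phi x *: (1 : quat R[i]).

(* [\sum_(k \in A)] is the sum over the finite support of the summand. *)
Definition dseries (c : nat -> quat R[i]) (u_ : nat -> functional) : functional :=
  fun phi => \sum_(k \in [set: nat]) (c k * u_ k phi).

Definition supported_from (c : R) u : Prop :=
  forall phi, is_test phi ->
    (exists2 b, b < c & forall x, b <= x -> phi x = 0) -> u phi = 0.

(* smooth, equal to 0 on ]-oo, c - 2] and to 1 on [c - 1, +oo[ *)
Definition flat (x : R) : R := if 0 < x then expR (- x^-1) else 0.
Definition cutoff (c x : R) : R :=
  flat (x - c + 2) / (flat (x - c + 2) + flat (c - 1 - x)).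

(* left H_C-linear extension of a functional to H_C-valued functions *)
Definition qpair w (F : R -> quat R[i]) : quat R[i] :=
  w (q0 \o F) + e1 * w (q1 \o F) + e2 * w (q2 \o F) + e3 * w (q3 \o F).

(* For w supported in [c, +oo[ and g vanishing on ]-oo, 0], the convolution is
     <g * w, phi> = < w, x |-> \int g(y) phi(x + y) dy >.
   The function paired with w is smooth with support bounded above only; the
   cutoff makes it a test function without changing it near [c, +oo[. The
   factor g stays on the left of w. *)
Definition conv (c : R) (g : R -> quat R[i]) w : functional :=
  fun phi => qpair w (fun x =>
    (cutoff c x)%:C *: qintegral (fun y => phi (x + y) *: g y)).

Definition frac_kernel (q : quat R) (t : R) : quat R[i] :=
  qC (Gammaq q)^-1 * ppowq t (q - 1).

(* D^{-q} on distributions supported in [c, +oo[ *)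
Definition frac_int (q : quat R) (c : R) (w : functional) : functional :=
  conv c (frac_kernel q) w.

(* D^q u = w; the right-hand side below does not depend on the choice of c. *)
Definition frac_deriv_eq (q : quat R) u w : Prop :=
  exists c : R,
    [/\ is_distribution u, supported_from c u,
        is_distribution w, supported_from c w
      & dist_eq u (frac_int q c w)].

End Distributions.

Section Spline.
Variable R : realType.
Variable q : quat R.

Definition spline_base (xi : R) : R[i] :=
  if xi == 0 then 1 else (1 - cexp (- ('i%C * xi%:C))) / ('i%C * xi%:C).

Definition spline_symbol (xi : R) : quat R[i] := cpowq (spline_base xi) q.

(* B is in L^2 and its Fourier transform, taken in the sense of tempered
   distributions (<B^, psi> = <B, psi^>), is the symbol. *)
Definition is_Bspline (B : R -> quat R[i]) : Prop :=
  qL2 B /\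
  forall psi : R -> R[i], is_schwartz psi ->
    regular B (fourier psi) = regular spline_symbol psi.

Definition spline_coef (k : nat) : quat R[i] := qC ((-1) ^+ k * binomq q k).

Definition spline_series (t : R) : quat R[i] :=
  qC (Gammaq q)^-1
  * \sum_(k \in [set: nat]) (spline_coef k * ppowq (t - k%:R) (q - 1)).

Definition spline_dseries : functional R := fun phi =>
  qC (Gammaq q)^-1
  * dseries spline_coef (fun k => regular (fun t => ppowq (t - k%:R) (q - 1))) phi.

End Spline.

(* Main.v *)
Require Import Defs.
From mathcomp Require Import all_boot all_order all_algebra.
From mathcomp Require Import complex.
From mathcomp Require Import all_classical all_reals all_analysis.
From mathcomp Require Import measurable_realfun.
From mathcomp Require Import ring lra.
Set Implicit Arguments.
Unset Strict Implicit.
Unset Printing Implicit Defensive.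
Import Order.TTheory GRing.Theory Num.Theory.
Import numFieldNormedType.Exports.
Local Open Scope classical_set_scope.
Local Open Scope ring_scope.
Local Open Scope complex_scope.

(** Let [q = a + |v| J] with [J] a unit imaginary quaternion. In [H_C] the element
    [i J] is a square root of 1, and the idempotents [(1 - i J) / 2] and
    [(1 + i J) / 2] split the commutative algebra generated by [J] into two copies
    of [C] on which [J] acts as [i] and as [- i] (the ring morphism [emb]). Powers
    with exponent [q], the Gamma function and the binomial coefficients all live in
    this algebra, and their components are the same objects for the conjugate
    complex orders [s = a + i |v|] and [a - i |v|] (lemmas [cpowq_emb],
    [Gammaq_emb], [spline_coef_emb]). So the theorem concerns the spline of complex
    order [s], where [Re s > 1]: the sum of the [bcoef s k * (t - k)_+ ^ (s - 1)].

    Multiplied by [exp (- sg t)] with [sg > 0], the truncated power has the Fourier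
    transform [Gamma(s) z ^ (- s)] at [z = sg + i xi] ([fourier_damp_tpow]), each
    shift by 1 contributes a factor [exp (- z)], and the binomial series sums these
    factors: the damped spline has the transform [Gamma(s) ((1 - exp (- z)) / z) ^ s]
    ([fourier_damp_cspline]). This is bounded by a multiple of
    [(1 + |xi|) ^ (- Re s)], uniformly in [sg]. By Plancherel the damped splines are
    therefore bounded in L2 and, by monotone convergence, the spline is in L2
    ([cspline_L2]); by dominated convergence its pairing with the transform of a
    Schwartz function is the pairing of that function with the limit of the
    transforms ([cspline_fourier]). The limit is the principal power of
    [(1 - exp (- i xi)) / (i xi)], because the logarithms of the numerator and of
    the denominator differ by a number with imaginary part in ]-pi, pi[
    ([ccvg_csymbol]). Dividing by Gamma(s) is legitimate: if it vanished, so would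
    the transform of [t_+ ^ (s - 1) exp (- t)], against the injectivity of the Fourier
    transform ([cGamma_neq0]). Hence the series is a B-spline
    ([spline_is_Bspline]).

    Any other B-spline has the same pairings with transforms of Schwartz functions,
    among them all translated and dilated Gaussians, which determine a square
    integrable function almost everywhere ([cL2_fourier_inj], [Bspline_unique]). It
    remains to look at the series itself. On the support of a test function it is a
    finite sum, which gives its equality with the series of distributions
    ([spline_dseries_eq]); and convolution with the kernel t_+^(q-1) / Gamma(q) turns
    the Dirac mass at [k] into (t - k)_+^(q-1) / Gamma(q), which is the differential
    equation ([spline_frac_int]). *)

(** * Complex-valued functions of a real variable *)

Section ComplexCalculus.
Variable R : realType.
Implicit Types (z w : R[i]) (f g : R -> R[i]).
Local Notation Re := (@complex.Re R).
Local Notation Im := (@complex.Im R).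

Lemma eqC z w : Re z = Re w -> Im z = Im w -> z = w.
Proof. by case: z w => a b [c d] /= -> ->. Qed.

Lemma ReD z w : Re (z + w) = Re z + Re w. Proof. by case: z w => ? ? []. Qed.
Lemma ImD z w : Im (z + w) = Im z + Im w. Proof. by case: z w => ? ? []. Qed.
Lemma ReN z : Re (- z) = - Re z. Proof. by case: z. Qed.
Lemma ImN z : Im (- z) = - Im z. Proof. by case: z. Qed.
Lemma ReM z w : Re (z * w) = Re z * Re w - Im z * Im w.
Proof. by case: z w => ? ? []. Qed.
Lemma ImM z w : Im (z * w) = Re z * Im w + Im z * Re w.
Proof. by case: z w => ? ? []. Qed.

Definition ReImE := (ReD, ImD, ReN, ImN, ReM, ImM).

Lemma realC_eq0 (x : R) : (x%:C == 0 :> R[i]) = (x == 0).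
Proof. by rewrite -[0]/((0 : R)%:C) (inj_eq (@complexI _)). Qed.

Section Parts.
Variables (T : Type) (f g : T -> R[i]).

Lemma Re_compD : Re \o (fun x => f x + g x) = (Re \o f) \+ (Re \o g).
Proof. by apply/funext => x; rewrite /= ReD. Qed.
Lemma Im_compD : Im \o (fun x => f x + g x) = (Im \o f) \+ (Im \o g).
Proof. by apply/funext => x; rewrite /= ImD. Qed.
Lemma Re_compM :
  Re \o (fun x => f x * g x) = (Re \o f) \* (Re \o g) \- (Im \o f) \* (Im \o g).
Proof. by apply/funext => x; rewrite /= ReM. Qed.
Lemma Im_compM :
  Im \o (fun x => f x * g x) = (Re \o f) \* (Im \o g) \+ (Im \o f) \* (Re \o g).
Proof. by apply/funext => x; rewrite /= ImM. Qed.
End Parts.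

Lemma cabsE z : (cabs z)%:C = `|z|. Proof. by rewrite normc_def. Qed.
Lemma cabs_ge0 z : 0 <= cabs z. Proof. exact: sqrtr_ge0. Qed.
Lemma cabsM z w : cabs (z * w) = cabs z * cabs w.
Proof. by apply: complexI; rewrite rmorphM /= !cabsE normrM. Qed.
Lemma cabsD z w : cabs (z + w) <= cabs z + cabs w.
Proof. by rewrite -lecR rmorphD /= !cabsE ler_normD. Qed.
Lemma cabsN z : cabs (- z) = cabs z.
Proof. by apply: complexI; rewrite !cabsE normrN. Qed.
Lemma cabsB z w : cabs (z - w) <= cabs z + cabs w.
Proof. by rewrite -(cabsN w); exact: cabsD. Qed.
Lemma cabsV z : cabs z^-1 = (cabs z)^-1.
Proof. by apply: complexI; rewrite fmorphV /= !cabsE normfV. Qed.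
Lemma cabsX z n : cabs (z ^+ n) = cabs z ^+ n.
Proof. by apply: complexI; rewrite rmorphXn /= !cabsE normrX. Qed.
Lemma cabs0 : cabs (0 : R[i]) = 0.
Proof. by apply: complexI; rewrite cabsE normr0. Qed.
Lemma cabs1 : cabs (1 : R[i]) = 1.
Proof. by apply: complexI; rewrite cabsE normr1. Qed.
Lemma cabsi : cabs ('i : R[i]) = 1.
Proof. by rewrite /cabs /= expr0n expr1n add0r sqrtr1. Qed.
Lemma cabs_eq0 z : (cabs z == 0) = (z == 0).
Proof. by rewrite -[LHS](inj_eq (@complexI R)) cabsE normr_eq0. Qed.
Lemma cabs_gt0 z : (0 < cabs z) = (z != 0).
Proof. by rewrite lt_neqAle cabs_ge0 andbT eq_sym cabs_eq0. Qed.
Lemma cabs_real (x : R) : cabs x%:C = `|x|.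
Proof. by rewrite /cabs /= expr0n addr0 sqrtr_sqr. Qed.
Lemma sqr_cabs z : cabs z ^+ 2 = Re z ^+ 2 + Im z ^+ 2.
Proof. by rewrite sqr_sqrtr // addr_ge0 ?sqr_ge0. Qed.

Lemma Re_cabs z : `|Re z| <= cabs z.
Proof.
by rewrite -sqrtr_sqr ler_sqrt ?lerDl ?sqr_ge0 // addr_ge0 ?sqr_ge0.
Qed.
Lemma Im_cabs z : `|Im z| <= cabs z.
Proof.
by rewrite -sqrtr_sqr ler_sqrt ?lerDr ?sqr_ge0 // addr_ge0 ?sqr_ge0.
Qed.
Lemma cabs_ReIm z : cabs z <= `|Re z| + `|Im z|.
Proof.
rewrite [z in cabs z]complexE (le_trans (cabsD _ _)) // cabsM cabsi mul1r.
by rewrite !cabs_real.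
Qed.

Lemma cabs_sum (I : Type) (r : seq I) (P : pred I) (F : I -> R[i]) :
  cabs (\sum_(i <- r | P i) F i) <= \sum_(i <- r | P i) cabs (F i).
Proof.
elim/big_ind2 : _ => [|x a y b xa yb|//]; first by rewrite cabs0.
by rewrite (le_trans (cabsD _ _)) // lerD.
Qed.

Lemma cexpD z w : cexp (z + w) = cexp z * cexp w.
Proof.
case: z w => a b [c d]; apply: eqC; rewrite /cexp !(ReImE, mul0r, subr0, addr0) /=.
  by rewrite expRD cosD; ring.
by rewrite expRD sinD; ring.
Qed.
Lemma cexp0 : cexp (0 : R[i]) = 1.
Proof. by rewrite /cexp raddf0 /= expR0 cos0 sin0 mul1r. Qed.
Lemma cabs_cexp z : cabs (cexp z) = expR (Re z).
Proof.
rewrite /cexp cabsM cabs_real ger0_norm ?expR_ge0 //.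
by rewrite /cabs /= cos2Dsin2 sqrtr1 mulr1.
Qed.
Lemma cexp_neq0 z : cexp z != 0.
Proof. by rewrite -cabs_eq0 cabs_cexp gt_eqF ?expR_gt0. Qed.
Lemma cexpN z : cexp (- z) = (cexp z)^-1.
Proof.
by apply: (mulfI (cexp_neq0 z)); rewrite divff ?cexp_neq0 // -cexpD subrr cexp0.
Qed.
Lemma cexp_real (x : R) : cexp x%:C = (expR x)%:C.
Proof. by rewrite /cexp /= cos0 sin0 [_ +i* _](_ : _ = 1) // mulr1. Qed.
Lemma cexp_i (x : R) : cexp ('i * x%:C) = cos x +i* sin x.
Proof.
rewrite [_ * _](_ : _ = 0 +i* x); last by apply: eqC => /=; ring.
by rewrite /cexp /= expR0 mul1r.
Qed.
Lemma cexp_nat n z : cexp (n%:R * z) = cexp z ^+ n.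
Proof.
elim: n => [|n ih]; first by rewrite mul0r cexp0 expr0.
by rewrite -natr1 mulrDl mul1r cexpD ih exprSr.
Qed.
Lemma conj_cexp z : (cexp z)^* = cexp (z^*).
Proof.
case: z => a b; apply: eqC; rewrite /cexp /= ?cosN ?sinN !(mul0r,subr0,addr0) //.
by rewrite mulrN.
Qed.
Lemma cabs_conj z : cabs z^* = cabs z.
Proof. by case: z => a b; rewrite /cabs /= sqrrN. Qed.

Definition is_cderive f (x : R) d :=
  is_derive x 1 (Re \o f) (Re d) /\ is_derive x 1 (Im \o f) (Im d).

Lemma is_derive_ext (f g : R -> R) (x d d' : R) : f =1 g -> d = d' ->
  is_derive x 1 f d -> is_derive x 1 g d'.
Proof. by move=> /funext -> ->. Qed.

Lemma is_cderive_ext f g x d d' : f =1 g -> d = d' ->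
  is_cderive f x d -> is_cderive g x d'.
Proof. by move=> /funext -> ->. Qed.

Lemma is_cderive_cst z x : is_cderive (fun=> z) x 0.
Proof. by split; exact: is_derive_cst. Qed.

Lemma is_cderiveD f g x a b : is_cderive f x a -> is_cderive g x b ->
  is_cderive (fun t => f t + g t) x (a + b).
Proof.
move=> [f1 f2] [g1 g2]; split.
  by apply: is_derive_ext (is_deriveD f1 g1) => [t|]; rewrite /= ReD.
by apply: is_derive_ext (is_deriveD f2 g2) => [t|]; rewrite /= ImD.
Qed.

Lemma is_cderiveM f g x a b : is_cderive f x a -> is_cderive g x b ->
  is_cderive (fun t => f t * g t) x (a * g x + f x * b).
Proof.
move=> [f1 f2] [g1 g2]; split.
  apply: is_derive_ext (is_deriveB (is_deriveM f1 g1) (is_deriveM f2 g2)).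
    by move=> t; rewrite /= ReM.
  by rewrite !ReImE /GRing.scale /=; ring.
apply: is_derive_ext (is_deriveD (is_deriveM f1 g2) (is_deriveM f2 g1)).
  by move=> t; rewrite /= ImM.
by rewrite !ReImE /GRing.scale /=; ring.
Qed.

Lemma is_cderiveZ z f x d : is_cderive f x d ->
  is_cderive (fun t => z * f t) x (z * d).
Proof.
move=> fd; apply: is_cderive_ext (is_cderiveM (is_cderive_cst z x) fd) => //.
by rewrite mul0r add0r.
Qed.

Lemma is_cderiveN f x d : is_cderive f x d -> is_cderive (fun t => - f t) x (- d).
Proof.
move=> /(is_cderiveZ (-1)); apply: is_cderive_ext => [t|]; exact: mulN1r.
Qed.

Lemma is_cderive_real (f : R -> R) (x d : R) : is_derive x 1 f d ->
  is_cderive (fun t => (f t)%:C) x d%:C.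
Proof. by move=> fd; split => //=; exact: is_derive_cst. Qed.

Lemma is_cderive_id x : is_cderive (fun t => t%:C) x 1.
Proof. exact: is_cderive_ext (is_cderive_real (is_derive_id x 1)). Qed.

Lemma is_cderive_cexp f x d : is_cderive f x d ->
  is_cderive (fun t => cexp (f t)) x (d * cexp (f x)).
Proof.
move=> [f1 f2].
have h1 : is_derive x 1 (expR \o (Re \o f)) (expR (Re (f x)) * Re d).
  exact: is_derive1_comp.
have h2 : is_derive x 1 (cos \o (Im \o f)) (- sin (Im (f x)) * Im d).
  exact: is_derive1_comp.
have h3 : is_derive x 1 (sin \o (Im \o f)) (cos (Im (f x)) * Im d).
  exact: is_derive1_comp.
split.
  apply: is_derive_ext (is_deriveM h1 h2) => [t|] /=.
    by rewrite /cexp /= mul0r subr0.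
  by rewrite /cexp !ReImE /GRing.scale /=; ring.
apply: is_derive_ext (is_deriveM h1 h3) => [t|] /=.
  by rewrite /cexp /= mul0r addr0.
by rewrite /cexp !ReImE /GRing.scale /=; ring.
Qed.

Lemma is_cderive0_cst f : (forall x, is_cderive f x 0) -> forall x y, f x = f y.
Proof.
move=> h x y; apply: eqC.
  by apply: (@is_derive_0_is_cst _ (Re \o f)) => t; have [] := h t.
by apply: (@is_derive_0_is_cst _ (Im \o f)) => t; have [] := h t.
Qed.

(** The principal logarithm on the right half-plane. With [atan] in place of the
    [acos] of [clog] it is visibly smooth there. *)
Definition rlog z : R[i] := ln (cabs z) +i* atan (Im z / Re z).

Lemma cexp_rlog z : 0 < Re z -> cexp (rlog z) = z.
Proof.
move=> z0; have nz : Re z != 0 by rewrite gt_eqF.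
have p0 : 0 < cabs z by rewrite cabs_gt0; apply: contraNneq nz => ->.
rewrite /cexp /= lnK ?posrE //.
have c : cos (atan (Im z / Re z)) = Re z / cabs z.
  rewrite cos_atan -[Re z in RHS]ger0_norm ?ltW // -sqrtr_sqr.
  rewrite -[in RHS]sqrtrV ?addr_ge0 ?sqr_ge0 // -sqrtrM ?sqr_ge0 // -sqrtrV ?addr_ge0 ?sqr_ge0 //.
  congr Num.sqrt; field; rewrite nz /=.
  by rewrite gt_eqF // -sqr_cabs exprn_gt0.
have c0 : cos (atan (Im z / Re z)) != 0.
  by rewrite c mulf_neq0 ?invr_eq0 ?gt_eqF.
have s : sin (atan (Im z / Re z)) = Im z / cabs z.
  have := atanK (Im z / Re z); rewrite /tan => /(canRL (divfK c0)) ->.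
  by rewrite c; field; rewrite nz gt_eqF.
by rewrite c s; apply: eqC => /=; field; rewrite gt_eqF.
Qed.

Lemma Im_rlog z : - (pi / 2) < Im (rlog z) < pi / 2.
Proof. by rewrite /= atan_gtNpi2 atan_ltpi2. Qed.

Lemma clog_cexp w : - pi < Im w < pi -> clog (cexp w) = w.
Proof.
case: w => a b /= /andP[b1 b2]; apply: eqC; rewrite /clog /=.
  by rewrite cabs_cexp /= expRK.
rewrite /carg cabs_cexp /= !(mul0r, subr0, addr0) mulrAC divff ?mul1r; last first.
  by rewrite gt_eqF ?expR_gt0.
rewrite pmulr_rge0 ?expR_gt0 //; case: (leP 0 (sin b)) => sb; last first.
  have b0 : b <= 0.
    rewrite leNgt; apply: contraTN sb => b0; rewrite -leNgt.
    by apply: sin_ge0_pi; rewrite (ltW b0) ltW.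
  by rewrite cosKN ?opprK // (ltW b1) b0.
have b0 : 0 <= b.
  rewrite leNgt; apply: contraTN sb => b0; rewrite -ltNge.
  by rewrite -oppr_gt0 -sinN; apply: sin_gt0_pi; rewrite oppr_gt0 b0 ltrNl b1.
by rewrite cosK // in_itv /= b0 ltW.
Qed.

Lemma clog_real (x : R) : 0 < x -> clog x%:C = (ln x)%:C.
Proof.
move=> x0; rewrite -[x in LHS]lnK ?posrE // -cexp_real clog_cexp //=.
by rewrite oppr_lt0 pi_gt0.
Qed.

Lemma is_cderive_rlog f x d : 0 < Re (f x) -> is_cderive f x d ->
  is_cderive (fun t => rlog (f t)) x (d / f x).
Proof.
move=> f0 [f1 f2].
have nz : Re (f x) != 0 by rewrite gt_eqF.
have p0 : 0 < Re (f x) ^+ 2 + Im (f x) ^+ 2.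
  by rewrite ltr_pwDl ?sqr_ge0 // exprn_gt0.
have pc : 0 < cabs (f x) by rewrite sqrtr_gt0.
have h0 : is_derive x 1 ((Re \o f) ^+ 2 + (Im \o f) ^+ 2)
   (2 * (Re (f x) * Re d) + 2 * (Im (f x) * Im d)).
  apply: is_derive_ext (is_deriveD (is_deriveM f1 f1) (is_deriveM f2 f2)).
    by move=> t; rewrite /= !expr2.
  by rewrite /GRing.scale /=; ring.
have h1 : is_derive x 1 (@cabs R \o f)
   ((2 * cabs (f x))^-1 * (2 * (Re (f x) * Re d) + 2 * (Im (f x) * Im d))).
  by apply: (@is_derive1_comp _ Num.sqrt); exact: is_derive1_sqrt.
have h2 := @is_derive1_comp _ (@ln R) (@cabs R \o f) x _ _ (is_derive1_ln pc) h1.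
have h3 := @is_deriveV _ _ _ _ _ nz f1.
have h4 := @is_derive1_comp _ (@atan R) _ x _ _ (is_derive1_atan _) (is_deriveM f2 h3).
set N := Re (f x) ^+ 2 + Im (f x) ^+ 2 in p0.
have dE : d / f x = ((Re d * Re (f x) + Im d * Im (f x)) / N)
                 +i* ((Im d * Re (f x) - Re d * Im (f x)) / N).
  apply: (@mulIf _ (f x)); first by apply: contraNneq nz => ->.
  rewrite divfK; last by apply: contraNneq nz => ->.
  rewrite /N in p0 *; apply: eqC; rewrite !ReImE /=; field.
    by rewrite gt_eqF.
  by rewrite gt_eqF.
rewrite dE; split.
  apply: is_derive_ext h2 => //=.
  rewrite /N -sqr_cabs; field.
  by rewrite gt_eqF.
apply: is_derive_ext h4 => //=.
rewrite [((_ \o f) * _) x](_ : _ = Im (f x) / Re (f x)) // /N /GRing.scale /=.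
rewrite (_ : 1 + _ = N / Re (f x) ^+ 2) /N; last by field.
by field; rewrite nz gt_eqF.
Qed.

(** The limit of [rlog] at [i xi], from inside the right half-plane. *)
Definition ilog (xi : R) : R[i] := ln `|xi| +i* (Num.sg xi * (pi / 2)).

Lemma cexp_ilog (xi : R) : xi != 0 -> cexp (ilog xi) = 'i * xi%:C.
Proof.
move=> x0; rewrite /cexp /= lnK ?posrE ?normr_gt0 //.
have [xp|xn|x00] := ltgtP xi 0; last by rewrite x00 eqxx in x0.
  rewrite ltr0_sg // ltr0_norm // mulN1r cosN sinN cos_pihalf sin_pihalf.
  by apply: eqC => /=; ring.
rewrite gtr0_sg // gtr0_norm // mul1r cos_pihalf sin_pihalf.
by apply: eqC => /=; ring.
Qed.

End ComplexCalculus.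

(** * Measurability and continuity of complex-valued functions *)

Section ComplexMeasurable.
Variable R : realType.
Local Notation Re := (@complex.Re R).
Local Notation Im := (@complex.Im R).

Definition cmeasurable d (T : measurableType d) (f : T -> R[i]) :=
  measurable_fun setT (Re \o f) /\ measurable_fun setT (Im \o f).

Lemma cmeasurable_ext d (T : measurableType d) (f g : T -> R[i]) :
  f =1 g -> cmeasurable f -> cmeasurable g.
Proof. by move=> /funext ->. Qed.

Lemma cmeasurable_cst d (T : measurableType d) (z : R[i]) :
  cmeasurable (fun _ : T => z).
Proof. by split; exact: measurable_cst. Qed.

Lemma cmeasurableD d (T : measurableType d) (f g : T -> R[i]) :
  cmeasurable f -> cmeasurable g -> cmeasurable (fun x => f x + g x).
Proof.
move=> [f1 f2] [g1 g2]; split; rewrite ?Re_compD ?Im_compD; exact: measurable_funD.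
Qed.

Lemma cmeasurableM d (T : measurableType d) (f g : T -> R[i]) :
  cmeasurable f -> cmeasurable g -> cmeasurable (fun x => f x * g x).
Proof.
move=> [f1 f2] [g1 g2]; split; rewrite ?Re_compM ?Im_compM.
  by apply: measurable_funB; exact: measurable_funM.
by apply: measurable_funD; exact: measurable_funM.
Qed.

Lemma cmeasurable_real d (T : measurableType d) (f : T -> R) :
  measurable_fun setT f -> cmeasurable (fun x => (f x)%:C).
Proof. by move=> mf; split => //; exact: measurable_cst. Qed.

Lemma cmeasurable_comp d (T : measurableType d) d' (T' : measurableType d')
    (f : T -> R[i]) (g : T' -> T) :
  cmeasurable f -> measurable_fun setT g -> cmeasurable (f \o g).
Proof. by move=> [f1 f2] mg; split; [exact: measurableT_comp f1 mg|exact: measurableT_comp f2 mg]. Qed.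

Lemma cmeasurable_conj d (T : measurableType d) (f : T -> R[i]) :
  cmeasurable f -> cmeasurable (fun x => (f x)^*).
Proof.
move=> [f1 f2]; split.
  by rewrite [_ \o _](_ : _ = Re \o f) //; apply/funext => x /=; case: (f x).
rewrite [_ \o _](_ : _ = \- (Im \o f)); first exact: measurable_funN.
by apply/funext => x /=; case: (f x).
Qed.

Lemma measurable_cabs d (T : measurableType d) (f : T -> R[i]) :
  cmeasurable f -> measurable_fun setT (fun x => cabs (f x)).
Proof.
move=> [f1 f2]; apply: (@measurableT_comp _ _ _ _ _ _ (@Num.sqrt R)).
  exact: continuous_measurable_fun (@sqrt_continuous R).
by apply: measurable_funD; apply: (@measurable_funX _ _ _ _ _ 2%N).
Qed.

Definition ccvg (u : nat -> R[i]) (l : R[i]) :=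
  (Re \o u @ \oo --> Re l) /\ (Im \o u @ \oo --> Im l).

Lemma cmeasurable_cvg d (T : measurableType d) (u : nat -> T -> R[i]) f :
  (forall n, cmeasurable (u n)) -> (forall x, ccvg (u ^~ x) (f x)) ->
  cmeasurable f.
Proof.
move=> mu cu; split.
  by apply: (@measurable_fun_cvg _ _ _ _ (fun n => Re \o u n));
    [move=> n; have [] := mu n | move=> x _; have [] := cu x].
by apply: (@measurable_fun_cvg _ _ _ _ (fun n => Im \o u n));
  [move=> n; have [] := mu n | move=> x _; have [] := cu x].
Qed.

Definition ccontinuous (f : R -> R[i]) :=
  continuous (Re \o f) /\ continuous (Im \o f).

Lemma ccontinuous_measurable (f : R -> R[i]) : ccontinuous f -> cmeasurable f.
Proof. by move=> [f1 f2]; split; exact: continuous_measurable_fun. Qed.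

Lemma ccontinuous_ext (f g : R -> R[i]) : f =1 g -> ccontinuous f -> ccontinuous g.
Proof. by move=> /funext ->. Qed.

Lemma ccontinuous_cst (z : R[i]) : ccontinuous (fun=> z).
Proof. by split => x; exact: cvg_cst. Qed.

Lemma ccontinuousD (f g : R -> R[i]) :
  ccontinuous f -> ccontinuous g -> ccontinuous (fun x => f x + g x).
Proof.
move=> [f1 f2] [g1 g2]; split => x; rewrite ?Re_compD ?Im_compD.
  exact: cvgD (f1 x) (g1 x).
exact: cvgD (f2 x) (g2 x).
Qed.

Lemma ccontinuousM (f g : R -> R[i]) :
  ccontinuous f -> ccontinuous g -> ccontinuous (fun x => f x * g x).
Proof.
move=> [f1 f2] [g1 g2]; split => x; rewrite ?Re_compM ?Im_compM.
  exact: cvgB (cvgM (f1 x) (g1 x)) (cvgM (f2 x) (g2 x)).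
exact: cvgD (cvgM (f1 x) (g2 x)) (cvgM (f2 x) (g1 x)).
Qed.

Lemma ccontinuous_sum (I : Type) (r : seq I) (F : I -> R -> R[i]) :
  (forall i, ccontinuous (F i)) -> ccontinuous (fun x => \sum_(i <- r) F i x).
Proof.
move=> mF; elim: r => [|i r ih].
  by apply: ccontinuous_ext (ccontinuous_cst 0) => x; rewrite big_nil.
by apply: ccontinuous_ext (ccontinuousD (mF i) ih) => x; rewrite big_cons.
Qed.

Lemma is_cderive_continuous (f d : R -> R[i]) :
  (forall x, is_cderive f x (d x)) -> ccontinuous f.
Proof.
by move=> h; split => x; have [h1 h2] := h x;
  apply: differentiable_continuous; apply/derivable1_diffP; exact: ex_derive.
Qed.

End ComplexMeasurable.

(** * Lebesgue integration and polynomial weights *)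

Section Integration.
Variable R : realType.
Local Notation Re := (@complex.Re R).
Local Notation Im := (@complex.Im R).
Local Notation mu := (@lebesgue_measure R).
Implicit Types (f g : R -> R).

Definition integr f := mu.-integrable setT (EFin \o f).

Lemma integr_measurable f : integr f -> measurable_fun setT f.
Proof. by move=> /measurable_int /measurable_EFinP. Qed.

Lemma integr_ext f g : f =1 g -> integr f -> integr g.
Proof. by move=> /funext ->. Qed.

Lemma integrD f g : integr f -> integr g -> integr (fun x => f x + g x).
Proof.
by move=> fi gi; rewrite /integr [_ \o _](_ : _ = (EFin \o f) \+ (EFin \o g))%E //; exact: integrableD.
Qed.

Lemma integrZ (k : R) f : integr f -> integr (fun x => k * f x).
Proof.
move=> fi; rewrite /integr [_ \o _](_ : _ = (fun x => k%:E * (EFin \o f) x)%E) //.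
exact: integrableZl.
Qed.

Lemma integr_norm f : integr f -> integr (fun x => `|f x|).
Proof. exact: integrable_norm. Qed.

Lemma integr_le f g : measurable_fun setT f -> (forall x, `|f x| <= g x) ->
  integr g -> integr f.
Proof.
move=> mf fg; apply: le_integrable => //; first exact/measurable_EFinP.
by move=> x _ /=; rewrite lee_fin (le_trans (fg x)) // ler_norm.
Qed.

Lemma integr0 : integr (fun=> 0).
Proof. exact: integrable0. Qed.

Lemma ae_mono (P Q : R -> Prop) : (forall x, P x -> Q x) ->
  {ae mu, forall x, P x} -> {ae mu, forall x, Q x}.
Proof. by move=> PQ; apply: (@filterS _ _ (ae_filter_ringOfSetsType mu)). Qed.

Lemma Rintegral_dct (u : nat -> R -> R) f g :
  (forall n, measurable_fun setT (u n)) -> measurable_fun setT f ->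
  {ae mu, forall x, u ^~ x @ \oo --> f x} -> integr g ->
  (forall n x, `|u n x| <= g x) ->
  (\int[mu]_x u n x) @[n --> \oo] --> \int[mu]_x f x.
Proof.
move=> mU mf uf gi ug.
have uf' : {ae mu, forall x, setT x ->
    (fun n => (u n x)%:E) @ \oo --> (f x)%:E}.
  by move: uf; apply: ae_mono => x h _; apply: cvg_EFin => //; exact: nearW.
have [] := @dominated_convergence _ _ R mu setT measurableT
  (fun n => EFin \o u n) (EFin \o f) (EFin \o g).
- by move=> n; apply/measurable_EFinP; exact: mU.
- by apply/measurable_EFinP; exact: mf.
- exact: uf'.
- exact: gi.
- by apply: aeW => x n _ /=; rewrite lee_fin.
move=> fi _ h; apply: fine_cvg.
by rewrite /Rintegral fineK //; exact: integrable_fin_num.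
Qed.

Lemma Rintegral_fubini (F : R * R -> R) f g : measurable_fun setT F ->
  integr f -> integr g -> (forall x y, `|F (x, y)| <= f x * g y) ->
  [/\ integr (fun x => \int[mu]_y F (x, y)), integr (fun y => \int[mu]_x F (x, y)) &
  \int[mu]_x (\int[mu]_y F (x, y)) = \int[mu]_y (\int[mu]_x F (x, y))].
Proof.
move=> mF fi gi Fb.
have mE : measurable_fun setT (EFin \o F) by exact/measurable_EFinP.
have mabs h : integr h -> measurable_fun setT (fun x => `|(h x)%:E|%E).
  by move=> hi; apply: measurableT_comp => //; exact: measurable_int hi.
have Fi : (mu \x mu)%E.-integrable setT (EFin \o F).
  apply/integrable12ltyP => //=.
  have fgi x : (\int[mu]_y `|(F (x, y))%:E| <= (`|f x|)%:E * \int[mu]_y `|(g y)%:E|)%E.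
    rewrite -ge0_integralZl //; last exact: mabs.
    apply: ge0_le_integral => //.
    - apply: measurableT_comp => //.
      by apply/measurable_EFinP; apply: (measurableT_comp mF); exact: measurable_pair1.
    - by apply: measurable_funeM; exact: mabs.
    - by move=> y _; rewrite /= -EFinM lee_fin -normrM (le_trans (Fb _ _)) // ler_norm.
  apply: (@le_lt_trans _ _ (\int[mu]_x ((`|f x|)%:E * \int[mu]_y `|(g y)%:E|))%E).
    apply: ge0_le_integral => //.
    - by move=> x _; exact: integral_ge0.
    - apply: (@measurable_fun_fubini_tonelli_F _ _ _ _ R mu (fun z => `|(F z)%:E|%E)) => //.
      exact: measurableT_comp.
    - by apply: emeasurable_funM => //; exact: mabs.
    - by move=> x _; exact: fgi.
  rewrite ge0_integralZr //; last 2 first.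
  - exact: mabs.
  - exact: integral_ge0.
  rewrite lte_mul_pinfty //.
  - exact: integral_ge0.
  - rewrite ge0_fin_numE; last exact: integral_ge0.
    by have /integrableP[] := fi.
  - by have /integrableP[] := gi.
have i1 x : mu.-integrable setT (fun y => (F (x, y))%:E).
  apply: (@integr_le _ (fun y => f x * g y)) => //.
    by apply: (measurableT_comp mF); exact: measurable_pair1.
  exact: integrZ.
have i2 y : mu.-integrable setT (fun x => (F (x, y))%:E).
  apply: (@integr_le _ (fun x => g y * f x)).
  - by apply: (measurableT_comp mF); exact: measurable_pair2.
  - by move=> x; rewrite mulrC.
  - exact: integrZ.
have e1 : EFin \o (fun x => \int[mu]_y F (x, y)) = fubini_F mu (EFin \o F).
  by apply/funext => x; rewrite /= /Rintegral fineK //; exact: integrable_fin_num.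
have e2 : EFin \o (fun y => \int[mu]_x F (x, y)) = fubini_G mu (EFin \o F).
  by apply/funext => x; rewrite /= /Rintegral fineK //; exact: integrable_fin_num.
split.
- by rewrite /integr e1; exact: integrable_fubini_F.
- apply: (@integr_le _ (fun y => (\int[mu]_x f x) * g y)); last exact: integrZ.
    by apply/measurable_EFinP; rewrite e2; exact: measurable_fubini_G Fi.
  move=> y; apply: (le_trans (le_normr_Rintegral _ (i2 y))) => //.
  rewrite mulrC -RintegralZl //; apply: le_Rintegral => //.
  - exact: integr_norm (i2 y).
  - exact: integrZ.
  - by move=> x _; rewrite mulrC.
rewrite /Rintegral; congr fine.
transitivity (\int[mu]_x fubini_F mu (EFin \o F) x)%E; first by rewrite -e1.
transitivity (\int[mu]_y fubini_G mu (EFin \o F) y)%E; last by rewrite -e2.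
exact: Fubini Fi.
Qed.

(** The weight [(1 + |x|) ^ (- a)], against which integrability is tested: it is
    integrable for [a > 1], and exponents add under products. *)
Definition wgt (a x : R) : R := expR (- a * ln (1 + `|x|)).

Lemma wgt_gt0 a x : 0 < wgt a x. Proof. exact: expR_gt0. Qed.
Lemma wgt_ge0 a x : 0 <= wgt a x. Proof. exact: expR_ge0. Qed.

Lemma gt0_1Dnorm (x : R) : 0 < 1 + `|x|. Proof. by rewrite ltr_pwDl. Qed.

Lemma wgtn n x : wgt n%:R x = (1 + `|x|) ^- n.
Proof.
by rewrite /wgt mulNr expRN mulrC expRM_natr lnK // posrE gt0_1Dnorm.
Qed.

Lemma wgtM a b x : wgt a x * wgt b x = wgt (a + b) x.
Proof. by rewrite /wgt -expRD opprD mulrDl. Qed.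

Lemma wgtN a x : wgt a (- x) = wgt a x.
Proof. by rewrite /wgt normrN. Qed.

Lemma wgt_le1 a x : 0 <= a -> wgt a x <= 1.
Proof.
by move=> a0; rewrite expR_le1 mulNr oppr_le0 mulr_ge0 // ln_ge0 // lerDl.
Qed.

Lemma wgt_le a b x : a <= b -> wgt b x <= wgt a x.
Proof. by move=> ab; rewrite ler_expR ler_wpM2r ?lerN2 // ln_ge0 // lerDl. Qed.

Lemma wgt_continuous a : continuous (wgt a).
Proof.
move=> x; apply: continuous_comp; last exact: continuous_expR.
apply: cvgM; first exact: cvg_cst.
apply: continuous_comp; last exact: continuous_ln (gt0_1Dnorm x).
by apply: cvgD; [exact: cvg_cst|exact: norm_continuous].
Qed.

Lemma measurable_wgt a : measurable_fun setT (wgt a).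
Proof. by apply: continuous_measurable_fun; exact: wgt_continuous. Qed.

Lemma cvg_wgt a : 0 < a -> wgt a x @[x --> +oo] --> (0 : R).
Proof.
move=> a0; apply/cvgr0Pnorm_le => e e0.
exists (expR (- ln e / a)); split; first exact: num_real.
move=> x hx; rewrite ger0_norm ?wgt_ge0 // -[leRHS]lnK ?posrE // ler_expR.
rewrite mulNr lerNl mulrC -ler_pdivrMr // -ler_expR lnK ?posrE ?gt0_1Dnorm //.
by rewrite (le_trans (ltW hx)) // (le_trans (ler_norm x)) // lerDr.
Qed.

Lemma integr_wgt a : 1 < a -> integr (wgt a).
Proof.
move=> a1; have a0 : 0 < a - 1 by rewrite subr_gt0.
apply/integrableP; split; first by apply/measurable_EFinP; exact: measurable_wgt.
under eq_integral do rewrite /= ger0_norm ?wgt_ge0 //.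
rewrite ge0_symfun_integralT; last 3 first.
- exact: wgt_ge0.
- exact: wgt_continuous.
- by move=> x; rewrite /= wgtN.
rewrite [X in (\int[_]_(_ in X) _)%E](_ : _ = `[0, +oo[%classic); last first.
  by apply/seteqP; split => x /=; rewrite in_itv /= andbT.
have dw (x : R) : 0 < x -> is_derive x 1 (fun t => - (a - 1)^-1 * expR (- (a - 1) * ln (1 + t))) (expR (- a * ln (1 + x))).
  move=> x0.
  have h : is_derive x 1 (fun t : R => 1 + t) 1.
    by rewrite -[X in is_derive _ _ _ X]add0r; exact: is_deriveD.
  have x1 : 0 < 1 + x by rewrite addr_gt0.
  have h1 := @is_derive1_comp _ (@ln R) (fun t : R => 1 + t) x _ _ (is_derive1_ln x1) h.
  have h2 := is_deriveZ (- (a - 1)) h1.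
  have h3 := @is_derive1_comp _ (@expR R) _ x _ _ (is_derive_expR _) h2.
  apply: is_derive_ext (is_deriveZ (- (a - 1)^-1) h3) => [t|].
    by [].
  rewrite /GRing.scale /= [X in expR X * _](_ : _ = - (a - 1) * ln (1 + x)) //.
  rewrite (_ : - a * ln (1 + x) = - (a - 1) * ln (1 + x) - ln (1 + x)); last by ring.
  rewrite expRB lnK ?posrE //; field.
  by rewrite !gt_eqF.
have dwgt (x : R) : 0 < x ->
    is_derive x 1 (fun t => - (a - 1)^-1 * wgt (a - 1) t) (wgt a x).
  move=> x0.
  have wE t b : 0 < t -> wgt b t = expR (- b * ln (1 + t)).
    by move=> t0; rewrite /wgt gtr0_norm.
  rewrite (wE _ _ x0); apply: (near_eq_is_derive _ (dw x x0)).
  near=> t; congr (_ * _); apply/esym/wE.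
  by near: t; exact: lt_nbhsr.
rewrite (@ge0_continuous_FTC2y _ (wgt a) (fun t => - (a - 1)^-1 * wgt (a - 1) t) 0 0).
- by rewrite -EFinB -EFinM ltry.
- by move=> x _; exact: wgt_ge0.
- apply: continuous_subspaceT; exact: wgt_continuous.
- by rewrite -[X in _ --> X](mulr0 (- (a - 1)^-1)); apply: cvgM; [exact: cvg_cst|exact: cvg_wgt].
- by move=> x x0; have [] := dwgt x x0.
- apply: cvg_at_right_filter; apply: cvgM; first exact: cvg_cst.
  exact: wgt_continuous.
- move=> x; rewrite in_itv /= andbT => x0.
  by rewrite derive1E; have [_ ->] := dwgt x x0.
Unshelve. all: by end_near. Qed.

Lemma integr_wgt2 : integr (wgt 2%:R).
Proof. by apply: integr_wgt; rewrite ltr1n. Qed.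

End Integration.

(** * Integration of complex-valued functions *)

Section ComplexIntegral.
Variable R : realType.
Local Notation Re := (@complex.Re R).
Local Notation Im := (@complex.Im R).
Local Notation mu := (@lebesgue_measure R).
Implicit Types (f g : R -> R[i]) (h : R -> R).

Definition cintegr f := integr (Re \o f) /\ integr (Im \o f).

Lemma cintegr_ext f g : f =1 g -> cintegr f -> cintegr g.
Proof. by move=> /funext ->. Qed.

Lemma cintegr_measurable f : cintegr f -> cmeasurable f.
Proof. by move=> [f1 f2]; split; exact: integr_measurable. Qed.

Lemma cintegr_le f h : cmeasurable f -> (forall x, cabs (f x) <= h x) ->
  integr h -> cintegr f.
Proof.
move=> [f1 f2] fh hi; split.
  by apply: integr_le hi => // x; exact: le_trans (Re_cabs _) (fh x).
by apply: integr_le hi => // x; exact: le_trans (Im_cabs _) (fh x).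
Qed.

Lemma integr_cabs f : cintegr f -> integr (fun x => cabs (f x)).
Proof.
move=> fi; have [f1 f2] := fi.
apply: (@integr_le _ _ (fun x => `|Re (f x)| + `|Im (f x)|)).
- exact/measurable_cabs/cintegr_measurable.
- by move=> x; rewrite ger0_norm ?cabs_ge0 // cabs_ReIm.
- by apply: integrD; exact: integr_norm.
Qed.

Lemma cintegrD f g : cintegr f -> cintegr g -> cintegr (fun x => f x + g x).
Proof.
move=> [f1 f2] [g1 g2]; split.
  by apply: integr_ext (integrD f1 g1) => x; rewrite /= ReD.
by apply: integr_ext (integrD f2 g2) => x; rewrite /= ImD.
Qed.

Lemma cintegrMl f g (M : R) : cintegr f -> cmeasurable g ->
  (forall x, cabs (g x) <= M) -> cintegr (fun x => g x * f x).
Proof.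
move=> fi mg gM; apply: (@cintegr_le _ (fun x => M * cabs (f x))).
- by apply: cmeasurableM => //; exact: cintegr_measurable.
- by move=> x; rewrite cabsM ler_wpM2r ?cabs_ge0.
- exact/integrZ/integr_cabs.
Qed.

Lemma cintegrZ z f : cintegr f -> cintegr (fun x => z * f x).
Proof.
move=> fi; apply: (@cintegrMl _ (fun=> z) (cabs z)) => //.
exact: cmeasurable_cst.
Qed.

Lemma cintegr_conj f : cintegr f -> cintegr (fun x => (f x)^*).
Proof.
move=> fi; apply: (cintegr_le _ _ (integr_cabs fi)).
  exact/cmeasurable_conj/cintegr_measurable.
by move=> x; rewrite cabs_conj.
Qed.

Lemma cintegr_real h : integr h -> cintegr (fun x => (h x)%:C).
Proof. by move=> hi; split => //; exact: integr0. Qed.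

Lemma cintegr0 : cintegr (fun=> 0).
Proof. by split; exact: integr0. Qed.

Lemma cintegr_sum (I : Type) (r : seq I) (F : I -> R -> R[i]) :
  (forall i, cintegr (F i)) -> cintegr (fun x => \sum_(i <- r) F i x).
Proof.
move=> iF; elim: r => [|i r ih].
  by apply: cintegr_ext cintegr0 => x; rewrite big_nil.
by apply: cintegr_ext (cintegrD (iF i) ih) => x; rewrite big_cons.
Qed.

Lemma eq_cintegral f g : f =1 g -> cintegral f = cintegral g.
Proof. by move=> /funext ->. Qed.

Lemma cintegral0 : cintegral (fun=> 0) = 0 :> R[i].
Proof. by apply: eqC; rewrite /cintegral /= /Rintegral integral0. Qed.

Lemma cintegralD f g : cintegr f -> cintegr g ->
  cintegral (fun x => f x + g x) = cintegral f + cintegral g.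
Proof.
move=> [f1 f2] [g1 g2]; apply: eqC; rewrite ?ReImE /cintegral /=.
  rewrite -[RHS]RintegralD //.
  by congr fine; apply: eq_integral => x _; rewrite /= ReD.
rewrite -[RHS]RintegralD //.
by congr fine; apply: eq_integral => x _; rewrite /= ImD.
Qed.

Lemma cintegralZ z f : cintegr f ->
  cintegral (fun x => z * f x) = z * cintegral f.
Proof.
move=> [f1 f2]; apply: eqC; rewrite ?ReImE /cintegral /=.
  rewrite -(RintegralZl (Re z) measurableT f1) -(RintegralZl (Im z) measurableT f2).
  rewrite -[RHS]RintegralB //; try exact: integrZ.
  by congr fine; apply: eq_integral => x _; rewrite /= ReM.
rewrite -(RintegralZl (Re z) measurableT f2) -(RintegralZl (Im z) measurableT f1).
rewrite -[RHS]RintegralD //; try exact: integrZ.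
by congr fine; apply: eq_integral => x _; rewrite /= ImM.
Qed.

Lemma cintegralB f g : cintegr f -> cintegr g ->
  cintegral (fun x => f x - g x) = cintegral f - cintegral g.
Proof.
move=> fi gi; rewrite -[X in _ + X]mulN1r -cintegralZ // -cintegralD //.
  by apply: eq_cintegral => x; rewrite mulN1r.
exact: cintegrZ.
Qed.

Lemma cintegral_sum (I : Type) (r : seq I) (F : I -> R -> R[i]) :
  (forall i, cintegr (F i)) ->
  cintegral (fun x => \sum_(i <- r) F i x) = \sum_(i <- r) cintegral (F i).
Proof.
move=> iF; elim: r => [|i r ih].
  by rewrite big_nil -[RHS]cintegral0; apply: eq_cintegral => x; rewrite big_nil.
rewrite big_cons -ih -cintegralD //; last exact: cintegr_sum.
by apply: eq_cintegral => x; rewrite big_cons.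
Qed.

Lemma cintegral_real h : cintegral (fun x => (h x)%:C) = (\int[mu]_x h x)%:C.
Proof. by apply: eqC => //; rewrite /cintegral /= /Rintegral integral0. Qed.

Lemma cintegral_conj f : cintegr f ->
  cintegral (fun x => (f x)^*) = (cintegral f)^*.
Proof.
move=> [f1 f2]; apply: eqC; rewrite /cintegral /=.
  by congr fine; apply: eq_integral => x _ /=; case: (f x).
rewrite -[RHS]mulN1r -(RintegralZl (-1) measurableT f2).
by congr fine; apply: eq_integral => x _ /=; case: (f x) => a b; rewrite mulN1r.
Qed.

(** The factor 2 comes from estimating real and imaginary parts separately. *)
Lemma cabs_cintegral f h : cintegr f -> (forall x, cabs (f x) <= h x) ->
  integr h -> cabs (cintegral f) <= 2 * \int[mu]_x h x.
Proof.
move=> [f1 f2] fh hi; rewrite (le_trans (cabs_ReIm _)) // mulr_natl mulr2n.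
apply: lerD; apply: (le_trans (le_normr_Rintegral _ _)) => //.
  apply: le_Rintegral => //; first exact: integr_norm.
  by move=> x _; exact: le_trans (Re_cabs _) (fh x).
apply: le_Rintegral => //; first exact: integr_norm.
by move=> x _; exact: le_trans (Im_cabs _) (fh x).
Qed.

Lemma ccvg_unique (u : nat -> R[i]) l l' : ccvg u l -> ccvg u l' -> l = l'.
Proof.
move=> [u1 u2] [v1 v2]; apply: eqC; [exact: cvg_unique u1 v1|exact: cvg_unique u2 v2].
Qed.

Lemma ccvg_ext (u v : nat -> R[i]) l : u =1 v -> ccvg u l -> ccvg v l.
Proof. by move=> /funext ->. Qed.

Lemma ccvg_cst (z : R[i]) : ccvg (fun=> z) z.
Proof. by split; exact: cvg_cst. Qed.

Lemma ccvgD (u v : nat -> R[i]) l l' : ccvg u l -> ccvg v l' ->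
  ccvg (fun n => u n + v n) (l + l').
Proof.
move=> [u1 u2] [v1 v2]; split; rewrite ?Re_compD ?Im_compD ReImE.
  exact: cvgD u1 v1.
exact: cvgD u2 v2.
Qed.

Lemma ccvgM (u v : nat -> R[i]) l l' : ccvg u l -> ccvg v l' ->
  ccvg (fun n => u n * v n) (l * l').
Proof.
move=> [u1 u2] [v1 v2]; split; rewrite ?Re_compM ?Im_compM ReImE.
  exact: cvgB (cvgM u1 v1) (cvgM u2 v2).
exact: cvgD (cvgM u1 v2) (cvgM u2 v1).
Qed.

Lemma ccvg_real (u : nat -> R) (l : R) : u @ \oo --> l ->
  ccvg (fun n => (u n)%:C) l%:C.
Proof. by move=> ul; split => //; exact: cvg_cst. Qed.

Lemma ccvg_comp f (u : nat -> R) (l : R) : ccontinuous f -> u @ \oo --> l ->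
  ccvg (fun n => f (u n)) (f l).
Proof.
move=> [f1 f2] ul; split.
  exact: (cvg_comp _ _ ul (f1 l)).
exact: (cvg_comp _ _ ul (f2 l)).
Qed.

Lemma ccvg_cexp (u : nat -> R[i]) l : ccvg u l -> ccvg (fun n => cexp (u n)) (cexp l).
Proof.
move=> [u1 u2]; apply: ccvgM.
  by apply: ccvg_real; apply: (cvg_comp _ _ u1); exact: continuous_expR.
split; rewrite /=.
  by apply: (cvg_comp _ _ u2); exact: continuous_cos.
by apply: (cvg_comp _ _ u2); exact: continuous_sin.
Qed.

Lemma ccvg_cabs (u : nat -> R[i]) l : (fun n => cabs (u n - l)) @ \oo --> (0 : R) ->
  ccvg u l.
Proof.
move=> h; split.
  apply/subr_cvg0; apply: norm_cvg0.
  apply: (@squeeze_cvgr _ _ _ _ (cst 0) (fun n => cabs (u n - l))) => //.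
    apply: nearW => n /=; rewrite normr_ge0 /=.
    by rewrite (le_trans _ (Re_cabs _)) // !ReImE.
  exact: cvg_cst.
apply/subr_cvg0; apply: norm_cvg0.
apply: (@squeeze_cvgr _ _ _ _ (cst 0) (fun n => cabs (u n - l))) => //.
  apply: nearW => n /=; rewrite normr_ge0 /=.
  by rewrite (le_trans _ (Im_cabs _)) // !ReImE.
exact: cvg_cst.
Qed.

Lemma cvg_cabs (u : nat -> R[i]) l : ccvg u l ->
  (fun n => cabs (u n)) @ \oo --> cabs l.
Proof.
move=> [u1 u2]; rewrite /cabs.
apply: (cvg_comp (fun n => Re (u n) ^+ 2 + Im (u n) ^+ 2) Num.sqrt);
  last exact: sqrt_continuous.
by apply: cvgD; [exact: cvg_comp u1 (@exprn_continuous _ 2 _)|exact: cvg_comp u2 (@exprn_continuous _ 2 _)].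
Qed.

Lemma cintegral_dct (u : nat -> R -> R[i]) f h :
  (forall n, cmeasurable (u n)) -> cmeasurable f ->
  {ae mu, forall x, ccvg (u ^~ x) (f x)} -> integr h ->
  (forall n x, cabs (u n x) <= h x) ->
  ccvg (fun n => cintegral (u n)) (cintegral f).
Proof.
move=> mU [mf1 mf2] uf hi uh; split.
  apply: (@Rintegral_dct _ (fun n => Re \o u n) (Re \o f) h) => //.
  - by move=> n; have [] := mU n.
  - by move: uf; apply: ae_mono => x [].
  - by move=> n x; exact: le_trans (Re_cabs _) (uh n x).
apply: (@Rintegral_dct _ (fun n => Im \o u n) (Im \o f) h) => //.
- by move=> n; have [] := mU n.
- by move: uf; apply: ae_mono => x [].
- by move=> n x; exact: le_trans (Im_cabs _) (uh n x).
Qed.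

Lemma cintegral_fubini (F : R * R -> R[i]) (a b : R -> R) : cmeasurable F ->
  integr a -> integr b -> (forall x y, cabs (F (x, y)) <= a x * b y) ->
  cintegral (fun x => cintegral (fun y => F (x, y))) =
  cintegral (fun y => cintegral (fun x => F (x, y))).
Proof.
move=> [F1 F2] ai bi Fab; apply: eqC; rewrite /cintegral /=.
  by have [] := @Rintegral_fubini _ (Re \o F) a b F1 ai bi
    (fun x y => le_trans (Re_cabs _) (Fab x y)).
by have [] := @Rintegral_fubini _ (Im \o F) a b F2 ai bi
  (fun x y => le_trans (Im_cabs _) (Fab x y)).
Qed.

Lemma cintegral_ext_ae f g : {ae mu, forall x, f x = g x} ->
  cmeasurable f -> cmeasurable g -> cintegral f = cintegral g.
Proof.
move=> fg [f1 f2] [g1 g2]; apply: eqC; rewrite /cintegral /=; congr fine.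
  apply: ae_eq_integral => //; try exact/measurable_EFinP.
  by move: fg; apply: ae_mono => x /= ->.
apply: ae_eq_integral => //; try exact/measurable_EFinP.
by move: fg; apply: ae_mono => x /= ->.
Qed.

(** * Differentiation under the integral and the fundamental theorem *)

Lemma is_cderive_cintegral (F F' : R -> R -> R[i]) h (x : R) :
  (forall x, cintegr (F x)) ->
  (forall x y, is_cderive (F ^~ y) x (F' x y)) ->
  (forall x y, cabs (F' x y) <= h y) -> integr h ->
  is_cderive (fun x => cintegral (F x)) x (cintegral (F' x)).
Proof.
move=> iF dF Fh hi.
have h0 y : 0 <= h y by exact: le_trans (cabs_ge0 _) (Fh 0 y).
have Ix : `]x - 1, x + 1[%classic x by rewrite /= in_itv /= ltrBlDr ltrDl ltr01.
have aux (G G' : R -> R -> R) : (forall x, integr (G x)) ->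
    (forall x y : R, is_derive x 1 (G ^~ y) (G' x y)) ->
    (forall x y, `|G' x y| <= h y) ->
    is_derive x 1 (fun x => \int[mu]_y G x y) (\int[mu]_y G' x y).
  move=> iG dG Gh.
  have pE a y : partial1of2 G a y = G' a y.
    by rewrite partial1of2E; have [_ ->] := dG a y.
  have Gd (a y : R) : derivable (G ^~ y) a 1 by have [] := dG a y.
  have Gb (a y : R) : `|partial1of2 G a y| <= h y by rewrite pE.
  apply: DeriveDef.
    exact: (@derivable_under_integral _ _ _ mu G setT measurableT x (x - 1) (x + 1) Ix (fun a _ => iG a) (fun a y _ _ => Gd a y) h h0 hi (fun a y _ _ => Gb a y)).
  rewrite -derive1E.
  rewrite (@differentiation_under_integral _ _ _ mu G setT measurableT x (x - 1) (x + 1) Ix (fun a _ => iG a) (fun a y _ _ => Gd a y) h h0 hi (fun a y _ _ => Gb a y)).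
  by congr fine; apply: eq_integral => y _; rewrite pE.
split.
  apply: (aux (fun x => Re \o F x) (fun x => Re \o F' x)).
  - by move=> a; have [] := iF a.
  - by move=> a y; have [] := dF a y.
  - by move=> a y; exact: le_trans (Re_cabs _) (Fh a y).
apply: (aux (fun x => Im \o F x) (fun x => Im \o F' x)).
- by move=> a; have [] := iF a.
- by move=> a y; have [] := dF a y.
- by move=> a y; exact: le_trans (Im_cabs _) (Fh a y).
Qed.

(** The fundamental theorem on [-n, n], with [n] tending to infinity. *)
Lemma Rintegral_derive (f g : R -> R) :
  (forall x : R, is_derive x 1 f (g x)) -> continuous g -> integr g ->
  (fun n : nat => f n%:R) @ \oo --> (0 : R) ->
  (fun n : nat => f (- n%:R)) @ \oo --> (0 : R) ->
  \int[mu]_x g x = 0.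
Proof.
move=> df cg gi f0 f0'.
have h1 : (fun n : nat => \int[mu]_x (g \_ `[- n.+1%:R, n.+1%:R]) x) @ \oo --> \int[mu]_x g x.
  apply: (@Rintegral_dct _ _ g (fun x => `|g x|)).
  - move=> n; apply/(measurable_restrictT _ _).1 => //.
    by apply: measurable_funTS; exact: integr_measurable.
  - exact: integr_measurable.
  - apply: aeW => x; apply: cvg_near_cst.
    exists (Num.bound `|x|) => // n /= xn; rewrite patchE mem_set //= in_itv /=.
    rewrite -ler_norml (le_trans (ltW (archi_boundP (normr_ge0 x)))) //.
    by rewrite ler_nat (leq_trans xn).
  - exact: integr_norm.
  - by move=> n x; rewrite patchE; case: ifP => //; rewrite normr0.
apply: (cvg_unique _ h1) => //.
have -> : (fun n : nat => \int[mu]_x (g \_ `[- n.+1%:R, n.+1%:R]) x) =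
          (fun n : nat => f n.+1%:R - f (- n.+1%:R)).
  apply/funext => n; rewrite -Rintegral_mkcond /Rintegral.
  rewrite (@continuous_FTC2 _ g f).
  - by rewrite -EFinB.
  - by rewrite (@lt_trans _ _ 0) // ?oppr_lt0 ltr0n.
  - exact: continuous_subspaceT.
  - have cf : continuous f.
      move=> t; apply: differentiable_continuous; apply/derivable1_diffP.
      by have [] := df t.
    split.
    + by move=> t _; have [] := df t.
    + exact/cvg_at_right_filter/cf.
    + exact/cvg_at_left_filter/cf.
  - by move=> t _; rewrite derive1E; have [_ ->] := df t.
have h2 : (fun n : nat => f n.+1%:R - f (- n.+1%:R)) @ \oo --> (0 - 0 : R).
  by apply: cvgB; [move: f0; rewrite -(cvg_shiftS (fun n : nat => f n%:R))
    |move: f0'; rewrite -(cvg_shiftS (fun n : nat => f (- n%:R)))].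
by rewrite subr0 in h2.
Qed.

End ComplexIntegral.

(** * The Fourier transform *)

Section Fourier.
Variable R : realType.
Local Notation Re := (@complex.Re R).
Local Notation Im := (@complex.Im R).
Local Notation mu := (@lebesgue_measure R).
Implicit Types (f g phi : R -> R[i]) (h : R -> R).

Lemma cintegral_derive g g' (C : R) :
  (forall x, is_cderive g x (g' x)) -> ccontinuous g' -> cintegr g' ->
  (forall x, cabs (g x) <= C * wgt 1 x) -> cintegral g' = 0.
Proof.
move=> dg [c1 c2] [i1 i2] gC.
have w0 : (fun n : nat => C * wgt 1 n%:R) @ \oo --> (0 : R).
  rewrite -[X in _ --> X](mulr0 C); apply: cvgM; first exact: cvg_cst.
  by apply: cvg_comp (cvg_wgt (ltr01 : 0 < 1 :> R)); exact: cvgr_idn.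
have z (u : nat -> R) : (forall n, `|u n| <= C * wgt 1 n%:R) -> u @ \oo --> (0 : R).
  move=> uC; apply: norm_cvg0.
  apply: (@squeeze_cvgr _ _ _ _ (cst 0) (fun n : nat => C * wgt 1 n%:R)) => //.
    by apply: nearW => n /=; rewrite normr_ge0 uC.
  exact: cvg_cst.
apply: eqC.
  apply: (@Rintegral_derive _ (Re \o g)) => //.
  - by move=> x; have [] := dg x.
  - by apply: z => n; exact: le_trans (Re_cabs _) (gC _).
  - by apply: z => n; rewrite -wgtN; exact: le_trans (Re_cabs _) (gC _).
apply: (@Rintegral_derive _ (Im \o g)) => //.
- by move=> x; have [] := dg x.
- by apply: z => n; exact: le_trans (Im_cabs _) (gC _).
- by apply: z => n; rewrite -wgtN; exact: le_trans (Im_cabs _) (gC _).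
Qed.

Lemma ccontinuous_cintegral (F : R -> R -> R[i]) h :
  (forall x, cintegr (F x)) -> (forall y, ccontinuous (F ^~ y)) ->
  (forall x y, cabs (F x y) <= h y) -> integr h ->
  ccontinuous (fun x => cintegral (F x)).
Proof.
move=> iF cF Fh hi.
have aux (G : R -> R -> R) : (forall x, integr (G x)) ->
    (forall y, continuous (G ^~ y)) -> (forall x y, `|G x y| <= h y) ->
    continuous (fun x => \int[mu]_y G x y).
  move=> iG cG Gh x.
  have Ix : x \in `]x - 1, x + 1[%classic.
    by rewrite inE /= in_itv /= ltrBlDr ltrDl ltr01.
  apply: (@continuity_under_integral _ _ _ mu G setT measurableT (x - 1) (x + 1) (fun a _ => iG a) _ h hi _ x Ix).
  - by apply: aeW => y _ a _; exact: cG.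
  - by move=> a _; apply: aeW => y _.
split.
  apply: (aux (fun x => Re \o F x)).
  - by move=> a; have [] := iF a.
  - by move=> y; have [] := cF y.
  - by move=> a y; exact: le_trans (Re_cabs _) (Fh a y).
apply: (aux (fun x => Im \o F x)).
- by move=> a; have [] := iF a.
- by move=> y; have [] := cF y.
- by move=> a y; exact: le_trans (Im_cabs _) (Fh a y).
Qed.

Definition fker (t : R) : R[i] := cexp (- ('i * t%:C)).

Lemma fourierE f xi : fourier f xi = cintegral (fun x => f x * fker (xi * x)).
Proof. by []. Qed.

Lemma cabs_fker t : cabs (fker t) = 1.
Proof. by rewrite /fker cabs_cexp /= !(mul0r, mul1r, subr0, mulr0, oppr0) expR0. Qed.

Lemma cabs_fkerM z t : cabs (z * fker t) = cabs z.
Proof. by rewrite [LHS]cabsM cabs_fker mulr1. Qed.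

Lemma fkerE t : fker t = cos t -i* sin t.
Proof. by rewrite /fker -mulrN -rmorphN cexp_i cosN sinN. Qed.

Lemma fker0 : fker 0 = 1.
Proof. by rewrite fkerE cos0 sin0 oppr0. Qed.

Lemma fkerD s t : fker (s + t) = fker s * fker t.
Proof. by rewrite /fker -cexpD rmorphD /= mulrDr opprD. Qed.

Lemma conj_fker t : (fker t)^* = fker (- t).
Proof. by rewrite !fkerE cosN sinN opprK /= opprK. Qed.

Lemma is_cderive_fker (a x : R) :
  is_cderive (fun x => fker (a * x)) x (- 'i * a%:C * fker (a * x)).
Proof.
apply: is_cderive_cexp.
apply: is_cderive_ext (is_cderiveZ (- 'i * a%:C) (is_cderive_id x)) => [t|].
  by rewrite rmorphM /= mulrA mulNr mulNr.
by rewrite mulr1.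
Qed.

Lemma ccontinuous_fker (a : R) : ccontinuous (fun x => fker (a * x)).
Proof. exact: is_cderive_continuous (is_cderive_fker a). Qed.

Lemma cmeasurable_fker : cmeasurable fker.
Proof.
apply: cmeasurable_ext (ccontinuous_measurable (ccontinuous_fker 1)) => x.
by rewrite mul1r.
Qed.

Lemma cintegr_fker f (a : R) : cintegr f -> cintegr (fun x => f x * fker (a * x)).
Proof.
move=> fi; apply: cintegr_ext (_ : cintegr (fun x => fker (a * x) * f x)).
  by move=> x; rewrite mulrC.
apply: (@cintegrMl _ _ (fun x => fker (a * x)) 1) => //.
  exact/ccontinuous_measurable/ccontinuous_fker.
by move=> x; rewrite cabs_fker.
Qed.

Lemma cabs_fourier f xi : cintegr f ->
  cabs (fourier f xi) <= 2 * \int[mu]_x cabs (f x).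
Proof.
move=> fi; apply: cabs_cintegral; last exact: integr_cabs.
  exact: cintegr_fker.
by move=> x; rewrite cabs_fkerM.
Qed.

Lemma ccontinuous_fourier f : cintegr f -> ccontinuous (fourier f).
Proof.
move=> fi; apply: (@ccontinuous_cintegral (fun xi x => f x * fker (xi * x)) (fun x => cabs (f x))).
- by move=> xi; exact: cintegr_fker.
- move=> x; apply: ccontinuousM; first exact: ccontinuous_cst.
  by apply: ccontinuous_ext (ccontinuous_fker x) => xi; rewrite mulrC.
- by move=> xi x; rewrite cabs_fkerM.
- exact: integr_cabs.
Qed.

Lemma cmeasurable_fourier f : cintegr f -> cmeasurable (fourier f).
Proof. by move=> /ccontinuous_fourier /ccontinuous_measurable. Qed.

Lemma eq_fourier f g : f =1 g -> fourier f =1 fourier g.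
Proof. by move=> /funext ->. Qed.

Lemma fourierD f g xi : cintegr f -> cintegr g ->
  fourier (fun x => f x + g x) xi = fourier f xi + fourier g xi.
Proof.
move=> fi gi; rewrite !fourierE -cintegralD; try exact: cintegr_fker.
by apply: eq_cintegral => x; rewrite mulrDl.
Qed.

Lemma fourierZ z f xi : cintegr f ->
  fourier (fun x => z * f x) xi = z * fourier f xi.
Proof.
move=> fi; rewrite !fourierE -cintegralZ; last exact: cintegr_fker.
by apply: eq_cintegral => x; rewrite mulrA.
Qed.

Lemma is_cderive_fourier f (xi : R) : cintegr f -> cintegr (fun x => x%:C * f x) ->
  is_cderive (fourier f) xi (- 'i * fourier (fun x => x%:C * f x) xi).
Proof.
move=> fi xfi; rewrite -fourierZ //.
apply: (@is_cderive_cintegral _ (fun xi x => f x * fker (xi * x))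
  (fun xi x => (- 'i * (x%:C * f x)) * fker (xi * x)) (fun x => cabs (x%:C * f x))).
- by move=> a; exact: cintegr_fker.
- move=> a x; have := is_cderiveZ (f x) (is_cderive_fker x a).
  apply: is_cderive_ext => [t|]; first by rewrite [x * t]mulrC.
  by rewrite [a * x]mulrC; ring.
- by move=> a x; rewrite cabs_fkerM !cabsM cabsN cabsi mul1r.
- exact: integr_cabs.
Qed.

(** Integration by parts: [g x * fker (xi * x)] has a derivative of integral 0. *)
Lemma fourier_derive g g' (C xi : R) :
  (forall x, is_cderive g x (g' x)) -> ccontinuous g' -> cintegr g' ->
  cintegr g -> (forall x, cabs (g x) <= C * wgt 1 x) ->
  fourier g' xi = 'i * xi%:C * fourier g xi.
Proof.
move=> dg cg' g'i gi gC; apply/eqP; rewrite -subr_eq0 -mulNr !fourierE; apply/eqP.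
rewrite -cintegralZ; last exact: cintegr_fker.
rewrite -cintegralD; [|exact: cintegr_fker|exact/cintegrZ/cintegr_fker].
apply: (@cintegral_derive (fun x => g x * fker (xi * x)) _ C).
- move=> x; apply: is_cderive_ext (is_cderiveM (dg x) (is_cderive_fker xi x)) => //.
  by ring.
- apply: ccontinuousD.
    by apply: ccontinuousM cg' _; exact: ccontinuous_fker.
  apply: ccontinuousM; first exact: ccontinuous_cst.
  apply: ccontinuousM; last exact: ccontinuous_fker.
  exact: is_cderive_continuous dg.
- by apply: cintegrD; [exact: cintegr_fker|exact/cintegrZ/cintegr_fker].
- by move=> x; rewrite cabs_fkerM.
Qed.

(** Both sides are the same double integral. Inversion and Plancherel follow by
    a choice of [phi], and so does the identification of the symbol. *)
Lemma fourier_mult f phi : cintegr f -> cintegr phi ->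
  cintegral (fun xi => phi xi * fourier f xi) =
  cintegral (fun x => f x * fourier phi x).
Proof.
move=> fi phii.
pose F (z : R * R) := phi z.1 * (f z.2 * fker (z.1 * z.2)).
transitivity (cintegral (fun xi => cintegral (fun x => F (xi, x)))).
  by apply: eq_cintegral => xi; rewrite -cintegralZ //; exact: cintegr_fker.
rewrite (@cintegral_fubini _ F (fun xi => cabs (phi xi)) (fun x => cabs (f x))).
- apply: eq_cintegral => x; rewrite fourierE -cintegralZ; last exact: cintegr_fker.
  by apply: eq_cintegral => xi; rewrite /F /= [xi * x]mulrC; ring.
- apply: cmeasurableM.
    apply: (cmeasurable_comp (cintegr_measurable phii)); exact: measurable_fst.
  apply: cmeasurableM.
    apply: (cmeasurable_comp (cintegr_measurable fi)); exact: measurable_snd.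
  apply: (cmeasurable_comp cmeasurable_fker).
  by apply: measurable_funM; [exact: measurable_fst|exact: measurable_snd].
- exact: integr_cabs.
- exact: integr_cabs.
- by move=> xi x; rewrite /F /= mulrA cabs_fkerM cabsM.
Qed.

(** * Affine changes of variable *)

Lemma Rintegral_affine_ge0 (h : R -> R) (c d : R) : 0 < c -> continuous h ->
  (forall x, 0 <= h x) ->
  (\int[mu]_x (h x)%:E = \int[mu]_x (c * h (c * x + d))%:E)%E.
Proof.
move=> c0 ch h0.
have dF (x : R) : is_derive x 1 (fun x => c * x + d) c.
  have := is_deriveD (is_deriveZ c (is_derive_id x 1)) (is_derive_cst d x 1).
  apply: is_derive_ext => //.
  by rewrite /GRing.scale /= mulr1 addr0.
have dF1 : derive1 (fun x : R => c * x + d) = cst c.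
  by apply/funext => x; rewrite derive1E; have [_ ->] := dF x.
rewrite (@increasing_ge0_integration_by_substitutionT _ (fun x => c * x + d) h) //.
- by apply: eq_integral => x _; rewrite dF1 /= mulrC.
- by move=> x y xy; rewrite ltrD2r ltr_pM2l.
- by rewrite dF1; exact: cst_continuous.
- by rewrite dF1; exact: is_cvg_cst.
- by rewrite dF1; exact: is_cvg_cst.
- apply/cvgrNyPle => A; exists ((A - d) / c); split; first exact: num_real.
  by move=> x xA; rewrite -lerBrDr mulrC -ler_pdivlMr // ltW.
- apply/cvgryPge => A; exists ((A - d) / c); split; first exact: num_real.
  by move=> x xA; rewrite -lerBlDr mulrC -ler_pdivrMr // ltW.
Qed.

Lemma continuous_affine (h : R -> R) (c d : R) : continuous h ->
  continuous (fun x => h (c * x + d)).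
Proof.
move=> ch x; apply: continuous_comp; last exact: ch.
apply: cvgD; last exact: cvg_cst.
by apply: cvgM; [exact: cvg_cst|exact: cvg_id].
Qed.

Lemma integr_affine (h : R -> R) (c d : R) : 0 < c -> continuous h -> integr h ->
  integr (fun x => h (c * x + d)).
Proof.
move=> c0 ch hi.
have ci : integr (fun x => c * `|h (c * x + d)|).
  have ca : continuous (fun x => `|h x|).
    by move=> x; apply: continuous_comp; [exact: ch|exact: norm_continuous].
  apply/integrableP; split.
    apply/measurable_EFinP; apply: measurable_funM => //.
    exact: continuous_measurable_fun (@continuous_affine _ c d ca).
  have /integrableP[_] := integr_norm hi.
  congr (_ < _)%E; transitivity (\int[mu]_x `|h x|%:E)%E.
    by apply: eq_integral => x _ /=; rewrite normr_id.
  rewrite (@Rintegral_affine_ge0 (fun x => `|h x|) c d) //.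
  by apply: eq_integral => x _ /=; rewrite normrM normr_id (gtr0_norm c0).
apply: (integr_le _ _ (integrZ c^-1 ci)).
  by apply: continuous_measurable_fun; exact: continuous_affine.
by move=> x; rewrite mulrA mulVf ?mul1r // gt_eqF.
Qed.

Lemma Rintegral_affine (h : R -> R) (c d : R) : 0 < c -> continuous h -> integr h ->
  \int[mu]_x h x = c * \int[mu]_x h (c * x + d).
Proof.
move=> c0 ch hi.
have hi' := integr_affine d c0 ch hi.
have ca : continuous (fun x => `|h x|).
  by move=> x; apply: continuous_comp; [exact: ch|exact: norm_continuous].
have aux (k : R -> R) : continuous k -> (forall x, 0 <= k x) -> integr k ->
    \int[mu]_x k x = c * \int[mu]_x k (c * x + d).
  move=> ck k0 ki; rewrite -RintegralZl //; last exact: integr_affine.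
  by rewrite /Rintegral (@Rintegral_affine_ge0 k c d c0 ck k0).
rewrite (_ : \int[mu]_x h x = \int[mu]_x (h x + `|h x|) - \int[mu]_x `|h x|); last first.
  rewrite RintegralD //; last exact: integr_norm.
  by rewrite addrK.
rewrite (aux (fun x => h x + `|h x|)); last 3 first.
- by move=> x; apply: cvgD; [exact: ch|exact: ca].
- by move=> x; rewrite addrC -lerBlDr sub0r -normrN ler_norm.
- by apply: integrD => //; exact: integr_norm.
rewrite (aux (fun x => `|h x|)) //; last exact: integr_norm.
rewrite -mulrBr -RintegralB //.
- by congr (_ * _); congr fine; apply: eq_integral => x _; rewrite addrK.
- by apply: integrD => //; exact: integr_norm.
- exact: integr_norm.
Qed.

Lemma cintegral_affine f (c d : R) : 0 < c -> ccontinuous f -> cintegr f ->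
  cintegral f = c%:C * cintegral (fun x => f (c * x + d)).
Proof.
move=> c0 [f1 f2] [i1 i2]; apply: eqC; rewrite !ReImE /= mul0r ?subr0 ?addr0.
  exact: (@Rintegral_affine (Re \o f)).
exact: (@Rintegral_affine (Im \o f)).
Qed.

Lemma cintegr_affine f (c d : R) : 0 < c -> ccontinuous f -> cintegr f ->
  cintegr (fun x => f (c * x + d)).
Proof.
move=> c0 [f1 f2] [i1 i2]; split.
  exact: (@integr_affine (Re \o f)).
exact: (@integr_affine (Im \o f)).
Qed.

End Fourier.

(** * Gaussians and Fourier inversion *)

Section Gaussian.
Variable R : realType.
Local Notation Re := (@complex.Re R).
Local Notation Im := (@complex.Im R).
Local Notation mu := (@lebesgue_measure R).
Implicit Types (f g phi : R -> R[i]) (h : R -> R).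

Lemma poly_exp_bound (n : nat) (s : R) : 0 < s ->
  exists C : R, forall x, 0 <= x -> (1 + x) ^+ n * expR (- s * x) <= C.
Proof.
move=> s0.
(* [expR y] dominates [y ^+ n.+1 / n.+1`!] at [y = s * (1 + x)] *)
exists (n.+1`!%:R / s ^+ n.+1 * expR s) => x x0.
have y0 : 0 <= s * (1 + x) by rewrite mulr_ge0 ?addr_ge0 // ltW.
have := expR_ge1Dxn n y0 => h.
have {}h : (s * (1 + x)) ^+ n.+1 / n.+1`!%:R <= expR (s * (1 + x)).
  by apply: le_trans h; rewrite lerDr.
have fp : 0 < n.+1`!%:R :> R by rewrite ltr0n fact_gt0.
have sp : 0 < s ^+ n.+1 by rewrite exprn_gt0.
rewrite (_ : - s * x = s - s * (1 + x)); last by ring.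
rewrite expRB mulrA ler_pdivrMr ?expR_gt0 // mulrAC ler_wpM2r ?expR_ge0 //.
apply: (@le_trans _ _ ((1 + x) ^+ n.+1)).
  by rewrite exprS ler_peMl ?exprn_ge0 ?addr_ge0 // lerDl.
rewrite mulrAC ler_pdivlMr // mulrC [leRHS]mulrC -ler_pdivrMr //.
by rewrite -exprMn.
Qed.

Definition gs (x : R) : R := expR (- (x ^+ 2 / 2)).

Lemma gs_ge0 x : 0 <= gs x. Proof. exact: expR_ge0. Qed.

Lemma gs_even x : gs (- x) = gs x. Proof. by rewrite /gs sqrrN. Qed.

Lemma is_derive_gs (x : R) : is_derive x 1 gs (- x * gs x).
Proof.
have h1 : is_derive x 1 (fun x : R => - (2^-1) * (x * x)) (- x).
  have := is_deriveZ (- (2^-1)) (is_deriveM (is_derive_id x 1) (is_derive_id x 1)).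
  apply: is_derive_ext => //.
  by rewrite /GRing.scale /=; field.
have := @is_derive1_comp _ (@expR R) _ x _ _ (is_derive_expR _) h1.
apply: is_derive_ext => [t|].
  by rewrite /gs /=; congr expR; field.
by rewrite mulrC /gs; congr (_ * expR _); field.
Qed.

Lemma continuous_gs : continuous gs.
Proof.
move=> x; apply: differentiable_continuous; apply/derivable1_diffP.
by have [] := is_derive_gs x.
Qed.

Lemma measurable_gs : measurable_fun setT gs.
Proof. exact: continuous_measurable_fun continuous_gs. Qed.

Lemma gs_bound (n : nat) : exists C : R, forall x, (1 + `|x|) ^+ n * gs x <= C.
Proof.
have [C hC] := @poly_exp_bound n 1 ltr01.
exists (C * expR (2^-1)) => x.
apply: (@le_trans _ _ ((1 + `|x|) ^+ n * expR (-1 * `|x|) * expR 2^-1)); last first.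
  by rewrite ler_wpM2r ?expR_ge0 // hC.
rewrite -mulrA -expRD ler_wpM2l ?exprn_ge0 ?addr_ge0 //.
rewrite ler_expR -real_normK ?num_real // -subr_ge0.
rewrite (_ : _ - _ = (`|x| - 1) ^+ 2 / 2); last by field.
by rewrite divr_ge0 ?sqr_ge0.
Qed.

Lemma gs_wgt (n : nat) : exists C : R, forall x, gs x <= C * wgt n%:R x.
Proof.
have [C hC] := gs_bound n; exists C => x.
by rewrite wgtn ler_pdivlMr ?exprn_gt0 ?gt0_1Dnorm // mulrC.
Qed.

Lemma integr_poly_gs (n : nat) : integr (fun x => (1 + `|x|) ^+ n * gs x).
Proof.
have [C hC] := gs_wgt n.+2.
apply: (integr_le _ _ (integrZ C (@integr_wgt2 R))).
  apply: continuous_measurable_fun => x; apply: cvgM; last exact: continuous_gs.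
  apply: (@cvg_comp _ _ _ (fun x : R => 1 + `|x|) (fun x => x ^+ n)); last exact: exprn_continuous.
  by apply: cvgD; [exact: cvg_cst|exact: norm_continuous].
move=> x; rewrite ger0_norm ?mulr_ge0 ?gs_ge0 ?exprn_ge0 ?addr_ge0 //.
rewrite -ler_pdivlMl ?exprn_gt0 ?gt0_1Dnorm // -wgtn mulrCA wgtM -natrD addn2.
exact: hC.
Qed.

Lemma integr_gs : integr gs.
Proof. by apply: integr_ext (integr_poly_gs 0) => x; rewrite expr0 mul1r. Qed.

Definition gsint : R := \int[mu]_x gs x.

Lemma gsint_gt0 : 0 < gsint.
Proof.
rewrite /gsint (@Rintegral_affine _ gs (Num.sqrt 2) 0) ?sqrtr_gt0 //; last 2 first.
- exact: continuous_gs.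
- exact: integr_gs.
rewrite mulr_gt0 ?sqrtr_gt0 // /Rintegral.
rewrite (_ : (\int[mu]_x _)%E = (Num.sqrt pi)%:E) ?sqrtr_gt0 ?pi_gt0 //.
rewrite -integralT_gauss; apply: eq_integral => x _ /=.
by rewrite /gs /gauss_fun addr0 exprMn sqr_sqrtr // mulrAC divff ?mul1r.
Qed.

Definition cgs (x : R) : R[i] := (gs x)%:C.

Lemma cintegr_cgs : cintegr cgs.
Proof. exact: cintegr_real integr_gs. Qed.

(** Differentiation under the integral and integration by parts show that the
    transform solves [F' = - xi F], the equation of the Gaussian itself. *)
Lemma fourier_cgs xi : fourier cgs xi = (gsint * gs xi)%:C.
Proof.
have dg (x : R) : is_cderive cgs x (- (x%:C * cgs x)).
  rewrite (_ : - _ = (- x * gs x)%:C); last by rewrite rmorphM rmorphN mulNr.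
  exact: is_cderive_real (is_derive_gs x).
have xi1 : cintegr (fun x => x%:C * cgs x).
  apply: cintegr_ext (_ : cintegr (fun x => (x * gs x)%:C)) => [x|].
    by rewrite rmorphM.
  apply: cintegr_real; apply: (integr_le _ _ (integr_poly_gs 1)).
    by apply: measurable_funM => //; exact: measurable_gs.
  by move=> x; rewrite normrM expr1 (ger0_norm (gs_ge0 _)) ler_wpM2r ?gs_ge0 // lerDr.
have [C hC] := gs_wgt 1.
have dF (t : R) : is_cderive (fourier cgs) t (- t%:C * fourier cgs t).
  have := is_cderive_fourier t cintegr_cgs xi1.
  apply: is_cderive_ext => //.
  have := @fourier_derive _ cgs (fun x => -1 * (x%:C * cgs x)) C t.
  move=> /(_ _ _ _ cintegr_cgs) h.
  rewrite fourierZ // in h.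
  have {}h : fourier (fun x : R => x%:C * cgs x) t = - ('i * t%:C * fourier cgs t).
    rewrite -h ?mulN1r ?opprK //.
    - by move=> x; rewrite mulN1r.
    - apply: ccontinuousM; first exact: ccontinuous_cst.
      apply: ccontinuousM; first exact: is_cderive_continuous (@is_cderive_id R).
      exact: is_cderive_continuous dg.
    - exact: cintegrZ.
    - by move=> x; rewrite cabs_real ger0_norm ?gs_ge0.
  rewrite h mulrNN mulrA mulrA -expr2 sqr_i.
  by rewrite mulN1r.
pose E (t : R) := expR (t ^+ 2 / 2).
have dE (t : R) : is_cderive (fun t => (E t)%:C) t (t * E t)%:C.
  apply: is_cderive_real.
  have h1 : is_derive t 1 (fun x : R => 2^-1 * (x * x)) t.
    have := is_deriveZ (2^-1) (is_deriveM (is_derive_id t 1) (is_derive_id t 1)).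
    apply: is_derive_ext => //.
    by rewrite /GRing.scale /=; field.
  have := @is_derive1_comp _ (@expR R) _ t _ _ (is_derive_expR _) h1.
  apply: is_derive_ext => [u|]; rewrite /E /=; first by congr expR; field.
  by rewrite mulrC; congr (_ * expR _); field.
have c0 t : is_cderive (fun t => fourier cgs t * (E t)%:C) t 0.
  have := is_cderiveM (dF t) (dE t); apply: is_cderive_ext => //.
  by rewrite rmorphM /=; ring.
have F0 : fourier cgs 0 = gsint%:C.
  rewrite fourierE -cintegral_real; apply: eq_cintegral => x.
  by rewrite mul0r fker0 mulr1.
have := is_cderive0_cst c0 xi 0.
rewrite F0 [E 0](_ : _ = 1) ?mulr1; last by rewrite /E expr0n mul0r expR0.
move=> h.
have e0 : (E xi)%:C != 0 :> R[i].
  by rewrite realC_eq0 gt_eqF // expR_gt0.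
apply: (mulIf e0); rewrite h -rmorphM /=; congr (_%:C).
by rewrite -mulrA /gs /E -expRD addNr expR0 mulr1.
Qed.

(** The modulated Gaussian whose transform is concentrated near [y] when [c]
    is small. *)
Definition wave (y c xi : R) : R[i] := fker (- y * xi) * (gs (c * xi))%:C.

Lemma cintegr_wave y c : 0 < c -> cintegr (wave y c).
Proof.
move=> c0; apply: (@cintegrMl _ _ (fun xi => fker (- y * xi)) 1).
- apply: cintegr_real.
  apply: integr_ext (integr_affine 0 c0 continuous_gs integr_gs) => x.
  by rewrite addr0.
- exact/ccontinuous_measurable/ccontinuous_fker.
- by move=> x; rewrite cabs_fker.
Qed.

Lemma ccontinuous_cgs : ccontinuous cgs.
Proof. by split; [exact: continuous_gs|move=> x; exact: cvg_cst]. Qed.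

Lemma fourier_wave y c x : 0 < c ->
  fourier (wave y c) x = (gsint / c * gs ((x - y) / c))%:C.
Proof.
move=> c0; have cn0 : c != 0 by rewrite gt_eqF.
pose G u := cgs u * fker ((x - y) / c * u).
have -> : fourier (wave y c) x = cintegral (fun xi => G (c * xi + 0)).
  apply: eq_cintegral => xi; rewrite -/(fker _) /wave /G addr0 mulrAC -fkerD mulrC.
  congr (_ * fker _); field; exact: cn0.
have c1 : c%:C != 0 :> R[i] by rewrite realC_eq0.
apply: (mulfI c1); rewrite -cintegral_affine //.
- rewrite -fourierE fourier_cgs -rmorphM /=; congr (_%:C); field.
  exact: cn0.
- by apply: ccontinuousM; [exact: ccontinuous_cgs|exact: ccontinuous_fker].
- exact/cintegr_fker/cintegr_cgs.
Qed.

Lemma cvg_harmonic_scale (y u : R) :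
  (fun n : nat => n.+1%:R^-1 * u + y) @ \oo --> y.
Proof.
rewrite -[X in _ --> X]add0r -[X in _ --> X + _](mul0r u).
apply: cvgD; last exact: cvg_cst.
by apply: cvgM; [exact: cvg_harmonic|exact: cvg_cst].
Qed.

(** Tested against [wave y c], the multiplication formula averages [g] with a
    Gaussian of width [c] around [y]; let [c] tend to 0. The constant
    [gsint ^+ 2] is 2 pi. *)
Lemma fourier_inversion g (M : R) : ccontinuous g -> cintegr g ->
  (forall x, cabs (g x) <= M) -> cintegr (fourier g) -> forall y,
  cintegral (fun xi => fourier g xi * fker (- y * xi)) = (gsint ^+ 2)%:C * g y.
Proof.
move=> cg gi gM Fi y.
pose c (n : nat) : R := n.+1%:R^-1.
have c0 n : 0 < c n by rewrite invr_gt0 ltr0n.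
have ch : c @ \oo --> (0 : R) by exact: cvg_harmonic.
have L : ccvg (fun n => cintegral (fun xi => wave y (c n) xi * fourier g xi))
    (cintegral (fun xi => fourier g xi * fker (- y * xi))).
  apply: (@cintegral_dct _ _ _ (fun xi => cabs (fourier g xi))).
  - move=> n; apply: cmeasurableM; last exact: cmeasurable_fourier.
    exact/cintegr_measurable/cintegr_wave.
  - by apply: cmeasurableM; [exact: cmeasurable_fourier|exact/ccontinuous_measurable/ccontinuous_fker].
  - apply: aeW => xi; rewrite mulrC; apply: ccvgM; last exact: ccvg_cst.
    rewrite -[fker _ in X in ccvg _ X]mulr1; apply: ccvgM; first exact: ccvg_cst.
    apply: ccvg_real; rewrite -[X in _ --> X](_ : gs 0 = 1); last first.
      by rewrite /gs expr0n mul0r oppr0 expR0.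
    have h : (fun n => c n * (xi : R)) @ \oo --> (0 * (xi : R) : R).
      by apply: cvgM => //; exact: cvg_cst.
    have : (gs \o (fun n => c n * (xi : R))) @ \oo --> gs (0 * (xi : R)).
      by apply: (cvg_comp _ _ h); exact: continuous_gs.
    by rewrite (mul0r (xi : R)).
  - exact: integr_cabs.
  - move=> n xi; rewrite [cabs _]cabsM /wave mulrC [cabs (_ * _)]cabsM cabs_fker mul1r cabs_real.
    rewrite ler_piMr ?cabs_ge0 // ger0_norm ?gs_ge0 // expR_le1 oppr_le0.
    by rewrite divr_ge0 ?sqr_ge0.
have Rr : ccvg (fun n => cintegral (fun xi => wave y (c n) xi * fourier g xi))
    ((gsint ^+ 2)%:C * g y).
  have -> : (fun n => cintegral (fun xi => wave y (c n) xi * fourier g xi)) =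
            (fun n => gsint%:C * cintegral (fun u => g (c n * u + y) * cgs u)).
    apply/funext => n; rewrite fourier_mult //; last exact: cintegr_wave.
    pose H (x : R) := g x * (gs ((x - y) / c n))%:C.
    have cH : ccontinuous H.
      apply: ccontinuousM => //; split => x; last exact: cvg_cst.
      apply: (cvg_comp (fun x => (x - y) / c n) gs); last exact: continuous_gs.
      apply: cvgM; last exact: cvg_cst.
      by apply: cvgB; [exact: cvg_id|exact: cvg_cst].
    have iH : cintegr H.
      apply: cintegr_ext (_ : cintegr (fun x => (gs ((x - y) / c n))%:C * g x)) => [x|].
        by rewrite mulrC.
      apply: (@cintegrMl _ _ _ 1) => //.
        apply: cmeasurable_real; apply: (measurableT_comp measurable_gs).
        by apply: measurable_funM => //; apply: measurable_funB.
      move=> x; rewrite cabs_real ger0_norm ?gs_ge0 // expR_le1 oppr_le0.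
      by rewrite divr_ge0 ?sqr_ge0.
    transitivity (cintegral (fun x => (gsint / c n)%:C * H x)).
      apply: eq_cintegral => x; rewrite fourier_wave // /H rmorphM /=; ring.
    rewrite (cintegralZ (gsint / c n)%:C iH).
    rewrite [X in _ * X = _](cintegral_affine y (c0 n) cH iH).
    have e1 : (gsint / c n)%:C * (c n)%:C = gsint%:C :> R[i].
      by rewrite -rmorphM /= divfK // gt_eqF.
    rewrite [LHS]mulrA e1; congr (_ * _).
    apply: eq_cintegral => u; rewrite /H /cgs addrK; congr (_ * (gs _)%:C).
    by rewrite mulrAC divff ?mul1r // gt_eqF.
  rewrite expr2 rmorphM /= -mulrA; apply: ccvgM; first exact: ccvg_cst.
  have -> : gsint%:C * g y = cintegral (fun u => g y * cgs u).
    have cint : cintegral cgs = gsint%:C by exact: cintegral_real.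
    by rewrite (cintegralZ (g y) cintegr_cgs) cint [RHS]mulrC.
  apply: (@cintegral_dct _ _ _ (fun u => M * gs u)).
  - move=> n; apply: cmeasurableM; last exact/ccontinuous_measurable/ccontinuous_cgs.
    apply: (cmeasurable_comp (ccontinuous_measurable cg)).
    by apply: measurable_funD => //; exact: measurable_funM.
  - apply: cmeasurableM; first exact: cmeasurable_cst.
    exact/ccontinuous_measurable/ccontinuous_cgs.
  - apply: aeW => u; apply: ccvgM; last exact: ccvg_cst.
    apply: (@ccvg_comp _ g (fun n => c n * u + y)) => //.
    exact: cvg_harmonic_scale.
  - exact/integrZ/integr_gs.
  - move=> n u; rewrite cabsM cabs_real (ger0_norm (gs_ge0 _)).
    by rewrite ler_wpM2r ?gs_ge0.
exact: ccvg_unique L Rr.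
Qed.

Lemma fourier_inj0 g (M : R) : ccontinuous g -> cintegr g ->
  (forall x, cabs (g x) <= M) -> (forall xi, fourier g xi = 0) -> forall y, g y = 0.
Proof.
move=> cg gi gM /funext F0 y.
have Fi : cintegr (fourier g) by rewrite F0; exact: cintegr0.
have := fourier_inversion cg gi gM Fi y.
rewrite F0 (@eq_cintegral _ _ (fun=> 0)) ?cintegral0; last first.
  by move=> xi; rewrite mul0r.
move/esym/eqP; rewrite mulf_eq0 => /orP[/eqP /complexI /eqP|/eqP //].
by rewrite sqrf_eq0 gt_eqF // gsint_gt0.
Qed.

(** The multiplication formula for the conjugate of the transform, whose own
    transform is known by inversion. *)
Lemma plancherel g (M : R) : ccontinuous g -> cintegr g ->
  (forall x, cabs (g x) <= M) -> cintegr (fourier g) ->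
  integr (fun x => cabs (g x) ^+ 2) /\
  \int[mu]_x (cabs (fourier g x) ^+ 2) = gsint ^+ 2 * \int[mu]_x (cabs (g x) ^+ 2).
Proof.
move=> cg gi gM Fi.
have M0 : 0 <= M by exact: le_trans (cabs_ge0 _) (gM 0).
have i2 : integr (fun x => cabs (g x) ^+ 2).
  apply: (integr_le _ _ (integrZ M (integr_cabs gi))).
    by apply: measurable_funX; exact/measurable_cabs/ccontinuous_measurable.
  by move=> x; rewrite ger0_norm ?sqr_ge0 // expr2 ler_wpM2r ?cabs_ge0.
split => //; apply: complexI; rewrite rmorphM /= -!cintegral_real.
have zz (z : R[i]) : (cabs z ^+ 2)%:C = z * z^*.
  by case: z => a b; rewrite sqr_cabs; apply: eqC => /=; ring.
have conji := cintegr_conj Fi.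
transitivity (cintegral (fun x => g x * fourier (fun xi => (fourier g xi)^*) x)).
  rewrite -fourier_mult //; apply: eq_cintegral => xi.
  by rewrite zz mulrC.
rewrite -cintegralZ; last exact: cintegr_real.
apply: eq_cintegral => x.
have -> : fourier (fun xi => (fourier g xi)^*) x = ((gsint ^+ 2)%:C * g x)^*.
  rewrite -(fourier_inversion cg gi gM Fi x) -cintegral_conj; last exact: cintegr_fker.
  apply: eq_cintegral => xi.
  rewrite [RHS]rmorphM; congr (_ * _).
  by rewrite -[RHS]/((fker (- x * xi))^*) conj_fker mulNr opprK.
have -> : ((gsint ^+ 2)%:C * g x)^* = (gsint ^+ 2)%:C * (g x)^*.
  by case: (g x) => a b; apply: eqC => /=; ring.
by rewrite zz; ring.
Qed.

End Gaussian.

(** * Functions orthogonal to all Gaussians *)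

Section Uniqueness.
Variable R : realType.
Local Notation Re := (@complex.Re R).
Local Notation Im := (@complex.Im R).
Local Notation mu := (@lebesgue_measure R).
Implicit Types (h : R -> R).

(** By Lebesgue differentiation, [h] is almost everywhere the limit of its
    averages over small balls. *)
Lemma ae_eq0_ball h : integr h ->
  (forall m r : R, 0 < r -> \int[mu]_x (h x * \1_(ball m r) x) = 0) ->
  {ae mu, forall x, h x = 0}.
Proof.
move=> hi h0.
have hl : locally_integrable setT h by apply: open_integrable_locally => //; exact: openT.
have := lebesgue_differentiation hl.
apply: ae_mono => x.
rewrite /lebesgue_pt => hx.
suff : (`|h x|%:E <= 0)%E by rewrite lee_fin normr_le0 => /eqP.
apply: (cvge_ge _ hx).
near=> r.
have r0 : 0 < r by near: r; exact: nbhs_right_gt.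
have mb : measurable (ball x r) by exact: measurable_ball.
have mbE : mu (ball (x : R) r) = (r *+ 2)%:E := lebesgue_measure_ball (x : R) (ltW r0).
have mbf : (mu (ball (x : R) r) < +oo)%E by rewrite mbE ltry.
have hb : mu.-integrable (ball x r) (EFin \o h) by exact: integrableS hi.
have cb : mu.-integrable (ball x r) (EFin \o cst (h x)).
  by apply: measurable_bounded_integrable => //; exact: bounded_cst.
have e : \int[mu]_(y in ball x r) (h y - h x) = - (h x * (r *+ 2)).
  rewrite RintegralB //.
  rewrite [X in _ - X](_ : _ = h x * (r *+ 2)); last first.
    by rewrite Rintegral_cst //; congr (_ * _); exact: (congr1 fine mbE).
  rewrite (_ : \int[mu]_(y in ball x r) h y = 0) ?sub0r //.
  rewrite -(h0 x r r0) Rintegral_mkcond; apply: eq_Rintegral => y _.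
  by rewrite patchE indicE; case: ifP; rewrite ?mulr1 ?mulr0.
have r2 : 0 < r *+ 2 by rewrite pmulrn_lgt0.
rewrite /davg /iavg [X in (_ <= X^-1 * _)%E]mbE inver gt_eqF // lee_pdivlMl // -EFinM.
rewrite -[leLHS](_ : `|(\int[mu]_(y in ball x r) (h y - h x))%:E|%E = _); last first.
  by rewrite e /= normrN normrM (gtr0_norm r2) mulrC.
have hcb : mu.-integrable (ball x r) (EFin \o (fun y => h y - h x)).
  by apply: (integrableB _ hb cb); exact: measurable_ball.
rewrite abse_EFin EFin_normr_Rintegral //.
by apply: le_abse_integral => //; exact: measurable_int hcb.
Unshelve. all: by end_near. Qed.

Lemma wgt_translate (n : nat) (x u : R) :
  wgt n%:R (u + x) <= wgt n%:R x * (1 + `|u|) ^+ n.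
Proof.
rewrite !wgtn ler_pdivlMl ?exprn_gt0 ?gt0_1Dnorm //.
rewrite ler_pdivrMr ?exprn_gt0 ?gt0_1Dnorm // -exprMn.
rewrite lerXn2r ?nnegrE ?mulr_ge0 ?addr_ge0 //.
have : `|x| <= `|u + x| + `|u|.
  by rewrite -[X in `|X| <= _](addKr u) addrC ler_normB.
have := normr_ge0 u; have := normr_ge0 (u + x).
nra.
Qed.

(** A continuous [chi] with enough decay is the limit of its averages with
    Gaussians of width [1 / n], and by Fubini [h] is orthogonal to these averages,
    hence to [chi]. Trapezoids increasing to the indicator of a ball are of this
    kind, so that [ae_eq0_ball] applies to [h * wgt 1], which is integrable. *)
Lemma ae_eq0_gs h : measurable_fun setT h -> integr (fun x => h x ^+ 2) ->
  (forall y c, 0 < c -> \int[mu]_x (h x * gs ((x - y) / c)) = 0) ->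
  {ae mu, forall x, h x = 0}.
Proof.
move=> mh h2 h0.
pose w := @wgt R 2%:R; pose k x := h x * wgt 1 x.
have hw n : (0 < n)%N -> integr (fun x => h x * wgt n%:R x).
  move=> n0; apply: (@integr_le _ _ (fun x => h x ^+ 2 + wgt 2 x)).
  - by apply: measurable_funM => //; exact: measurable_wgt.
  - move=> x; rewrite normrM (ger0_norm (wgt_ge0 _ _)).
    have w1 : wgt n%:R x <= wgt 1 x by apply: wgt_le; rewrite ler1n.
    apply: (@le_trans _ _ (`|h x| * wgt 1 x)); first by rewrite ler_wpM2l.
    rewrite -[2]natr1 -wgtM -expr2 -real_normK ?num_real //.
    have := sqr_ge0 (`|h x| - wgt 1 x); have := sqr_ge0 (wgt 1 x); have := sqr_ge0 `|h x|.
    nra.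
  - by apply: integrD => //; exact: integr_wgt2.
have test chi : continuous chi -> (exists C, forall x, `|chi x| <= C * wgt 4 x) ->
    \int[mu]_x (h x * chi x) = 0.
  move=> cchi [C hC4].
  have C0 : 0 <= C by rewrite -(pmulr_rge0 _ (wgt_gt0 4 0)) mulrC (le_trans _ (hC4 0)).
  have hC x : `|chi x| <= C * wgt 2 x.
    by rewrite (le_trans (hC4 x)) // ler_wpM2l // wgt_le // ler_nat.
  have mchi := continuous_measurable_fun cchi.
  have hci : integr (fun x => h x * chi x).
    apply: (integr_le _ _ (integrZ C (integr_norm (hw 2 isT)))).
      exact: measurable_funM.
    move=> x; rewrite !normrM mulrCA ler_wpM2l // (ger0_norm (wgt_ge0 _ _)) //.
  pose c (n : nat) : R := n.+1%:R^-1.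
  have c0 n : 0 < c n by rewrite invr_gt0 ltr0n.
  have c1 n : c n <= 1 by rewrite invf_le1 ?ler1n ?ltr0n.
  have wtr n x u : wgt 2 (c n * u + x) <= wgt 2 x * (1 + `|u|) ^+ 2.
    apply: (le_trans (wgt_translate 2 x (c n * u))); rewrite ler_wpM2l ?wgt_ge0 //.
    rewrite lerXn2r ?nnegrE ?addr_ge0 // lerD2l.
    by rewrite normrM gtr0_norm // ler_piMl.
  pose F n (z : R * R) := h z.1 * (chi (c n * z.2 + z.1) * gs z.2).
  have mF n : measurable_fun setT (F n).
    apply: measurable_funM; first exact: measurableT_comp mh measurable_fst.
    apply: measurable_funM; last exact: measurableT_comp (@measurable_gs R) measurable_snd.
    apply: (measurableT_comp mchi); apply: measurable_funD; last exact: measurable_fst.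
    by apply: measurable_funM => //; exact: measurable_snd.
  pose A x := C * `|h x * wgt 2 x|; pose B u := (1 + `|u|) ^+ 2 * @gs R u.
  have FAB n x u : `|F n (x, u)| <= A x * B u.
    rewrite /F /A /B /= !normrM (ger0_norm (gs_ge0 _)) (ger0_norm (wgt_ge0 _ _)).
    rewrite mulrA [leRHS]mulrA ler_wpM2r ?gs_ge0 //.
    rewrite [leRHS](_ : _ = `|h x| * (C * (wgt 2 x * (1 + `|u|) ^+ 2))); last by ring.
    rewrite ler_wpM2l //.
    by rewrite (le_trans (hC _)) // ler_wpM2l.
  have Ai : integr A by apply/integrZ/integr_norm/hw.
  have Bi : integr B by exact: integr_poly_gs.
  have [D hD] := @gs_wgt R 2.
  have D0 : 0 <= D by rewrite -(pmulr_rge0 _ (wgt_gt0 2 0)) mulrC (le_trans _ (hD 0)) ?gs_ge0.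
  have chi_i : integr chi.
    apply: (integr_le mchi hC); apply: integrZ; exact: integr_wgt2.
  have gs1 (t : R) : gs t <= 1 by rewrite expR_le1 oppr_le0 divr_ge0 ?sqr_ge0.
  have ccv (y v : R) : (fun n => chi (c n * v + y)) @ \oo --> chi y.
    apply: (cvg_comp (fun n => c n * v + y) chi); last exact: cchi.
    exact: cvg_harmonic_scale.
  have z' n : \int[mu]_x (\int[mu]_u F n (x, u)) = 0.
    pose G (z : R * R) := (c n)^-1 * (h z.1 * chi z.2 * gs ((z.1 - z.2) / c n)).
    have cg (x : R) : continuous (fun v : R => gs ((x - v) / c n)).
      move=> v; apply: (cvg_comp (fun v => (x - v) / c n)); last exact: continuous_gs.
      apply: cvgM; last exact: cvg_cst.
      by apply: cvgB; [exact: cvg_cst|exact: cvg_id].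
    have e x : \int[mu]_u F n (x, u) = \int[mu]_v G (x, v).
      have ki : integr (fun v => chi v * gs ((x - v) / c n)).
        apply: (integr_le _ _ (integr_norm chi_i)).
          by apply: measurable_funM => //; exact: continuous_measurable_fun.
        by move=> v; rewrite normrM ler_piMr // ger0_norm ?gs_ge0.
      have kc : continuous (fun v => chi v * gs ((x - v) / c n)).
        by move=> v; apply: cvgM; [exact: cchi|exact: cg].
      have -> : \int[mu]_v G (x, v) = (c n)^-1 * h x * \int[mu]_v (chi v * gs ((x - v) / c n)).
        rewrite -RintegralZl //; apply: eq_Rintegral => v _.
        by rewrite /G /=; ring.
      rewrite (Rintegral_affine x (c0 n) kc ki) mulrA.
      rewrite [_^-1 * _ * _]mulrAC mulVf ?gt_eqF // mul1r.
      have ai := integr_affine x (c0 n) kc ki.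
      rewrite -(RintegralZl (h x) measurableT ai).
      apply: eq_Rintegral => u _; rewrite /F /=; congr (_ * (_ * _)).
      by rewrite opprD addrCA subrr addr0 mulNr gs_even mulrAC divff ?mul1r // gt_eqF.
    under eq_Rintegral do rewrite e.
    pose A' x := (c n)^-1 * D * C * `|h x * wgt 2 x|; pose B' := @wgt R 2.
    have mG : measurable_fun setT G.
      apply: measurable_funM => //; apply: measurable_funM.
        by apply: measurable_funM; [exact: measurableT_comp mh measurable_fst|exact: measurableT_comp mchi measurable_snd].
      apply: (measurableT_comp (@measurable_gs R)); apply: measurable_funM => //.
      by apply: measurable_funB; [exact: measurable_fst|exact: measurable_snd].
    have b1 x v : gs ((x - v) / c n) <= D * (wgt 2 x * (1 + `|v|) ^+ 2).
      rewrite (le_trans (hD _)) // ler_wpM2l //.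
      apply: (@le_trans _ _ (wgt 2 (x - v))).
        rewrite !(wgtn 2%N) lef_pV2 ?posrE ?exprn_gt0 ?gt0_1Dnorm //.
        rewrite lerXn2r ?nnegrE ?addr_ge0 // lerD2l normrM ler_peMr //.
        by rewrite gtr0_norm ?invr_gt0 // invf_ge1.
      by have := wgt_translate 2 x (- v); rewrite normrN addrC.
    have GAB x v : `|G (x, v)| <= A' x * B' v.
      rewrite /G /A' /B' /= !normrM (ger0_norm (gs_ge0 _)) (ger0_norm (wgt_ge0 _ _)).
      rewrite gtr0_norm ?invr_gt0 //.
      have b2 : `|chi v| * (1 + `|v|) ^+ 2 <= C * wgt 2 v.
        rewrite -ler_pdivlMr ?exprn_gt0 ?gt0_1Dnorm // -mulrA -(wgtn 2%N) wgtM -natrD.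
        exact: hC4.
      rewrite -!mulrA ler_wpM2l ?invr_ge0 ?(ltW (c0 _)) //.
      apply: (@le_trans _ _ (`|h x| * (`|chi v| * (D * (wgt 2 x * (1 + `|v|) ^+ 2))))).
        by rewrite ler_wpM2l // ler_wpM2l.
      rewrite [leLHS](_ : _ = D * `|h x| * wgt 2 x * (`|chi v| * (1 + `|v|) ^+ 2)); last by ring.
      rewrite [leRHS](_ : _ = D * `|h x| * wgt 2 x * (C * wgt 2 v)); last by ring.
      by rewrite ler_wpM2l // !mulr_ge0 // wgt_ge0.
    have [_ _ ->] := Rintegral_fubini mG (integrZ _ (integr_norm (hw 2 isT))) (@integr_wgt2 R) GAB.
    transitivity (\int[mu]_(v in setT) (0 : R)); last by rewrite Rintegral_cst // mul0r.
    apply: eq_Rintegral => v _.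
    have hgi : integr (fun x => h x * gs ((x - v) / c n)).
      apply: (integr_le _ _ (integrZ (D * (1 + `|v|) ^+ 2) (integr_norm (hw 2 isT)))).
        apply: measurable_funM => //; apply: (measurableT_comp (@measurable_gs R)).
        by apply: measurable_funM => //; exact: measurable_funB.
      move=> x; rewrite !normrM (ger0_norm (wgt_ge0 _ _)) (ger0_norm (gs_ge0 _)).
      rewrite [leRHS](_ : _ = `|h x| * (D * (wgt 2 x * (1 + `|v|) ^+ 2))); last by ring.
      by rewrite ler_wpM2l.
    transitivity (\int[mu]_x ((c n)^-1 * chi v * (h x * gs ((x - v) / c n)))).
      by apply: eq_Rintegral => x _; rewrite /G /=; ring.
    by rewrite RintegralZl // h0 // mulr0.
  have [iF _ _] := Rintegral_fubini (mF 0%N) Ai Bi (FAB 0%N).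
  have L : (fun n => \int[mu]_x (\int[mu]_u F n (x, u))) @ \oo --> \int[mu]_x (h x * chi x * @gsint R).
    apply: (@Rintegral_dct _ _ _ (fun x => A x * \int[mu]_u B u)).
    - by move=> n; have [iFn _ _] := Rintegral_fubini (mF n) Ai Bi (FAB n); exact: integr_measurable.
    - by apply: measurable_funM => //; exact: measurable_funM.
    - apply: aeW => x.
      have -> : h x * chi x * @gsint R = \int[mu]_u (h x * chi x * gs u).
        by rewrite RintegralZl //; exact: integr_gs.
      apply: (@Rintegral_dct _ _ _ (fun u => A x * B u)).
      + by move=> n; apply: (measurableT_comp (mF n)); exact: measurable_pair1.
      + by apply: measurable_funM => //; exact: measurable_gs.
      + apply: aeW => u; rewrite /F /= -mulrA; apply: cvgM; first exact: cvg_cst.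
        apply: cvgM; last exact: cvg_cst.
        exact: ccv.
      + exact: integrZ.
      + by move=> n u; exact: FAB.
    - by apply: integr_ext (integrZ (\int[mu]_u B u) Ai) => x; rewrite mulrC.
    - move=> n x; rewrite -RintegralZl //.
      have Fi : integr (fun u => F n (x, u)).
        apply: (integr_le _ _ (integrZ (A x) Bi)) => //.
        by apply: (measurableT_comp (mF n)); exact: measurable_pair1.
      apply: (le_trans (le_normr_Rintegral _ Fi)) => //.
      apply: le_Rintegral => //; [exact: integr_norm|exact: integrZ].
  move: L; under eq_fun do rewrite z'.
  move=> L; have /eqP : \int[mu]_x (h x * chi x * @gsint R) = 0.
    by apply: (cvg_unique _ L) => //; exact: cvg_cst.
  rewrite RintegralZr // mulf_eq0 => /orP[/eqP //|].
  by rewrite gt_eqF // gsint_gt0.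
have ki : integr k by exact: hw 1%N isT.
suff : {ae mu, forall x, k x = 0}.
  apply: ae_mono => x /eqP.
  by rewrite mulf_eq0 (gt_eqF (wgt_gt0 _ _)) orbF => /eqP.
apply: ae_eq0_ball => // m r r0.
(* trapezoids of height 1 supported in the ball *)
pose chi (n : nat) x := Num.min 1 (n%:R * Num.max 0 (r - `|m - x|)).
have chi0 n x : 0 <= chi n x.
  by rewrite le_min ler01 mulr_ge0 // le_max lexx.
have chi_out n x : r <= `|m - x| -> chi n x = 0.
  move=> rx; rewrite /chi (max_idPl _) ?mulr0; last by rewrite subr_le0.
  by apply/min_idPr.
have cc n : continuous (chi n).
  have c1 : continuous (fun x : R => r - `|m - x|).
    move=> x; apply: cvgB; first exact: cvg_cst.
    by apply: cvg_norm; apply: cvgB; [exact: cvg_cst|exact: cvg_id].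
  have c2 : continuous (fun x : R => n%:R * Num.max 0 (r - `|m - x|)).
    move=> x; apply: cvgM; first exact: cvg_cst.
    by apply: (@continuous_max _ _ (cst 0) (fun x : R => r - `|m - x|)); [exact: cst_continuous|exact: c1].
  by move=> x; apply: (@continuous_min _ _ (cst 1) (fun x : R => n%:R * Num.max 0 (r - `|m - x|))); [exact: cst_continuous|exact: c2].
have T n : \int[mu]_x (k x * chi n x) = 0.
  rewrite -[RHS](test (fun x => wgt 1 x * chi n x)).
  - by apply: eq_Rintegral => x _; rewrite /k mulrA.
  - by move=> x; apply: cvgM; [exact: wgt_continuous|exact: cc].
  exists ((1 + (`|m| + r)) ^+ 4) => x.
  case: (leP r `|m - x|) => rx.
    by rewrite chi_out // mulr0 normr0 mulr_ge0 ?wgt_ge0 ?exprn_ge0 // !addr_ge0 // ltW.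
  rewrite (@wgtn _ 4) ler_pdivlMr ?exprn_gt0 ?gt0_1Dnorm // normrM.
  rewrite (ger0_norm (wgt_ge0 _ _)) (ger0_norm (chi0 _ _)).
  apply: (@le_trans _ _ (1 * (1 + `|x|) ^+ 4)).
    rewrite ler_wpM2r ?exprn_ge0 ?addr_ge0 //.
    by rewrite mulr_ile1 ?wgt_ge0 ?wgt_le1 // ge_min lexx.
  have r0' := ltW r0.
  rewrite mul1r lerXn2r ?nnegrE ?addr_ge0 // lerD2l.
  have : `|x| <= `|m| + `|m - x|.
    by rewrite -[X in `|X| <= _](subKr m) ler_normB.
  by move=> /le_trans; apply; rewrite lerD2l ltW.
have : (fun n => \int[mu]_x (k x * chi n x)) @ \oo --> \int[mu]_x (k x * \1_(ball m r) x).
  apply: (@Rintegral_dct _ _ _ (fun x => `|k x|)).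
  - move=> n; apply: measurable_funM; first exact: integr_measurable.
    exact: continuous_measurable_fun.
  - apply: measurable_funM; first exact: integr_measurable.
    by apply: measurable_indic; exact: measurable_ball.
  - apply: aeW => x; apply: cvgM; first exact: cvg_cst.
    case: (leP r `|m - x|) => rx.
      rewrite indicE memNset /=; last by rewrite /ball /=; apply/negP; rewrite -leNgt.
      by under eq_fun do rewrite chi_out //; exact: cvg_cst.
    rewrite indicE mem_set //; apply: cvg_near_cst.
    have d0 : 0 < r - `|m - x| by rewrite subr_gt0.
    exists (Num.bound (r - `|m - x|)^-1) => // n /= nN.
    rewrite /chi (max_idPr _) ?(ltW d0) //; apply/min_idPl.
    rewrite -ler_pdivrMr // mul1r (le_trans (ltW (archi_boundP _))) ?ler_nat //.
    by rewrite invr_ge0 ltW.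
  - exact: integr_norm.
  - move=> n x; rewrite normrM ler_piMr // ger0_norm //.
    by rewrite ge_min lexx.
under eq_fun do rewrite T; move=> L.
by apply: (cvg_unique _ L) => //; exact: cvg_cst.
Qed.

End Uniqueness.

(** * Truncated complex powers and the Gamma integral *)

Section TruncatedPower.
Variable R : realType.
Local Notation Re := (@complex.Re R).
Local Notation Im := (@complex.Im R).
Local Notation mu := (@lebesgue_measure R).
Implicit Types (s z : R[i]) (t : R).

Lemma realCV (x : R) : (x^-1)%:C = (x%:C)^-1 :> R[i].
Proof. exact: fmorphV. Qed.

Definition tpow s t : R[i] := if 0 < t then cexp (s * (ln t)%:C) else 0.

Lemma tpow_gt0 s t : 0 < t -> tpow s t = cexp (s * (ln t)%:C).
Proof. by rewrite /tpow => ->. Qed.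

Lemma tpow_le0 s t : t <= 0 -> tpow s t = 0.
Proof. by rewrite /tpow leNgt => /negbTE ->. Qed.

Lemma cabs_tpow s t : 0 < t -> cabs (tpow s t) = expR (Re s * ln t).
Proof. by move=> t0; rewrite tpow_gt0 // cabs_cexp ReM /= mulr0 subr0. Qed.

Lemma tpowS s t : t%:C * tpow s t = tpow (s + 1) t.
Proof.
have [t0|t0] := ltP 0 t; last by rewrite !tpow_le0 // mulr0.
rewrite !tpow_gt0 // mulrDl mul1r cexpD cexp_real lnK ?posrE //.
by rewrite [RHS]mulrC.
Qed.

Lemma tpow1 s : tpow s 1 = 1.
Proof. by rewrite tpow_gt0 // ln1 mulr0 cexp0. Qed.

Lemma tpowZ s (c : R) t : 0 < c -> tpow s (c * t) = cexp (s * (ln c)%:C) * tpow s t.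
Proof.
move=> c0; have [t0|t0] := ltP 0 t; last first.
  by rewrite !tpow_le0 ?mulr0 // pmulr_rle0.
rewrite !tpow_gt0 ?mulr_gt0 // lnM ?posrE // -cexpD -mulrDr.
by rewrite -rmorphD.
Qed.

Lemma near_is_cderive (f g : R -> R[i]) t d :
  (\forall u \near t, f u = g u) -> is_cderive f t d -> is_cderive g t d.
Proof.
move=> fg [d1 d2]; split.
  by apply: near_eq_is_derive d1; apply: filterS fg => u /= ->.
by apply: near_eq_is_derive d2; apply: filterS fg => u /= ->.
Qed.

Lemma is_cderive_tpow_gt0 s t : 0 < t -> is_cderive (tpow s) t (s * tpow (s - 1) t).
Proof.
move=> t0.
have nt : t%:C != 0 :> R[i] by rewrite realC_eq0 gt_eqF.
apply: (@near_is_cderive (fun u => cexp (s * (ln u)%:C))).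
  near=> u; rewrite tpow_gt0 //; near: u; exact: lt_nbhsr.
have := is_cderive_cexp (is_cderiveZ s (is_cderive_real (is_derive1_ln t0))).
apply: is_cderive_ext => //.
rewrite -[X in _ = _ * X](mulKf nt) [t%:C * _]tpowS subrK tpow_gt0 //.
by rewrite realCV [RHS]mulrA.
Unshelve. all: by end_near. Qed.

Lemma is_cderive_tpow_lt0 s t : t < 0 -> is_cderive (tpow s) t 0.
Proof.
move=> t0; apply: (@near_is_cderive (fun=> 0)); last exact: is_cderive_cst.
near=> u; rewrite tpow_le0 // ltW //; near: u; exact: lt_nbhsl.
Unshelve. all: by end_near. Qed.

Lemma tpow_cvg0 s (e : R) : 0 < Re s -> 0 < e ->
  \forall t \near (0 : R), cabs (tpow s t) <= e.
Proof.
move=> s0 e0; near=> t.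
have [t0|t0] := ltP 0 t; last by rewrite tpow_le0 // cabs0 ltW.
rewrite cabs_tpow // -[leRHS]lnK ?posrE // ler_expR mulrC -ler_pdivlMr //.
rewrite -ler_expR lnK ?posrE //.
near: t; apply: filterS (lt_nbhsl (expR_gt0 (ln e / Re s))) => t; exact: ltW.
Unshelve. all: by end_near. Qed.

Lemma ccontinuous_tpow s : 0 < Re s -> ccontinuous (tpow s).
Proof.
move=> s0.
have aux t d : is_cderive (tpow s) t d ->
    {for t, continuous (Re \o tpow s)} /\ {for t, continuous (Im \o tpow s)}.
  by move=> [d1 d2]; split; apply: differentiable_continuous;
    apply/derivable1_diffP; exact: ex_derive.
have aux0 : {for 0, continuous (Re \o tpow s)} /\ {for 0, continuous (Im \o tpow s)}.
  split; apply/(@cvgrPdist_le _ R^o) => e e0; apply: filterS (tpow_cvg0 s0 e0) => t.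
    apply: le_trans; rewrite /= [tpow s 0]tpow_le0 //= sub0r normrN.
    exact: Re_cabs.
  apply: le_trans; rewrite /= [tpow s 0]tpow_le0 //= sub0r normrN.
  exact: Im_cabs.
split => t; have [t0|t0|->] := ltgtP t 0.
- by have [] := aux _ _ (is_cderive_tpow_lt0 s t0).
- by have [] := aux _ _ (is_cderive_tpow_gt0 s t0).
- by have [] := aux0.
- by have [] := aux _ _ (is_cderive_tpow_lt0 s t0).
- by have [] := aux _ _ (is_cderive_tpow_gt0 s t0).
- by have [] := aux0.
Qed.

(** At the origin the difference quotient of [tpow s] is [tpow (s - 1)], which is
    continuous and vanishes there. *)
Lemma is_cderive_tpow s t : 1 < Re s -> is_cderive (tpow s) t (s * tpow (s - 1) t).
Proof.
move=> s1; have [t0|t0|->] := ltgtP t 0.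
- by rewrite [tpow (s - 1) _]tpow_le0 ?(ltW t0) // mulr0; exact: is_cderive_tpow_lt0.
- exact: is_cderive_tpow_gt0.
rewrite [tpow (s - 1) _]tpow_le0 // mulr0.
have s0 : 0 < Re (s - 1) by rewrite ReD ReN /= subr_gt0.
have [c1 c2] := ccontinuous_tpow s0.
have e u : tpow s u = u%:C * tpow (s - 1) u by rewrite tpowS subrK.
split; apply/is_derive1_caratheodory.
  exists (Re \o tpow (s - 1)); split => [u||].
  - by rewrite /= !e !ReM /= !mul0r !subr0 mulrC.
  - exact: c1.
  - by rewrite /= tpow_le0.
exists (Im \o tpow (s - 1)); split => [u||].
- by rewrite /= !e !ImM /= !mul0r !addr0 !subr0 mulrC.
- exact: c2.
- by rewrite /= tpow_le0.
Qed.

Lemma tpow_bound s : 0 <= Re s -> exists n, forall t, cabs (tpow s t) <= (1 + `|t|) ^+ n.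
Proof.
move=> s0; exists (Num.bound (Re s)) => t.
have [t0|t0] := ltP 0 t; last first.
  by rewrite tpow_le0 // cabs0 exprn_ge0 // addr_ge0.
rewrite cabs_tpow // gtr0_norm // -[X in X ^+ _]lnK ?posrE ?addr_gt0 //.
rewrite -expRM_natl ler_expR.
have l0 : 0 <= ln (1 + t) by rewrite ln_ge0 // lerDl ltW.
apply: (@le_trans _ _ (Re s * ln (1 + t))).
  by rewrite ler_wpM2l // ler_ln ?posrE ?addr_gt0 // lerDr.
by rewrite ler_wpM2r // ltW // archi_boundP.
Qed.

(** * Exponential damping *)

Definition damp (sg : R) (f : R -> R[i]) t : R[i] := (expR (- sg * t))%:C * f t.

(** The constant serves all [f] with the same polynomial bound at once, in
    particular all partial sums of a series. *)
Lemma damp_wgt (sg K : R) (n m : nat) : 0 < sg -> exists C, forall f : R -> R[i],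
  (forall t, t <= 0 -> f t = 0) -> (forall t, cabs (f t) <= K * (1 + `|t|) ^+ n) ->
  forall t, cabs (damp sg f t) <= C * wgt m%:R t.
Proof.
move=> sg0; have [C hC] := poly_exp_bound (n + m) sg0.
exists (K * C) => f f0 fK t; have K0 : 0 <= K.
  by have := le_trans (cabs_ge0 _) (fK 0); rewrite normr0 addr0 expr1n mulr1.
have [t0|t0] := leP t 0.
  rewrite /damp f0 // mulr0 cabs0 mulr_ge0 ?wgt_ge0 // mulr_ge0 //.
  by apply: le_trans (hC 0 (lexx _)); rewrite mulr_ge0 ?expR_ge0 // exprn_ge0 // addr0.
rewrite wgtn ler_pdivlMr ?exprn_gt0 ?gt0_1Dnorm // /damp cabsM cabs_real.
rewrite (ger0_norm (expR_ge0 _)).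
apply: (@le_trans _ _ (expR (- sg * t) * (K * (1 + `|t|) ^+ n) * (1 + `|t|) ^+ m)).
  by rewrite ler_wpM2r ?exprn_ge0 ?addr_ge0 // ler_wpM2l ?expR_ge0.
rewrite [leLHS](_ : _ = K * ((1 + `|t|) ^+ (n + m) * expR (- sg * t))); last first.
  by rewrite exprD; ring.
by rewrite ler_wpM2l // gtr0_norm // hC // ltW.
Qed.

Lemma cmeasurable_damp (sg : R) (f : R -> R[i]) : cmeasurable f -> cmeasurable (damp sg f).
Proof.
move=> mf; apply: cmeasurableM => //; apply: cmeasurable_real.
by apply: measurableT_comp => //; exact: measurable_funM.
Qed.

Lemma is_derive_exp (sg x : R) :
  is_derive x 1 (fun t => expR (- sg * t)) (- sg * expR (- sg * x)).
Proof.
have h1 : is_derive x 1 (fun t : R => - sg * t) (- sg).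
  have := is_deriveZ (- sg) (is_derive_id x 1); apply: is_derive_ext => //.
  by rewrite /GRing.scale /= mulr1.
have := @is_derive1_comp _ (@expR R) _ x _ _ (is_derive_expR _) h1.
by apply: is_derive_ext => //; rewrite mulrC.
Qed.

Lemma ccontinuous_damp (sg : R) (f : R -> R[i]) : ccontinuous f -> ccontinuous (damp sg f).
Proof.
apply: ccontinuousM.
exact: is_cderive_continuous (fun x => is_cderive_real (is_derive_exp sg x)).
Qed.

Lemma damp_tpow_wgt (sg : R) s (m : nat) : 0 < sg -> 0 <= Re s ->
  exists C, forall t, cabs (damp sg (tpow s) t) <= C * wgt m%:R t.
Proof.
move=> sg0 s0; have [n hn] := tpow_bound s0; have [C hC] := damp_wgt 1 n m sg0.
by exists C; apply: hC => t; [exact: tpow_le0|rewrite mul1r].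
Qed.

Lemma cintegr_damp_tpow (sg : R) s : 0 < sg -> 0 < Re s -> cintegr (damp sg (tpow s)).
Proof.
move=> sg0 s0; have [C hC] := damp_tpow_wgt 2 sg0 (ltW s0).
apply: (cintegr_le _ hC).
  exact/cmeasurable_damp/ccontinuous_measurable/ccontinuous_tpow.
exact/integrZ/integr_wgt2.
Qed.

(** The Gamma integral over the half-line, written over the whole line. *)
Definition cGamma s : R[i] := cintegral (damp 1 (tpow (s - 1))).

(** Both sides solve the same first-order equation in [xi], which comes from
    integrating the derivative of t^s exp(-sg t); they agree at [xi = 0] by
    scaling. *)
Lemma fourier_damp_tpow s (sg xi : R) : 1 < Re s -> 0 < sg ->
  fourier (damp sg (tpow (s - 1))) xi = cGamma s * cexp (- (s * rlog (sg +i* xi))).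
Proof.
move=> s1 sg0.
have s0 : 0 < Re (s - 1) by rewrite ReD ReN /= subr_gt0.
have s0' : 0 < Re s by exact: lt_trans s1.
pose y := damp sg (tpow (s - 1)); pose g := damp sg (tpow s).
have yi : cintegr y by exact: cintegr_damp_tpow.
have gi : cintegr g by exact: cintegr_damp_tpow.
have ty t : t%:C * y t = g t by rewrite /y /g /damp mulrCA tpowS subrK.
have dg t : is_cderive g t (s * y t - sg%:C * g t).
  have := is_cderiveM (is_cderive_real (is_derive_exp sg t)) (is_cderive_tpow t s1).
  apply: is_cderive_ext => //; rewrite rmorphM rmorphN /=.
  by rewrite /g /y /damp; ring.
have yc : ccontinuous y by exact/ccontinuous_damp/ccontinuous_tpow.
have gc : ccontinuous g by exact/ccontinuous_damp/ccontinuous_tpow.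
have [C hC] := damp_tpow_wgt 1 sg0 (ltW s0').
have zne t : sg +i* t != 0 :> R[i].
  by apply/eqP => /(congr1 Re) /= /eqP; rewrite gt_eqF.
have key t : s * fourier y t = (sg +i* t) * fourier g t.
  have h1 : cintegr (fun u => s * y u) by exact: cintegrZ.
  have h2 : cintegr (fun u => - sg%:C * g u) by exact: cintegrZ.
  have h3 : cintegr (fun u => s * y u - sg%:C * g u).
    by apply: cintegr_ext (cintegrD h1 h2) => u; rewrite mulNr.
  have h4 : ccontinuous (fun u => s * y u - sg%:C * g u).
    apply: ccontinuous_ext (_ : ccontinuous (fun u => s * y u + - sg%:C * g u)) => [u|].
      by rewrite mulNr.
    by apply: ccontinuousD; apply: ccontinuousM => //; exact: ccontinuous_cst.
  have := fourier_derive t dg h4 h3 gi hC.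
  rewrite (@eq_fourier _ _ (fun u => s * y u + - sg%:C * g u)); last first.
    by move=> u; rewrite mulNr.
  rewrite fourierD // fourierZ // fourierZ // => /eqP.
  rewrite mulNr subr_eq => /eqP ->; rewrite -mulrDl; congr (_ * _).
  by apply: eqC; rewrite !ReImE /=; ring.
have dy t : is_cderive (fourier y) t (- 'i * (s / (sg +i* t)) * fourier y t).
  have tyi : cintegr (fun t => t%:C * y t) by apply: cintegr_ext gi => u; rewrite ty.
  have := is_cderive_fourier t yi tyi; apply: is_cderive_ext => //.
  rewrite (eq_fourier ty) -!mulrA; congr (_ * _).
  by rewrite mulrCA key mulrA mulVf // mul1r.
have dE t : is_cderive (fun t => cexp (s * rlog (sg +i* t))) t
    (s * ('i / (sg +i* t)) * cexp (s * rlog (sg +i* t))).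
  apply: is_cderive_cexp; apply: is_cderiveZ; apply: is_cderive_rlog => //.
  by split => /=; [exact: is_derive_cst|exact: is_derive_id].
have c0 t : is_cderive (fun t => fourier y t * cexp (s * rlog (sg +i* t))) t 0.
  have := is_cderiveM (dy t) (dE t); apply: is_cderive_ext => //.
  by ring.
have h := is_cderive0_cst c0 xi 0.
have r0 : rlog (sg +i* 0) = (ln sg)%:C.
  rewrite /rlog /= mul0r atan0; congr (_ +i* _).
  by rewrite /cabs /= expr0n addr0 sqrtr_sqr gtr0_norm.
have y0 : fourier y 0 = cGamma s * cexp (- (s * (ln sg)%:C)).
  have -> : fourier y 0 = cintegral y.
    by rewrite fourierE; apply: eq_cintegral => t; rewrite mul0r fker0 mulr1.
  have si : 0 < sg^-1 by rewrite invr_gt0.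
  rewrite (cintegral_affine 0 si yc yi).
  rewrite (@eq_cintegral _ _ (fun t => cexp ((s - 1) * (ln sg^-1)%:C) * damp 1 (tpow (s - 1)) t)).
    rewrite cintegralZ; last exact: cintegr_damp_tpow.
    rewrite mulrA mulrC -/(cGamma s); congr (_ * _).
    rewrite -[sg^-1 in X in X * _]lnK ?posrE // -cexp_real -cexpD.
    congr cexp; rewrite lnV ?posrE // rmorphN /=; ring.
  move=> t; rewrite /y /damp addr0 tpowZ // mulrCA; congr (_ * ((expR _)%:C * _)).
  by rewrite mulrA mulNr divff ?mulN1r ?mulNr ?mul1r // gt_eqF.
rewrite r0 y0 -mulrA -cexpD addNr cexp0 mulr1 in h.
by rewrite -h -mulrA -cexpD subrr cexp0 mulr1.
Qed.

(** If the Gamma integral vanished, so would the Fourier transform of the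
    continuous function [expR (- t) * t_+ ^ (s - 1)], hence the function. *)
Lemma cGamma_neq0 s : 1 < Re s -> cGamma s != 0.
Proof.
move=> s1; apply/negP => /eqP G0.
have s0 : 0 < Re (s - 1) by rewrite ReD ReN /= subr_gt0.
have [C hC] := damp_tpow_wgt 0 (ltr01 : 0 < 1 :> R) (ltW s0).
have hC' t : cabs (damp 1 (tpow (s - 1)) t) <= C.
  by have := hC t; rewrite wgtn expr0 invr1 mulr1.
have Fz xi : fourier (damp 1 (tpow (s - 1))) xi = 0.
  by rewrite fourier_damp_tpow // G0 mul0r.
have := fourier_inj0 (ccontinuous_damp 1 (ccontinuous_tpow s0))
  (cintegr_damp_tpow ltr01 s0) hC' Fz 1.
rewrite /damp tpow1 mulr1 => /complexI /eqP.
by rewrite gt_eqF // expR_gt0.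
Qed.

End TruncatedPower.

(** * The binomial series *)

#[local] Opaque cexp.

Section Binomial.
Variable R : realType.
Local Notation Re := (@complex.Re R).
Local Notation Im := (@complex.Im R).
Implicit Types (s w : R[i]).

(** The coefficient of [w ^+ k] in [(1 - w) ^ s], that is (-1)^k binom(s, k). *)
Fixpoint bcoef s (k : nat) : R[i] :=
  if k is k'.+1 then bcoef s k' * ((k'%:R - s) / k'.+1%:R) else 1.

Lemma natC_neq0 (n : nat) : (n.+1%:R : R[i]) != 0.
Proof. by rewrite pnatr_eq0. Qed.

Lemma cabs_nat (n : nat) : cabs (n%:R : R[i]) = n%:R.
Proof. by rewrite -[n%:R in LHS](rmorph_nat (real_complex R)) cabs_real ger0_norm. Qed.

Lemma rlog1 : rlog (1 : R[i]) = 0.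
Proof. by apply: eqC; rewrite /= ?cabs1 ?ln1 ?mul0r ?atan0. Qed.

(** The ratio [|k - s| / (k + 1)] of consecutive coefficients is at most 1 once
    [k >= Re s + Im s ^+ 2]. *)
Lemma bcoef_bound s : 0 <= Re s -> exists C, forall k, cabs (bcoef s k) <= C.
Proof.
move=> s0; pose K := Num.bound (Re s + Im s ^+ 2).
exists (\sum_(k < K.+1) cabs (bcoef s k)) => k.
have low k' : (k' < K.+1)%N -> cabs (bcoef s k') <= \sum_(k < K.+1) cabs (bcoef s k).
  move=> kK; rewrite (bigD1 (Ordinal kK)) //= lerDl; apply: sumr_ge0 => i _.
  exact: cabs_ge0.
have [/low //|] := ltnP k K.+1.
elim: k => [|k ih] // kK.
have [/low hk|/ih hk] := ltnP k K.+1; apply: le_trans _ hk; rewrite /= cabsM ler_piMr ?cabs_ge0 //.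
all: rewrite cabsM cabsV cabs_nat ler_pdivrMr ?ltr0n // mul1r.
all: rewrite -(@ler_pXn2r _ 2) ?nnegrE ?cabs_ge0 ?ler0n // sqr_cabs.
all: have ek : (k%:R : R[i]) = (k%:R)%:C by rewrite rmorph_nat.
all: rewrite ek !ReImE /= -natr1.
all: have kB : Re s + Im s ^+ 2 <= k%:R
  by rewrite (le_trans (ltW (archi_boundP _))) ?addr_ge0 ?sqr_ge0 // ler_nat.
all: have := sqr_ge0 (Im s); nra.
Qed.

Lemma is_cderive_exprn (k : nat) (r : R) :
  is_cderive (fun r : R => r%:C ^+ k) r (k%:R * r%:C ^+ k.-1).
Proof.
elim: k => [|k ih].
  by apply: is_cderive_ext (is_cderive_cst 1 r) => [t|]; rewrite ?expr0 // mul0r.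
have := is_cderiveM (is_cderive_id r) ih; apply: is_cderive_ext => [t|].
  by rewrite exprS.
case: k {ih} => [|k] /=; first by rewrite mul0r mulr0 addr0.
by rewrite -[k.+2%:R]natr1 mulrDl mul1r exprS; ring.
Qed.

(** The mean value inequality; the factor 2 comes from the two real parts. *)
Lemma cderive_le (F F' : R -> R[i]) (B : R) :
  (forall r : R, 0 <= r <= 1 -> is_cderive F r (F' r)) ->
  (forall r : R, 0 <= r <= 1 -> cabs (F' r) <= B) -> cabs (F 1 - F 0) <= 2 * B.
Proof.
move=> dF F'B.
have aux (f f' : R -> R) : (forall r : R, 0 <= r <= 1 -> is_derive r 1 f (f' r)) ->
    (forall r : R, 0 <= r <= 1 -> `|f' r| <= B) -> `|f 1 - f 0| <= B.
  move=> df f'B.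
  have dfo (r : R) : r \in `]0, 1[ -> is_derive r 1 f (f' r).
    by rewrite in_itv /= => /andP[r0 r1]; apply: df; rewrite !ltW.
  have cf : {within `[0, 1], continuous f}.
    apply: derivable_within_continuous => r; rewrite in_itv /= => r01.
    by have [] := df r r01.
  have [c] := @MVT _ f f' 0 1 ltr01 dfo cf.
  rewrite in_itv /= => /andP[c0 c1] ->; rewrite subr0 mulr1 f'B //.
  by rewrite !ltW.
apply: (le_trans (cabs_ReIm _)); rewrite mulr_natl mulr2n !ReImE.
apply: lerD.
  apply: (aux (Re \o F) (Re \o F')) => r r01; first by have [] := dF r r01.
  exact: le_trans (Re_cabs _) (F'B r r01).
apply: (aux (Im \o F) (Im \o F')) => r r01; first by have [] := dF r r01.
exact: le_trans (Im_cabs _) (F'B r r01).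
Qed.

(** The partial sum at [r w] times [(1 - r w) ^ (- s)] has a derivative in [r]
    that telescopes to a single term, of size [N rho ^ N]; integrate it over
    [0, 1]. *)
Lemma binomial_series s w : 0 <= Re s -> cabs w < 1 ->
  ccvg (fun N => \sum_(k < N) bcoef s k * w ^+ k) (cexp (s * rlog (1 - w))).
Proof.
move=> s0 w1; have [C hC] := bcoef_bound s0.
have C0 : 0 <= C by exact: le_trans (cabs_ge0 _) (hC 0%N).
(* a positive bound, so that [ln rho] makes sense also for [w = 0] *)
pose rho := Num.max (cabs w) 2^-1.
have rho0 : 0 < rho by rewrite lt_max invr_gt0 ltr0n orbT.
have rho1 : rho < 1 by rewrite gt_max w1 invf_lt1 ?ltr0n // ltr1n.
have wr : cabs w <= rho by rewrite le_max lexx.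
pose z (r : R) : R[i] := 1 - w * r%:C.
have zre (r : R) : 0 <= r <= 1 -> 1 - rho <= Re (z r).
  move=> /andP[r0 r1]; rewrite /z !ReImE /= mulr0 subr0 lerB //.
  rewrite (le_trans (ler_norm _)) // normrM (ger0_norm r0).
  rewrite (le_trans _ wr) // (le_trans _ (Re_cabs w)) // ler_piMr //.
have zre0 (r : R) : 0 <= r <= 1 -> 0 < Re (z r).
  by move=> /zre; apply: lt_le_trans; rewrite subr_gt0.
have zabs (r : R) : 0 <= r <= 1 -> 1 - rho <= cabs (z r).
  by move=> r01; rewrite (le_trans (zre r r01)) // (le_trans (ler_norm _)) // Re_cabs.
have zne (r : R) : 0 <= r <= 1 -> z r != 0.
  move=> r01; rewrite -cabs_gt0; apply: lt_le_trans (zabs r r01).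
  by rewrite subr_gt0.
have dz (r : R) : is_cderive z r (- w).
  have := is_cderiveD (is_cderive_cst 1 r) (is_cderiveN (is_cderiveZ w (is_cderive_id r))).
  by apply: is_cderive_ext => //; rewrite add0r mulr1.
pose E r := cexp (- s * rlog (z r)).
have dE r : 0 <= r <= 1 -> is_cderive E r (s * w / z r * E r).
  move=> r01.
  have := is_cderive_cexp (is_cderiveZ (- s) (is_cderive_rlog (zre0 r r01) (dz r))).
  by apply: is_cderive_ext => //; rewrite mulrA mulrNN.
pose M := expR (- (Re s * ln (1 - rho)) + `|Im s| * pi).
have EM r : 0 <= r <= 1 -> cabs (E r) <= M.
  move=> r01; rewrite cabs_cexp ler_expR ReM /= ReN ImN !mulNr opprK lerD //.
    rewrite lerN2 ler_wpM2l // ler_ln ?posrE ?zabs // ?subr_gt0 //.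
    by rewrite cabs_gt0 zne.
  rewrite (le_trans (ler_norm _)) // normrM ler_wpM2l //.
  have /andP[a1 a2] := Im_rlog (z r).
  rewrite ler_norml; have := pi_gt0 R; rewrite /= in a1 a2; lra.
pose G N (r : R) := \sum_(k < N) bcoef s k * w ^+ k * r%:C ^+ k.
have dG N (r : R) : is_cderive (G N) r
    (\sum_(k < N) bcoef s k * w ^+ k * (k%:R * r%:C ^+ k.-1)).
  elim: N => [|N ih].
    rewrite big_ord0; apply: is_cderive_ext (is_cderive_cst 0 r) => // t.
    by rewrite /G big_ord0.
  rewrite big_ord_recr /=.
  have := is_cderiveD ih (is_cderiveZ (bcoef s N * w ^+ N) (is_cderive_exprn N r)).
  by apply: is_cderive_ext => // t; rewrite /G big_ord_recr.
pose rem N (r : R) := N%:R * (bcoef s N * w ^+ N) * r%:C ^+ N.-1.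
have tele N (r : R) : z r * (\sum_(k < N) bcoef s k * w ^+ k * (k%:R * r%:C ^+ k.-1))
    + s * w * G N r = - rem N r.
  elim: N => [|N ih].
    by rewrite /rem /G !big_ord0 !mul0r !mulr0 addr0 oppr0.
  rewrite /G !big_ord_recr /= !mulrDr addrACA -/(G N r) ih /rem /=.
  have e : N.+1%:R * (bcoef s N * ((N%:R - s) / N.+1%:R)) = (N%:R - s) * bcoef s N.
    by rewrite mulrCA [_ / _]mulrC mulVKf ?natC_neq0 // mulrC.
  rewrite [N.+1%:R * (_ * w ^+ _)]mulrA e exprS /z.
  case: N {ih e} => [|N] /=; first by rewrite !expr0; ring.
  by rewrite [r%:C ^+ N.+1]exprS; ring.
pose H N r := G N r * E r.
have dH N r : 0 <= r <= 1 -> is_cderive (H N) r (- rem N r / z r * E r).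
  move=> r01; have := is_cderiveM (dG N r) (dE r r01); apply: is_cderive_ext => //.
  rewrite -tele; set S := \sum_(k < N) _.
  move: S (z r) (E r) (G N r) (zne r r01) => S Z e g nz.
  by field.
have remb N r : 0 <= r <= 1 -> cabs (- rem N r / z r * E r) <= N%:R * rho ^+ N * (C * M / (1 - rho)).
  move=> r01; have r1 : 0 < 1 - rho by rewrite subr_gt0.
  rewrite [cabs _]cabsM cabsM cabsN cabsV /rem cabsM cabsM cabs_nat cabsM !cabsX cabs_real.
  have /andP[r0 r1'] := r01.
  rewrite (ger0_norm r0).
  rewrite [leRHS](_ : _ = N%:R * (C * rho ^+ N) * 1 / (1 - rho) * M); last by ring.
  have z0 : 0 < cabs (z r) by rewrite cabs_gt0 zne.
  rewrite ler_pM ?cabs_ge0 ?EM //.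
    by rewrite !mulr_ge0 ?ler0n ?cabs_ge0 ?exprn_ge0 ?cabs_ge0 // invr_ge0 ltW.
  rewrite ler_pM ?invr_ge0 ?(ltW z0) //.
  - by rewrite !mulr_ge0 ?ler0n ?cabs_ge0 ?exprn_ge0 ?cabs_ge0.
  - rewrite ler_pM ?exprn_ge0 ?exprn_ile1 //.
      by rewrite !mulr_ge0 ?ler0n ?cabs_ge0 ?exprn_ge0 ?cabs_ge0.
    rewrite ler_wpM2l ?ler0n // ler_pM ?cabs_ge0 ?exprn_ge0 ?cabs_ge0 //.
    by rewrite lerXn2r ?nnegrE ?cabs_ge0 // ltW.
  - by rewrite lef_pV2 ?posrE // zabs.
have rho_cvg : (fun N : nat => N%:R * rho ^+ N * (C * M / (1 - rho))) @ \oo --> (0 : R).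
  rewrite -[X in _ --> X](mul0r (C * M / (1 - rho))); apply: cvgM; last exact: cvg_cst.
  have l0 : 0 < - ln rho by rewrite oppr_gt0 ln_lt0 // rho0.
  have [D hD] := poly_exp_bound 2 l0.
  apply: (@squeeze_cvgr _ _ _ _ (cst 0) (fun N : nat => D * N.+1%:R^-1)).
  - apply: nearW => N; rewrite mulr_ge0 ?ler0n ?exprn_ge0 ?(ltW rho0) //=.
    rewrite ler_pdivlMr ?ltr0n //.
    apply: le_trans (hD N%:R (ler0n _ _)); rewrite opprK.
    rewrite mulrC mulrA -[X in _ <= _ * expR (X * _)]opprK opprK.
    rewrite [ln rho * _]mulrC expRM_natl lnK ?posrE // ler_wpM2r ?exprn_ge0 ?(ltW rho0) //.
    by rewrite -natr1 expr2 [1 + _]addrC ler_wpM2l ?lerDl.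
  - exact: cvg_cst.
  - rewrite -[X in _ --> X](mulr0 D); apply: cvgM; [exact: cvg_cst|exact: cvg_harmonic].
have HN : ccvg (fun N => H N 1 - H N 0) 0.
  apply: ccvg_cabs; rewrite [X in X @ _ --> _](_ : _ = fun N => cabs (H N 1 - H N 0)); last first.
    by apply/funext => N; rewrite subr0.
  apply: (@squeeze_cvgr _ _ _ _ (cst 0) (fun N : nat => 2 * (N%:R * rho ^+ N * (C * M / (1 - rho))))).
  - apply: nearW => N /=; rewrite cabs_ge0 /=.
    by apply: cderive_le; [exact: dH|exact: remb].
  - exact: cvg_cst.
  - rewrite -[X in _ --> X](mulr0 2); apply: cvgM => //; exact: cvg_cst.
have E1 : E 0 = 1.
  by rewrite /E /z mulr0 subr0 rlog1 mulr0 cexp0.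
have G1 N : G N.+1 0 = 1.
  rewrite /G big_ord_recl /= !expr0 !mulr1 big1 ?addr0 // => i _.
  by rewrite -[0%:C]/(0 : R[i]) /bump leq0n expr0n mulr0.
have e N : (\sum_(k < N.+1) bcoef s k * w ^+ k) =
    (H N.+1 1 - H N.+1 0) * cexp (s * rlog (1 - w)) + cexp (s * rlog (1 - w)).
  rewrite /H G1 E1 mul1r mulrBl mul1r subrK /E mulNr /z mulr1.
  rewrite -mulrA -cexpD addNr cexp0 mulr1.
  by apply: eq_bigr => k _; rewrite expr1n mulr1.
have S1 : ccvg (fun N => \sum_(k < N.+1) bcoef s k * w ^+ k) (cexp (s * rlog (1 - w))).
  apply: ccvg_ext (_ : ccvg (fun N => (H N.+1 1 - H N.+1 0) * cexp (s * rlog (1 - w)) + cexp (s * rlog (1 - w))) _).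
    by move=> N; rewrite e.
  rewrite -[X in ccvg _ X]add0r -[X in ccvg _ (X + _)](mul0r (cexp (s * rlog (1 - w)))).
  apply: ccvgD; last exact: ccvg_cst.
  apply: ccvgM; last exact: ccvg_cst.
  have [h1 h2] := HN; split.
    by move: h1; rewrite -cvg_shiftS.
  by move: h2; rewrite -cvg_shiftS.
have [h1 h2] := S1; split.
  by rewrite -cvg_shiftS.
by rewrite -cvg_shiftS.
Qed.

End Binomial.

(** * The scalar spline of complex order *)

Section ScalarSpline.
Variable R : realType.
Local Notation Re := (@complex.Re R).
Local Notation Im := (@complex.Im R).
Local Notation mu := (@lebesgue_measure R).
Variable s : R[i].
Hypothesis s1 : 1 < Re s.
Implicit Types (t xi sg : R) (z : R[i]).

Let s0 : 0 < Re (s - 1). Proof. by rewrite ReD ReN /= subr_gt0. Qed.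
Let s0' : 0 < Re s. Proof. exact: lt_trans s1. Qed.

Definition psum (N : nat) t : R[i] :=
  \sum_(k < N) bcoef s k * tpow (s - 1) (t - k%:R).

(** The terms with index at least [t] vanish, so that the partial sums at [t] are
    eventually constant. *)
Definition cspline t : R[i] := psum (Num.truncn t).+1 t.

Lemma psum_stable (M N : nat) t : t <= M%:R -> (M <= N)%N -> psum N t = psum M t.
Proof.
move=> tM MN; rewrite /psum -!(big_mkord xpredT (fun k => bcoef s k * tpow (s - 1) (t - k%:R))).
rewrite (big_cat_nat (leq0n M) MN) /= [X in _ + X = _](_ : _ = 0) ?addr0 //.
rewrite big_nat_cond big1 // => k /andP[/andP[Mk _] _].
by rewrite tpow_le0 ?mulr0 // subr_le0 (le_trans tM) // ler_nat.
Qed.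

Lemma csplineE (N : nat) t : t <= N%:R -> cspline t = psum N t.
Proof.
move=> tN; rewrite /cspline.
have tt : t <= (Num.truncn t).+1%:R by rewrite ltW // truncnS_gt.
case: (leqP N (Num.truncn t).+1) => NN.
  by rewrite (psum_stable tN NN).
by rewrite (psum_stable tt (ltnW NN)).
Qed.

Lemma psum_le0 (N : nat) t : t <= 0 -> psum N t = 0.
Proof.
move=> t0; have t0' : t <= 0%:R by [].
by rewrite (psum_stable t0' (leq0n N)) /psum big_ord0.
Qed.

Lemma cspline_le0 t : t <= 0 -> cspline t = 0.
Proof. exact: psum_le0. Qed.

Lemma ccvg_psum t : ccvg (fun N => psum N t) (cspline t).
Proof.
have e N : (Num.truncn t < N)%N -> psum N t = cspline t.
  by move=> h; apply: psum_stable => //; rewrite ltW // truncnS_gt.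
split; apply: cvg_near_cst; exists (Num.truncn t).+1 => // N /= hN.
  by rewrite e.
by rewrite e.
Qed.

(** At most [1 + |t|] terms are nonzero at [t], with bounded coefficients. *)
Lemma psum_bound : exists K, exists n, forall N t,
  cabs (psum N t) <= K * (1 + `|t|) ^+ n.
Proof.
have [C hC] := bcoef_bound (ltW s0'); have [n hn] := tpow_bound (ltW s0).
have C0 : 0 <= C by exact: le_trans (cabs_ge0 _) (hC 0%N).
exists C; exists n.+1 => N t.
have [t0|t0] := leP t 0.
  by rewrite psum_le0 // cabs0 mulr_ge0 // exprn_ge0 // addr_ge0.
pose m := minn N (Num.truncn t).+1.
have -> : psum N t = psum m t.
  rewrite /m; case: (leqP N (Num.truncn t).+1) => // NN.
  by apply: psum_stable (ltnW NN); rewrite ltW // truncnS_gt.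
have mt : m%:R <= 1 + `|t|.
  apply: (@le_trans _ _ (Num.truncn t).+1%:R); first by rewrite ler_nat geq_minr.
  rewrite -natr1 addrC lerD2l gtr0_norm //.
  by have /andP[] := truncn_itv (ltW t0).
apply: (le_trans (cabs_sum _ _ _)).
apply: (@le_trans _ _ (\sum_(k < m) C * (1 + `|t|) ^+ n)).
  apply: ler_sum => k _; rewrite cabsM ler_pM ?cabs_ge0 //.
  have [tk|tk] := leP (t - k%:R) 0.
    by rewrite tpow_le0 // cabs0 exprn_ge0 // addr_ge0.
  rewrite (le_trans (hn _)) // lerXn2r ?nnegrE ?addr_ge0 // lerD2l.
  by rewrite !gtr0_norm // gerBl.
rewrite sumr_const card_ord -mulr_natr exprSr mulrA.
by rewrite ler_wpM2l // mulr_ge0 // exprn_ge0 // addr_ge0.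
Qed.

Lemma ccontinuous_tpow_shift (k : R) : ccontinuous (fun t => tpow (s - 1) (t - k)).
Proof.
have [c1 c2] := ccontinuous_tpow s0.
have h : continuous (fun t : R => t - k).
  by move=> t; apply: cvgB; [exact: cvg_id|exact: cvg_cst].
split => t.
  by apply: (@continuous_comp _ _ _ (fun t => t - k) (Re \o tpow (s - 1))); [exact: h|exact: c1].
by apply: (@continuous_comp _ _ _ (fun t => t - k) (Im \o tpow (s - 1))); [exact: h|exact: c2].
Qed.

Lemma ccontinuous_psum N : ccontinuous (psum N).
Proof.
apply: ccontinuous_sum => k; apply: ccontinuousM; first exact: ccontinuous_cst.
exact: ccontinuous_tpow_shift.
Qed.

Lemma ccontinuous_cspline : ccontinuous cspline.
Proof.
have near t : \forall u \near t, cspline u = psum (Num.truncn t).+2 u.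
  near=> u; apply: csplineE; apply: ltW.
  near: u; apply: lt_nbhsl; apply: (lt_trans (truncnS_gt t)).
  by rewrite ltr_nat.
split => t; have [c1 c2] := ccontinuous_psum (Num.truncn t).+2; rewrite /continuous_at.
  have -> : (Re \o cspline) t = (Re \o psum (Num.truncn t).+2) t.
    by rewrite /=; congr Re; exact: nbhs_singleton (near t).
  apply: cvg_trans (c1 t); apply: near_eq_cvg.
  by apply: filterS (near t) => u /= ->.
have -> : (Im \o cspline) t = (Im \o psum (Num.truncn t).+2) t.
  by rewrite /=; congr Im; exact: nbhs_singleton (near t).
apply: cvg_trans (c2 t); apply: near_eq_cvg.
by apply: filterS (near t) => u /= ->.
Unshelve. all: by end_near. Qed.

Lemma cmeasurable_cspline : cmeasurable cspline.
Proof. exact/ccontinuous_measurable/ccontinuous_cspline. Qed.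

Lemma damp_cspline_wgt sg (m : nat) : 0 < sg ->
  exists C, forall t, cabs (damp sg cspline t) <= C * wgt m%:R t.
Proof.
move=> sg0; have [K [n h]] := psum_bound; have [C hC] := damp_wgt K n m sg0.
by exists C; apply: hC => t; [exact: cspline_le0|exact: h].
Qed.

Lemma cintegr_damp_cspline sg : 0 < sg -> cintegr (damp sg cspline).
Proof.
move=> sg0; have [C hC] := damp_cspline_wgt 2 sg0.
apply: (cintegr_le _ hC); first exact/cmeasurable_damp/cmeasurable_cspline.
exact/integrZ/integr_wgt2.
Qed.

(** * The Laplace transform of the scalar spline *)

Lemma cintegr_damp_tpow_shift sg (k : nat) : 0 < sg ->
  cintegr (damp sg (fun t => tpow (s - 1) (t - k%:R))).
Proof.
move=> sg0; have [n hn] := tpow_bound (ltW s0).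
have b t : cabs (tpow (s - 1) (t - k%:R)) <= (1 + k%:R) ^+ n * (1 + `|t|) ^+ n.
  rewrite (le_trans (hn _)) // -exprMn lerXn2r ?nnegrE ?mulr_ge0 ?addr_ge0 //.
  have := ler_normB t k%:R; rewrite (ger0_norm (ler0n _ k)).
  have := normr_ge0 t; have := ler0n R k; nra.
have z t : t <= 0 -> tpow (s - 1) (t - k%:R) = 0.
  by move=> t0; rewrite tpow_le0 // subr_le0 (le_trans t0).
have [C hC] := damp_wgt ((1 + k%:R) ^+ n) n 2 sg0.
apply: (cintegr_le _ (hC _ z b)); last exact/integrZ/integr_wgt2.
exact/ccontinuous_measurable/ccontinuous_damp/ccontinuous_tpow_shift.
Qed.

Lemma fourier_damp_tpow_shift sg xi (k : nat) : 0 < sg ->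
  fourier (damp sg (fun t => tpow (s - 1) (t - k%:R))) xi =
  cexp (- (sg +i* xi)) ^+ k * fourier (damp sg (tpow (s - 1))) xi.
Proof.
move=> sg0; pose f t := damp sg (fun t => tpow (s - 1) (t - k%:R)) t * fker (xi * t).
have cf : ccontinuous f.
  apply: ccontinuousM; last exact: ccontinuous_fker.
  exact/ccontinuous_damp/ccontinuous_tpow_shift.
have fi : cintegr f.
  exact/cintegr_fker/cintegr_damp_tpow_shift.
have gi : cintegr (damp sg (tpow (s - 1))) by exact: cintegr_damp_tpow.
rewrite fourierE (cintegral_affine k%:R (ltr01 : 0 < 1 :> R) cf fi) mul1r.
rewrite fourierE -cintegralZ; last exact: cintegr_fker.
apply: eq_cintegral => t; rewrite /f /damp mul1r addrK.
have -> : cexp (- (sg +i* xi)) ^+ k = (expR (- sg * k%:R))%:C * fker (xi * k%:R).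
  rewrite -cexp_nat /fker -cexp_real -cexpD; congr cexp.
  have -> : (k%:R : R[i]) = (k%:R)%:C by rewrite rmorph_nat.
  by apply: eqC; rewrite !ReImE /=; ring.
rewrite mulrDr expRD rmorphM mulrDr fkerD /=; ring.
Qed.

Lemma Re_1Bcexp z : 0 < Re z -> 0 < Re (1 - cexp (- z)).
Proof.
move=> z0; rewrite ReD ReN subr_gt0 /=.
rewrite (le_lt_trans (ler_norm _)) // (le_lt_trans (Re_cabs _)) // cabs_cexp ReN.
by rewrite expR_lt1 oppr_lt0.
Qed.

(** A logarithm of [(1 - cexp (- z)) / z] on the right half-plane, where both the
    numerator and the denominator have positive real part. *)
Definition lbase z : R[i] := rlog (1 - cexp (- z)) - rlog z.

(** Each shift multiplies the transform by [cexp (- z)], where [z = sg + i xi], and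
    the binomial series sums these factors to [(1 - cexp (- z)) ^ s]. *)
Lemma fourier_damp_cspline sg xi : 0 < sg ->
  fourier (damp sg cspline) xi = cGamma s * cexp (s * lbase (sg +i* xi)).
Proof.
move=> sg0; set z := sg +i* xi.
have [K [n h]] := psum_bound.
have [C hC'] := damp_wgt K n 2 sg0.
have hC N : forall t, cabs (damp sg (psum N) t) <= C * wgt 2 t.
  by apply: hC' => // t; exact: psum_le0.
have L : ccvg (fun N => fourier (damp sg (psum N)) xi) (fourier (damp sg cspline) xi).
  apply: (@cintegral_dct _ _ _ (fun t => C * wgt 2 t)).
  - move=> N; apply: cmeasurableM; last exact/ccontinuous_measurable/ccontinuous_fker.
    exact/cmeasurable_damp/ccontinuous_measurable/ccontinuous_psum.
  - apply: cmeasurableM; last exact/ccontinuous_measurable/ccontinuous_fker.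
    exact/cmeasurable_damp/cmeasurable_cspline.
  - apply: aeW => t; apply: ccvgM; last exact: ccvg_cst.
    by apply: ccvgM; [exact: ccvg_cst|exact: ccvg_psum].
  - exact/integrZ/integr_wgt2.
  - by move=> N t; rewrite -/(fker _) cabs_fkerM.
have e N : fourier (damp sg (psum N)) xi =
    fourier (damp sg (tpow (s - 1))) xi * \sum_(k < N) bcoef s k * cexp (- z) ^+ k.
  rewrite big_distrr /= fourierE.
  transitivity (\sum_(k < N) cintegral (fun t => bcoef s k *
      (damp sg (fun t => tpow (s - 1) (t - k%:R)) t * fker (xi * t)))).
    rewrite -cintegral_sum; last by move=> k; exact/cintegrZ/cintegr_fker/cintegr_damp_tpow_shift.
    apply: eq_cintegral => t; rewrite /damp /psum mulr_sumr mulr_suml.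
    by apply: eq_bigr => k _; ring.
  apply: eq_bigr => k _; rewrite cintegralZ; last exact/cintegr_fker/cintegr_damp_tpow_shift.
  by rewrite -fourierE fourier_damp_tpow_shift //; ring.
have w1 : cabs (cexp (- z)) < 1 by rewrite cabs_cexp ReN expR_lt1 oppr_lt0.
have L2 : ccvg (fun N => fourier (damp sg (psum N)) xi)
    (fourier (damp sg (tpow (s - 1))) xi * cexp (s * rlog (1 - cexp (- z)))).
  apply: ccvg_ext (_ : ccvg (fun N => fourier (damp sg (tpow (s - 1))) xi *
    \sum_(k < N) bcoef s k * cexp (- z) ^+ k) _); first by move=> N; rewrite e.
  by apply: ccvgM; [exact: ccvg_cst|exact: binomial_series (ltW s0') w1].
rewrite (ccvg_unique L L2) fourier_damp_tpow // -mulrA -cexpD; congr (_ * cexp _).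
by rewrite /lbase -/z; ring.
Qed.

Lemma cabs_1Bcexp_le z : 0 <= Re z -> cabs (1 - cexp (- z)) <= 2 * cabs z.
Proof.
move=> z0; rewrite -[_ - _]opprB cabsN.
have dF (r : R) : is_cderive (fun r => cexp (- z * r%:C)) r (- z * cexp (- z * r%:C)).
  have := is_cderive_cexp (is_cderiveZ (- z) (is_cderive_id r)).
  by apply: is_cderive_ext => //; rewrite mulr1.
have := @cderive_le _ _ _ (cabs z) (fun r _ => dF r).
rewrite mulr1 mulr0 cexp0; apply => r /andP[r0 r1].
rewrite [cabs _]cabsM cabsN cabs_cexp ler_piMr ?cabs_ge0 // expR_le1.
by rewrite mulNr ReN ReM /= mulr0 subr0 oppr_le0 mulr_ge0.
Qed.

(** [|1 - cexp (- z)|] is at most 2 and at most [2 |z|], whence a quotient by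
    [|z|] of at most [4 / (1 + |xi|)]. *)
Lemma Re_lbase_le sg xi : 0 < sg ->
  Re (lbase (sg +i* xi)) <= ln 4 - ln (1 + `|xi|).
Proof.
move=> sg0; set z := sg +i* xi.
have z0 : 0 < Re z by [].
have zp : 0 < cabs z by rewrite (lt_le_trans z0) // (le_trans (ler_norm _)) // Re_cabs.
have wp : 0 < cabs (1 - cexp (- z)).
  by rewrite (lt_le_trans (Re_1Bcexp z0)) // (le_trans (ler_norm _)) // Re_cabs.
rewrite ReD ReN /= lerBlDr addrAC lerBrDr -!lnM ?posrE ?mulr_gt0 ?gt0_1Dnorm //.
rewrite ler_ln ?posrE ?mulr_gt0 ?gt0_1Dnorm //.
have h1 := cabs_1Bcexp_le (ltW z0).
have h2 : cabs (1 - cexp (- z)) <= 2.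
  rewrite (le_trans (cabsB _ _)) // cabs1 -[2]natr1 lerD2l cabs_cexp expR_le1 ReN oppr_le0.
  exact: ltW.
have h3 : `|xi| <= cabs z by exact: (Im_cabs z).
have := normr_ge0 xi; nra.
Qed.

Lemma Im_lbase z : `|Im (lbase z)| <= pi.
Proof.
rewrite ImD ImN; have /andP[] := Im_rlog (1 - cexp (- z)); have /andP[] := Im_rlog z.
by move=> *; rewrite ler_norml; have := pi_gt0 R; lra.
Qed.

Definition cbound : R := expR (Re s * ln 4 + `|Im s| * pi).

(** The bound does not depend on the damping, and it is square integrable and
    integrable in [xi] because [Re s > 1]. *)
Lemma cabs_cexp_lbase sg xi : 0 < sg ->
  cabs (cexp (s * lbase (sg +i* xi))) <= cbound * wgt (Re s) xi.
Proof.
move=> sg0; rewrite cabs_cexp /cbound /wgt -expRD ler_expR ReM.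
have h1 := Re_lbase_le xi sg0.
have h2 : - (Im s * Im (lbase (sg +i* xi))) <= `|Im s| * pi.
  rewrite (le_trans (ler_norm _)) // normrN normrM ler_wpM2l //; exact: Im_lbase.
have h3 : Re s * Re (lbase (sg +i* xi)) <= Re s * (ln 4 - ln (1 + `|xi|)).
  by rewrite ler_wpM2l // ltW.
rewrite [leRHS](_ : _ = Re s * (ln 4 - ln (1 + `|xi|)) + `|Im s| * pi); last by ring.
exact: lerD.
Qed.

Lemma cintegr_fourier_damp_cspline sg : 0 < sg -> cintegr (fourier (damp sg cspline)).
Proof.
move=> sg0; apply: (@cintegr_le _ _ (fun xi => cabs (cGamma s) * cbound * wgt (Re s) xi)).
- exact/cmeasurable_fourier/cintegr_damp_cspline.
- move=> xi; rewrite fourier_damp_cspline // cabsM -mulrA ler_wpM2l ?cabs_ge0 //.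
  exact: cabs_cexp_lbase.
- exact/integrZ/integr_wgt.
Qed.

(** * Square integrability of the scalar spline *)

Let sgn (n : nat) : R := n.+1%:R^-1.
Let sgn0 n : 0 < sgn n. Proof. by rewrite invr_gt0 ltr0n. Qed.

(** By Plancherel the damped splines have uniformly bounded L2 norms, and they
    increase in modulus to the spline as the damping decreases. *)
Lemma cspline_L2 : integr (fun t => cabs (cspline t) ^+ 2).
Proof.
pose B := \int[mu]_xi ((cabs (cGamma s) * cbound) ^+ 2 * wgt 2 xi) / @gsint R ^+ 2.
have mS := measurable_cabs cmeasurable_cspline.
have b n : (\int[mu]_t (cabs (damp (sgn n) cspline t) ^+ 2)%:E <= B%:E)%E.
  have [C hC] := damp_cspline_wgt 0 (sgn0 n).
  have hC' t : cabs (damp (sgn n) cspline t) <= C.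
    by have := hC t; rewrite wgtn expr0 invr1 mulr1.
  have [i2 e] := plancherel (ccontinuous_damp (sgn n) ccontinuous_cspline)
    (cintegr_damp_cspline (sgn0 n)) hC' (cintegr_fourier_damp_cspline (sgn0 n)).
  have g2 : 0 < @gsint R ^+ 2 by rewrite exprn_gt0 // gsint_gt0.
  rewrite -[leLHS]fineK; last exact: integrable_fin_num.
  rewrite lee_fin -/(Rintegral _ _ _) /B ler_pdivlMr // mulrC -e.
  have fb xi : cabs (fourier (damp (sgn n) cspline) xi) ^+ 2 <=
      (cabs (cGamma s) * cbound) ^+ 2 * wgt 2 xi.
    have -> : wgt 2 xi = wgt 1 xi ^+ 2 by rewrite expr2 wgtM (_ : 1 + 1 = 2) //; ring.
    rewrite -exprMn.
    have pos : 0 <= cabs (cGamma s) * cbound * wgt 1 xi.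
      exact: mulr_ge0 (mulr_ge0 (cabs_ge0 _) (expR_ge0 _)) (wgt_ge0 _ _).
    apply: lerXn2r; rewrite ?nnegrE ?cabs_ge0 ?pos //.
    rewrite fourier_damp_cspline // [leLHS]cabsM -mulrA ler_wpM2l ?cabs_ge0 //.
    apply: (le_trans (cabs_cexp_lbase _ (sgn0 n))); apply: (ler_wpM2l (expR_ge0 _)).
    exact/wgt_le/ltW.
  have fi : integr (fun xi => (cabs (cGamma s) * cbound) ^+ 2 * wgt 2 xi).
    exact/integrZ/integr_wgt2.
  apply: le_Rintegral => //.
  apply: (integr_le _ _ fi) => [|xi]; last by rewrite ger0_norm ?sqr_ge0.
  by apply: measurable_funX; exact/measurable_cabs/cmeasurable_fourier/cintegr_damp_cspline.
have mn n : measurable_fun setT (fun t => (cabs (damp (sgn n) cspline t) ^+ 2)%:E).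
  apply/measurable_EFinP; apply: measurable_funX.
  exact/measurable_cabs/cmeasurable_damp/cmeasurable_cspline.
apply/integrableP; split; first by apply/measurable_EFinP; exact: measurable_funX.
under eq_integral do rewrite /= ger0_norm ?sqr_ge0 //.
suff : (\int[mu]_t (cabs (cspline t) ^+ 2)%:E <= B%:E)%E.
  by move=> /le_lt_trans; apply; exact: ltry.
have cv := @cvg_monotone_convergence _ _ R mu setT measurableT
  (fun n t => (cabs (damp (sgn n) cspline t) ^+ 2)%:E) mn.
rewrite (_ : (\int[mu]_t _)%E = (\int[mu]_t limn (fun n => (cabs (damp (sgn n) cspline t) ^+ 2)%:E))%E); last first.
  apply: eq_integral => t _; apply/esym/cvg_lim => //.
  apply: cvg_EFin; first exact: nearW.
  have h : (fun n => cabs (damp (sgn n) cspline t)) @ \oo --> cabs (cspline t).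
    apply: cvg_cabs; rewrite -[X in ccvg _ X]mul1r; apply: ccvgM; last exact: ccvg_cst.
    apply: ccvg_real; rewrite -[X in _ --> X]expR0.
    apply: (cvg_comp (fun n => - sgn n * t) (@expR R)); last exact: continuous_expR.
    have h1 : (fun n => - sgn n * (t : R)) @ \oo --> (- 0 * (t : R) : R).
      by apply: cvgM; [apply: cvgN; exact: cvg_harmonic|exact: cvg_cst].
    by rewrite oppr0 (mul0r (t : R)) in h1.
  exact: (cvg_comp _ (fun x : R => x ^+ 2) h (@exprn_continuous _ 2 _)).
apply: (cvge_le _ (cv _ _)).
- by apply: nearW => n; exact: b.
- by move=> n t _; rewrite lee_fin sqr_ge0.
- move=> t _ m n mn'; rewrite lee_fin lerXn2r ?nnegrE ?cabs_ge0 //.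
  have [t0|t0] := leP t 0; first by rewrite /damp cspline_le0 // !mulr0.
  rewrite /damp !cabsM ler_wpM2r ?cabs_ge0 // !cabs_real !ger0_norm ?expR_ge0 //.
  rewrite ler_expR; apply: (ler_wpM2r (ltW t0)).
  by rewrite lerN2 lef_pV2 ?posrE ?ltr0n // ler_nat ltnS.
Qed.

End ScalarSpline.

(** * The boundary values of the transform *)

Section Symbol.
Variable R : realType.
Local Notation Re := (@complex.Re R).
Local Notation Im := (@complex.Im R).
Local Notation mu := (@lebesgue_measure R).
Variable s : R[i].
Hypothesis s1 : 1 < Re s.
Implicit Types (t xi sg : R) (z : R[i]).

Let s0' : 0 < Re s. Proof. exact: lt_trans s1. Qed.
Let sgn (n : nat) : R := n.+1%:R^-1.
Let sgn0 n : 0 < sgn n. Proof. by rewrite invr_gt0 ltr0n. Qed.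
Let sgn_cvg : sgn @ \oo --> (0 : R). Proof. exact: cvg_harmonic. Qed.

Definition cpow z : R[i] := if z == 0 then 0 else cexp (s * clog z).
Definition csymbol xi : R[i] := cpow (spline_base xi).

Lemma ccvg_vert xi : ccvg (fun n => sgn n +i* xi) (0 +i* xi).
Proof. by split; [exact: sgn_cvg|exact: cvg_cst]. Qed.

Lemma ccvgN (u : nat -> R[i]) l : ccvg u l -> ccvg (fun n => - u n) (- l).
Proof.
move=> ul; rewrite -mulN1r; apply: ccvg_ext (ccvgM (ccvg_cst (-1)) ul) => n.
by rewrite mulN1r.
Qed.

Lemma ccvg_1Bcexp xi :
  ccvg (fun n => 1 - cexp (- (sgn n +i* xi))) (1 - fker xi).
Proof.
apply: ccvgD; first exact: ccvg_cst.
apply: ccvgN; rewrite /fker; apply: ccvg_cexp.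
have -> : 'i * xi%:C = 0 +i* xi :> R[i] by apply: eqC => /=; ring.
exact/ccvgN/ccvg_vert.
Qed.

Lemma cvg_ln_cabs (u : nat -> R[i]) l : ccvg u l -> l != 0 ->
  (fun n => ln (cabs (u n))) @ \oo --> ln (cabs l).
Proof.
move=> ul l0; apply: (cvg_comp _ _ (cvg_cabs ul) (_ : @ln R @ cabs l --> ln (cabs l))).
by apply: continuous_ln; rewrite cabs_gt0.
Qed.

Lemma ccvg_rlog (u : nat -> R[i]) l : ccvg u l -> 0 < Re l ->
  ccvg (fun n => rlog (u n)) (rlog l).
Proof.
move=> ul l0; have ln0 : Re l != 0 by rewrite gt_eqF.
have [u1 u2] := ul; split.
  by apply: cvg_ln_cabs => //; apply: contraNneq ln0 => ->.
apply: (cvg_comp (fun n => Im (u n) / Re (u n)) (@atan R)); last exact: continuous_atan.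
by apply: cvgM => //; exact: cvgV.
Qed.

Lemma ccvg_rlog_vert xi : xi != 0 -> ccvg (fun n => rlog (sgn n +i* xi)) (ilog xi).
Proof.
move=> x0; split.
  have -> : Re (ilog xi) = ln (cabs (0 +i* xi)).
    by rewrite /= /cabs /= expr0n add0r sqrtr_sqr.
  apply: cvg_ln_cabs; first exact: ccvg_vert.
  by apply/eqP => /(congr1 Im) /= /eqP; apply/negP.
have up (x : R) : 0 < x -> (fun n => atan (x / sgn n)) @ \oo --> (pi / 2 : R).
  move=> xp; apply: (cvg_comp (fun n => x / sgn n) (@atan R)); last exact: cvgy_atan.
  apply/cvgryPge => A; near=> n; rewrite /sgn invrK -ler_pdivrMl //.
  rewrite -natr1 (@le_trans _ _ n%:R) ?lerDl //; near: n.
  exact: nbhs_infty_ger.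
have [xp|xn|x00] := ltgtP xi 0; last by rewrite x00 eqxx in x0.
  rewrite [X in _ --> X](_ : _ = - (pi / 2)); last by rewrite /= ltr0_sg // mulN1r.
  rewrite [X in X @ _ --> _](_ : _ = fun n => - atan (- xi / sgn n)); last first.
    by apply/funext => n; rewrite /= mulNr atanN opprK.
  by apply: cvgN; apply: up; rewrite oppr_gt0.
rewrite [X in _ --> X](_ : _ = pi / 2); last by rewrite /= gtr0_sg // mul1r.
exact: up.
Unshelve. all: by end_near. Qed.

(** Where the base does not vanish, the two logarithms have in the limit imaginary
    parts in [-pi/2, pi/2], the first one strictly between the bounds, so that
    their difference is the principal logarithm of the base. *)
Lemma ccvg_csymbol xi : xi != 0 ->
  ccvg (fun n => cexp (s * lbase (sgn n +i* xi))) (csymbol xi).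
Proof.
move=> x0; have ix0 : 'i * xi%:C != 0 :> R[i] by rewrite -cexp_ilog // cexp_neq0.
have baseE : spline_base xi = (1 - fker xi) / ('i * xi%:C).
  by rewrite /spline_base (negbTE x0).
have [f1|f1] := eqVneq (fker xi) 1.
  (* the symbol vanishes: only the modulus matters *)
  rewrite /csymbol /cpow baseE f1 subrr mul0r eqxx.
  apply: ccvg_cabs; rewrite [X in X @ _ --> _](_ : _ =
      fun n => cabs (cexp (s * lbase (sgn n +i* xi)))); last first.
    by apply/funext => n; rewrite subr0.
  have b n : cabs (cexp (s * lbase (sgn n +i* xi))) <=
      expR (`|Im s| * pi) * expR (Re s * - ln `|xi|) *
      cabs (tpow (Re s)%:C (cabs (1 - cexp (- (sgn n +i* xi))))).
    have z0 : 0 < Re (sgn n +i* xi) by exact: sgn0.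
    have wp : 0 < cabs (1 - cexp (- (sgn n +i* xi))).
      by rewrite (lt_le_trans (Re_1Bcexp z0)) // (le_trans (ler_norm _)) // Re_cabs.
    rewrite cabs_tpow // -!expRD cabs_cexp ler_expR ReM /=.
    have h2 : - (Im s * Im (lbase (sgn n +i* xi))) <= `|Im s| * pi.
      rewrite (le_trans (ler_norm _)) // normrN normrM ler_wpM2l //; exact: Im_lbase.
    rewrite -addrA addrC lerD // -mulrDr ler_wpM2l ?(ltW s0') //.
    rewrite /lbase /= [leRHS]addrC lerD2l lerN2 ler_ln ?posrE ?normr_gt0 //.
      exact: (Im_cabs (sgn n +i* xi)).
    by rewrite cabs_gt0; apply/eqP => /(congr1 Im) /= /eqP; apply/negP.
  apply: (@squeeze_cvgr _ _ _ _ (cst 0) (fun n => expR (`|Im s| * pi) * expR (Re s * - ln `|xi|) *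
      cabs (tpow (Re s)%:C (cabs (1 - cexp (- (sgn n +i* xi))))))).
  - by apply: nearW => n; rewrite cabs_ge0 b.
  - exact: cvg_cst.
  set K := expR _ * expR _.
  have h : (fun n => cabs (tpow (Re s)%:C (cabs (1 - cexp (- (sgn n +i* xi)))))) @ \oo --> (0 : R).
    have h1 : (fun n => cabs (1 - cexp (- (sgn n +i* xi)))) @ \oo --> (0 : R).
      by have := cvg_cabs (ccvg_1Bcexp xi); rewrite f1 subrr cabs0.
    apply/cvgr0Pnorm_le => e e0; near=> n; rewrite ger0_norm ?cabs_ge0 //.
    near: n; exact: (h1 _ (tpow_cvg0 (s0' : 0 < Re (Re s)%:C) e0)).
  have := cvgM (cvg_cst K) h; rewrite mulr0; exact.
have re0 : 0 < Re (1 - fker xi).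
  rewrite fkerE /= subr_gt0 lt_neqAle cos_le1 andbT.
  apply: contraNneq f1 => c1; rewrite fkerE c1.
  have := cos2Dsin2 xi; rewrite c1 expr1n => /(canRL (addKr _)).
  by rewrite addNr => /eqP; rewrite sqrf_eq0 => /eqP ->; rewrite oppr0.
pose w := rlog (1 - fker xi) - ilog xi.
have wE : cexp w = spline_base xi by rewrite cexpD cexpN cexp_rlog // cexp_ilog // baseE.
have wI : - pi < Im w < pi.
  have /andP[] := Im_rlog (1 - fker xi); rewrite /w ImD ImN /=.
  have := pi_gt0 R; have [xp|xn|x00] := ltgtP xi 0; last by rewrite x00 eqxx in x0.
    by rewrite ltr0_sg // mulN1r => *; lra.
  by rewrite gtr0_sg // mul1r => *; lra.
rewrite /csymbol /cpow -wE (negbTE (cexp_neq0 _)) clog_cexp //.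
apply: ccvg_cexp; apply: ccvgM; first exact: ccvg_cst.
apply: ccvgD; first exact: ccvg_rlog (ccvg_1Bcexp xi) re0.
exact/ccvgN/ccvg_rlog_vert.
Unshelve. all: by end_near. Qed.

Lemma ae_neq0 : {ae mu, forall xi : R, xi != 0}.
Proof.
exists [set 0]; split; [exact: measurable_set1|exact: lebesgue_measure_set1|].
by move=> x /= /negP; rewrite negbK => /eqP.
Qed.

Lemma cmeasurable_lbase n : cmeasurable (fun xi => cexp (s * lbase (sgn n +i* xi))).
Proof.
have G0 := cGamma_neq0 s1.
apply: cmeasurable_ext (_ : cmeasurable (fun xi => (cGamma s)^-1 * fourier (damp (sgn n) (cspline s)) xi)).
  by move=> xi; rewrite fourier_damp_cspline // mulrA mulVf // mul1r.
apply: cmeasurableM; first exact: cmeasurable_cst.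
exact/cmeasurable_fourier/cintegr_damp_cspline.
Qed.

Lemma cmeasurable_csymbol : cmeasurable csymbol.
Proof.
pose i0 (xi : R) : R[i] := (\1_[set (0 : R)] xi)%:C.
have mi : cmeasurable i0.
  by apply: cmeasurable_real; apply: measurable_indic; exact: measurable_set1.
have i0E xi : i0 xi = if xi == 0 then 1 else 0.
  rewrite /i0 indicE; case: eqP => [->|/eqP x0]; first by rewrite mem_set.
  by rewrite memNset //=; apply/eqP.
apply: (@cmeasurable_cvg _ _ _ (fun n xi =>
    cexp (s * lbase (sgn n +i* xi)) * (1 - i0 xi) + csymbol 0 * i0 xi)).
  move=> n; apply: cmeasurableD.
    apply: cmeasurableM; first exact: cmeasurable_lbase.
    apply: cmeasurable_ext (_ : cmeasurable (fun xi => 1 + -1 * i0 xi)) => [xi|].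
      by rewrite mulN1r.
    apply: cmeasurableD; first exact: cmeasurable_cst.
    by apply: cmeasurableM => //; exact: cmeasurable_cst.
  by apply: cmeasurableM => //; exact: cmeasurable_cst.
move=> xi; rewrite i0E; case: (eqVneq xi 0) => [->|x0].
  apply: ccvg_ext (ccvg_cst _) => n.
  by rewrite subrr mulr0 add0r mulr1.
apply: ccvg_ext (ccvg_csymbol x0) => n.
by rewrite subr0 mulr1 mulr0 addr0.
Qed.

(** * Schwartz functions *)

Lemma schwartz_wgt (psi : R -> R[i]) (n : nat) : is_schwartz psi ->
  exists C, forall x, cabs (cderiven n psi x) <= C * wgt 2 x.
Proof.
move=> [_ h]; have [M0 h0] := h 0%N n; have [M2 h2] := h 2%N n.
exists (2 * (M0 + M2)) => x; rewrite (@wgtn _ 2) ler_pdivlMr ?exprn_gt0 ?gt0_1Dnorm //.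
have := h0 x; have := h2 x; rewrite expr0 mul1r.
have := cabs_ge0 (cderiven n psi x); have := normr_ge0 x.
move: (cabs _) `|x| => c u u0 c0 a b.
have : (1 + u) ^+ 2 <= 2 * (1 + u ^+ 2) by have := sqr_ge0 (u - 1); nra.
move=> /(ler_wpM2l c0); nra.
Qed.

Lemma schwartz_derive (psi : R -> R[i]) (n : nat) x : is_schwartz psi ->
  is_cderive (cderiven n psi) x (cderiven n.+1 psi x).
Proof.
move=> [[h1 h2] _]; split; apply: DeriveDef.
- exact: h1.
- by rewrite -derive1E /=; congr derive1.
- exact: h2.
- by rewrite -derive1E /=; congr derive1.
Qed.

Lemma cderiven0 (psi : R -> R[i]) x : cderiven 0 psi x = psi x.
Proof. by apply: eqC. Qed.

Lemma cintegr_schwartz (psi : R -> R[i]) n : is_schwartz psi -> cintegr (cderiven n psi).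
Proof.
move=> hp; have [C hC] := schwartz_wgt n hp.
apply: (cintegr_le _ hC); last exact/integrZ/integr_wgt2.
apply: ccontinuous_measurable; apply: is_cderive_continuous => x.
exact: schwartz_derive.
Qed.

Lemma fourier_schwartz_wgt (psi : R -> R[i]) : is_schwartz psi ->
  exists C, forall xi, cabs (fourier psi xi) <= C * wgt 1 xi.
Proof.
move=> hp; have [C hC] := schwartz_wgt 0 hp.
have C0 : 0 <= C by rewrite -(pmulr_rge0 _ (wgt_gt0 2 0)) mulrC (le_trans _ (hC 0)) ?cabs_ge0.
have pE : cderiven 0 psi = psi by apply/funext => x; rewrite cderiven0.
have i0 := cintegr_schwartz 0 hp; have i1 := cintegr_schwartz 1 hp; rewrite pE in i0.
have d (x : R) : is_cderive psi x (cderiven 1 psi x) by have := schwartz_derive 0 x hp; rewrite pE.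
have c1 : ccontinuous (cderiven 1 psi).
  by apply: is_cderive_continuous => x; exact: schwartz_derive.
have b x : cabs (psi x) <= C * wgt 1 x.
  by rewrite -cderiven0 (le_trans (hC x)) // ler_wpM2l // wgt_le // ler1n.
exists (2 * \int[mu]_x cabs (psi x) + 2 * \int[mu]_x cabs (cderiven 1 psi x)) => xi.
rewrite (@wgtn _ 1) expr1 ler_pdivlMr ?gt0_1Dnorm // mulrDr mulr1 lerD //.
  exact: cabs_fourier.
have e := fourier_derive xi d c1 i1 i0 b.
have := cabs_fourier xi i1; rewrite e !cabsM cabsi mul1r cabs_real.
by rewrite mulrC.
Qed.

(** The multiplication formula for the damped splines, in the limit of no
    damping; dominated convergence applies on both sides. *)
Lemma cspline_fourier (psi : R -> R[i]) : is_schwartz psi ->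
  cintegral (fun x => fourier psi x * ((cGamma s)^-1 * cspline s x)) =
  cintegral (fun xi => psi xi * csymbol xi).
Proof.
move=> hp; have G0 := cGamma_neq0 s1.
have pE : cderiven 0 psi = psi by apply/funext => x; rewrite cderiven0.
have pi := cintegr_schwartz 0 hp; rewrite pE in pi.
have [D hD] := fourier_schwartz_wgt hp.
have L : ccvg (fun n => cintegral (fun xi => psi xi * ((cGamma s)^-1 * fourier (damp (sgn n) (cspline s)) xi)))
    (cintegral (fun xi => psi xi * csymbol xi)).
  apply: (@cintegral_dct _ _ _ (fun xi => cbound s * cabs (psi xi))).
  - move=> n; apply: cmeasurableM; first exact: cintegr_measurable.
    apply: cmeasurableM; first exact: cmeasurable_cst.
    exact/cmeasurable_fourier/cintegr_damp_cspline.
  - by apply: cmeasurableM; [exact: cintegr_measurable|exact: cmeasurable_csymbol].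
  - apply: (ae_mono _ ae_neq0) => xi x0; apply: ccvgM; first exact: ccvg_cst.
    apply: ccvg_ext (ccvg_csymbol x0) => n.
    by rewrite fourier_damp_cspline // mulrA mulVf // mul1r.
  - exact/integrZ/integr_cabs.
  - move=> n xi; rewrite fourier_damp_cspline // [X in psi xi * X]mulrA mulVf // mul1r [leLHS]cabsM mulrC.
    rewrite ler_wpM2r ?cabs_ge0 // (le_trans (cabs_cexp_lbase s1 xi (sgn0 n))) //.
    by rewrite ler_piMr ?expR_ge0 // wgt_le1 // ltW.
have L2 : ccvg (fun n => cintegral (fun xi => psi xi * ((cGamma s)^-1 * fourier (damp (sgn n) (cspline s)) xi)))
    (cintegral (fun x => fourier psi x * ((cGamma s)^-1 * cspline s x))).
  apply: ccvg_ext (_ : ccvg (fun n => cintegral (fun x => fourier psi x * ((cGamma s)^-1 * damp (sgn n) (cspline s) x))) _).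
    move=> n; have di := cintegr_damp_cspline s1 (sgn0 n).
    have m1 := fourier_mult (cintegrZ (cGamma s)^-1 di) pi.
    transitivity (cintegral (fun x => (cGamma s)^-1 * damp (sgn n) (cspline s) x * fourier psi x)).
      by apply: eq_cintegral => x; rewrite mulrC.
    rewrite -m1; apply: eq_cintegral => xi; congr (_ * _).
    exact: fourierZ.
  apply: (@cintegral_dct _ _ _ (fun x => cabs (cGamma s)^-1 * (cabs (cspline s x) ^+ 2 + D ^+ 2 * wgt 2 x))).
  - move=> n; apply: cmeasurableM; first exact: cmeasurable_fourier.
    apply: cmeasurableM; first exact: cmeasurable_cst.
    exact/cmeasurable_damp/cmeasurable_cspline.
  - apply: cmeasurableM; first exact: cmeasurable_fourier.
    apply: cmeasurableM; first exact: cmeasurable_cst.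
    exact: cmeasurable_cspline.
  - apply: aeW => x; apply: ccvgM; first exact: ccvg_cst.
    apply: ccvgM; first exact: ccvg_cst.
    rewrite -[X in ccvg _ X]mul1r; apply: ccvgM; last exact: ccvg_cst.
    apply: ccvg_real; rewrite -[X in _ --> X]expR0.
    apply: (cvg_comp (fun n => - sgn n * x) (@expR R)); last exact: continuous_expR.
    have h1 : (fun n => - sgn n * (x : R)) @ \oo --> (- 0 * (x : R) : R).
      by apply: cvgM; [apply: cvgN; exact: sgn_cvg|exact: cvg_cst].
    by rewrite oppr0 (mul0r (x : R)) in h1.
  - apply/integrZ/integrD; first exact: cspline_L2.
    exact/integrZ/integr_wgt2.
  - move=> n x; rewrite [leLHS]cabsM [cabs (_ * damp _ _ _)]cabsM mulrCA.
    rewrite ler_wpM2l ?cabs_ge0 //.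
    have h1 : cabs (damp (sgn n) (cspline s) x) <= cabs (cspline s x).
      have [x0|x0] := leP x 0; first by rewrite /damp cspline_le0 // mulr0.
      rewrite /damp [leLHS]cabsM cabs_real ger0_norm ?expR_ge0 //.
      rewrite ler_piMl ?cabs_ge0 // expR_le1 mulNr oppr_le0 mulr_ge0 // ltW //.
    have h2 := hD x; have w0 := wgt_ge0 1 x.
    have -> : wgt 2 x = wgt 1 x ^+ 2 by rewrite expr2 wgtM (_ : 1 + 1 = 2) //; ring.
    have := cabs_ge0 (damp (sgn n) (cspline s) x); have := cabs_ge0 (fourier psi x).
    move: (cabs (fourier psi x)) (cabs (damp _ _ x)) (cabs (cspline s x)) h1 h2 => f d c h1 h2 f0 d0.
    rewrite -exprMn; move: (D * wgt 1 x) h2 => e h2.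
    have := sqr_ge0 (e - c); have : f * d <= e * c by apply: ler_pM.
    nra.
exact: ccvg_unique L2 L.
Qed.

End Symbol.

(** * Splitting the complexified quaternions *)

Section QuaternionBasics.
Variable R : realType.
Local Notation Re := (@complex.Re R).
Local Notation Im := (@complex.Im R).
Local Notation H := (quat R[i]).
Implicit Types (p q : quat R) (u v w z : R[i]).

Lemma eqQ (K : Type) (p q : quat K) :
  q0 p = q0 q -> q1 p = q1 q -> q2 p = q2 q -> q3 p = q3 q -> p = q.
Proof. by case: p q => [????] [????] /= -> -> -> ->. Qed.

Lemma qscaleAr (K : comNzRingType) (a : K) (p q : quat K) : a *: (p * q) = p * (a *: q).
Proof. by apply: eqQ => /=; ring. Qed.

Lemma qC1 : qC (1 : quat R) = 1.
Proof. by apply: eqQ. Qed.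

Lemma qCM p q : qC (p * q) = qC p * qC q.
Proof. by apply: eqQ; rewrite /= !(rmorphB, rmorphD, rmorphM). Qed.

Lemma qCD p q : qC (p + q) = qC p + qC q.
Proof. by apply: eqQ; rewrite /= rmorphD. Qed.

Lemma qCZ (x : R) p : qC (x *: p) = x%:C *: qC p.
Proof. by apply: eqQ; rewrite /= rmorphM. Qed.

Lemma qCV p : qC p^-1 = (qC p)^-1.
Proof.
have nE : normsq (qC p) = (normsq p)%:C.
  by rewrite /normsq /= !rmorphD /= !rmorphXn.
rewrite /GRing.inv /= /qinv nE (_ : (normsq p)%:C == 0 = (normsq p == 0)); last first.
  exact: realC_eq0.
by case: eqP => // _; apply: eqQ; rewrite /= rmorphM /= realCV // rmorphN.
Qed.

Variables j1 j2 j3 : R.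
Hypothesis jj : j1 ^+ 2 + j2 ^+ 2 + j3 ^+ 2 = 1.

(** The unit imaginary quaternion [J] with real coordinates [j1, j2, j3]
    satisfies [J ^+ 2 = -1], so that [H_C] contains the copy of [C x C] spanned
    by the idempotents [(1 -+ i J) / 2]; the pair [(u, v)] is sent to the element
    on which [J] acts as [i] on the first factor and as [- i] on the second. *)
Definition emb u v : H :=
  Quat ((u + v) / 2) ('i * (v - u) / 2 * j1%:C)
       ('i * (v - u) / 2 * j2%:C) ('i * (v - u) / 2 * j3%:C).

Lemma embD u v u' v' : emb (u + u') (v + v') = emb u v + emb u' v'.
Proof. by apply: eqQ => /=; ring. Qed.

Lemma embZ w u v : emb (w * u) (w * v) = w *: emb u v.
Proof. by apply: eqQ => /=; ring. Qed.

Lemma emb0 : emb 0 0 = 0.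
Proof. by apply: eqQ => /=; ring. Qed.

Lemma emb1 : emb 1 1 = 1.
Proof.
apply: eqQ => /=; rewrite ?subrr ?mulr0 ?mul0r //.
by rewrite -[1 + 1]/(2%:R) divff // pnatr_eq0.
Qed.

Lemma embM u v u' v' : emb u v * emb u' v' = emb (u * u') (v * v').
Proof.
have i2 := sqr_i R.
have jC : j1%:C ^+ 2 + j2%:C ^+ 2 + j3%:C ^+ 2 = 1 :> R[i].
  by rewrite -!rmorphXn -!rmorphD jj.
have h : 2 != 0 :> R[i] by rewrite pnatr_eq0.
apply: eqQ => /=; last 3 first.
- by field.
- by field.
- by field.
transitivity ((u + v) / 2 * ((u' + v') / 2) -
  'i ^+ 2 * ((v - u) / 2 * ((v' - u') / 2)) * (j1%:C ^+ 2 + j2%:C ^+ 2 + j3%:C ^+ 2)).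
  by field.
by rewrite jC i2; field.
Qed.

Lemma embV u v : u != 0 -> v != 0 -> (emb u v)^-1 = emb u^-1 v^-1.
Proof.
move=> u0 v0.
have e1 : emb u v * emb u^-1 v^-1 = 1 by rewrite embM !mulfV // emb1.
have e2 : emb u^-1 v^-1 * emb u v = 1 by rewrite embM !mulVf // emb1.
have U : emb u v \is a GRing.unit by apply/unitrP; exists (emb u^-1 v^-1).
by apply: (mulrI U); rewrite divrr // e1.
Qed.

Lemma emb_sum (I : Type) (r : seq I) (F G : I -> R[i]) :
  \sum_(i <- r) emb (F i) (G i) = emb (\sum_(i <- r) F i) (\sum_(i <- r) G i).
Proof.
elim: r => [|i r ih]; first by rewrite !big_nil emb0.
by rewrite !big_cons ih embD.
Qed.

(** The order [q = a + |v| J] corresponds to the pair of conjugate complex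
    orders [a + i |v|] and [a - i |v|]. *)
Definition ord1 q : R[i] := Sc q +i* vnorm q.
Definition ord2 q : R[i] := Sc q -i* vnorm q.

Definition along q :=
  [/\ q1 q = vnorm q * j1, q2 q = vnorm q * j2 & q3 q = vnorm q * j3].

Lemma qC_emb q : along q -> qC q = emb (ord1 q) (ord2 q).
Proof.
move=> [h1 h2 h3]; have h : 2 != 0 :> R[i] by rewrite pnatr_eq0.
have e : 'i * (ord2 q - ord1 q) / 2 = (vnorm q)%:C.
  have -> : ord2 q - ord1 q = - (2 * 'i * (vnorm q)%:C) by apply: eqC => /=; ring.
  have := sqr_i R; rewrite expr2 => i2.
  transitivity (- ('i * 'i) * (vnorm q)%:C); first by field.
  by rewrite i2 opprK mul1r.
have e0 : (ord1 q + ord2 q) / 2 = (Sc q)%:C.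
  have -> : ord1 q + ord2 q = 2 * (Sc q)%:C by apply: eqC => /=; ring.
  by field.
by apply: eqQ; rewrite /= ?e0 ?e ?h1 ?h2 ?h3 ?rmorphM.
Qed.

Lemma cpowq_emb z q : along q ->
  cpowq z q = emb (cpow (ord1 q) z) (cpow (ord2 q) z).
Proof.
move=> [h1 h2 h3]; rewrite /cpowq /cpow; case: eqP => [_|_]; first by rewrite emb0.
have e1 : ord1 q * clog z = (Sc q)%:C * clog z + 'i * ((vnorm q)%:C * clog z).
  by apply: eqC => /=; ring.
have e2 : ord2 q * clog z = (Sc q)%:C * clog z + - ('i * ((vnorm q)%:C * clog z)).
  by apply: eqC => /=; ring.
rewrite e1 e2 !cexpD embZ; congr (_ *: _).
move: (clog z) => L {e1 e2}.
have h : 2 != 0 :> R[i] by rewrite pnatr_eq0.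
have i0 : 'i != 0 :> R[i] by rewrite neq0Ci.
have i2 : 'i * 'i = -1 :> R[i] by rewrite -expr2 sqr_i.
have cE : csin ((vnorm q)%:C * L) =
    'i * (cexp (- ('i * ((vnorm q)%:C * L))) - cexp ('i * ((vnorm q)%:C * L))) / 2.
  rewrite /csin; move: (cexp _) (cexp _) => e e'.
  transitivity (- ('i * 'i) * (e' - e) / (2 * 'i)); last by field; rewrite ?h ?i0.
  by rewrite i2 opprK mul1r.
have key (x y : R) : x = vnorm q * y ->
    csin ((vnorm q)%:C * L) / (vnorm q)%:C * x%:C = csin ((vnorm q)%:C * L) * y%:C.
  move=> ->; rewrite rmorphM /=; have [b0|b0] := eqVneq (vnorm q) 0.
    by rewrite cE b0 !mul0r !mulr0 oppr0 subrr !(mul0r, mulr0).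
  have b0' : (vnorm q)%:C != 0 :> R[i] by rewrite realC_eq0.
  by rewrite mulrA divfK.
by apply: eqQ; rewrite /= ?(key _ _ h1) ?(key _ _ h2) ?(key _ _ h3) ?cE ?(mulr0, mulr1, add0r, addr0).
Qed.

Lemma ppowq_emb t q : along q ->
  ppowq t q = emb (tpow (ord1 q) t) (tpow (ord2 q) t).
Proof.
move=> aq; rewrite /ppowq /tpow; case: ifP => [t0|_]; last by rewrite emb0.
rewrite cpowq_emb // /cpow.
by rewrite realC_eq0 gt_eqF // clog_real.
Qed.

Lemma vnormB q : vnorm (q - 1) = vnorm q.
Proof. by rewrite /vnorm /normsq /= !subr0. Qed.

Lemma alongB q : along q -> along (q - 1).
Proof. by rewrite /along vnormB /= !subr0. Qed.

Lemma ord1B q : ord1 (q - 1) = ord1 q - 1.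
Proof. by apply: eqC; rewrite /= ?vnormB ?subr0. Qed.

Lemma ord2B q : ord2 (q - 1) = ord2 q - 1.
Proof. by apply: eqC; rewrite /= ?vnormB ?subr0. Qed.

Lemma spline_coef_emb q k : along q ->
  spline_coef q k = emb (bcoef (ord1 q) k) (bcoef (ord2 q) k).
Proof.
move=> aq; rewrite /spline_coef; elim: k => [|k ih].
  by rewrite /binomq big_ord0 fact0 invr1 scale1r expr0 mul1r qC1 emb1.
have bE : (-1) ^+ k.+1 * binomq q k.+1 =
    (-1) ^+ k * binomq q k * ((k.+1%:R^-1 : R) *: (k%:R - q)).
  rewrite /binomq big_ord_recr /= factS natrM invfM.
  have aux (E P M : quat R) (x y : R) :
      E * (-1) * ((x * y) *: (P * M)) = E * (y *: P) * (x *: - M).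
    by apply: eqQ => /=; ring.
  by rewrite exprSr aux opprB.
rewrite bE qCM ih qCZ; have -> : qC (k%:R - q) = emb (k%:R - ord1 q) (k%:R - ord2 q).
  have nE : qC (k%:R : quat R) = emb k%:R k%:R.
    elim: k {ih bE} => [|k ih]; first by rewrite emb0; apply: eqQ.
    by rewrite -!natr1 qCD qC1 ih -emb1 embD.
  have -> : k%:R - q = k%:R + (-1 : R) *: q by rewrite scaleN1r.
  rewrite qCD qCZ nE qC_emb // -embZ -embD rmorphN rmorph1.
  by rewrite !mulN1r.
rewrite -embZ embM /= realCV rmorph_nat.
by congr emb; rewrite [_^-1 * _]mulrC.
Qed.

End QuaternionBasics.

(** * The two components of the quaternionic spline *)

Section Embedding.
Variable R : realType.
Local Notation Re := (@complex.Re R).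
Local Notation Im := (@complex.Im R).
Local Notation mu := (@lebesgue_measure R).
Implicit Types (p q : quat R) (u v w z s : R[i]) (t : R).

Lemma direction q : exists j1 j2 j3 : R,
  j1 ^+ 2 + j2 ^+ 2 + j3 ^+ 2 = 1 /\ along j1 j2 j3 q.
Proof.
have n0 : 0 <= normsq (vec q) by rewrite /normsq /= expr0n /= add0r !addr_ge0 ?sqr_ge0.
have bE : vnorm q ^+ 2 = q1 q ^+ 2 + q2 q ^+ 2 + q3 q ^+ 2.
  by rewrite /vnorm sqr_sqrtr // /normsq /= expr0n /= add0r.
have [b0|b0] := eqVneq (vnorm q) 0.
  (* for a vanishing vector part any unit vector will do *)
  exists 1, 0, 0; split; first by rewrite expr1n expr0n /= !addr0.
  move: bE; rewrite /along b0 !mul0r expr0n /= => /esym h.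
  have z (x y u : R) : x ^+ 2 + y ^+ 2 + u ^+ 2 = 0 -> x = 0 by nra.
  split; [exact: z h|apply: (z _ (q3 q) (q1 q))|apply: (z _ (q1 q) (q2 q))]; rewrite -[RHS]h; ring.
exists (q1 q / vnorm q), (q2 q / vnorm q), (q3 q / vnorm q); split.
  by rewrite !expr_div_n -!mulrDl -bE divff // expf_neq0.
by split; rewrite mulrC divfK.
Qed.

Lemma conj_tpow s t : tpow s^* t = (tpow s t)^*.
Proof.
rewrite /tpow; case: ifP => _; last by apply: eqC => /=; rewrite ?oppr0.
by rewrite conj_cexp; congr cexp; case: s => a b; apply: eqC => /=; ring.
Qed.

Lemma cGamma_conj s : 1 < Re s -> cGamma s^* = (cGamma s)^*.
Proof.
move=> s1; rewrite /cGamma -cintegral_conj; last first.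
  by apply: cintegr_damp_tpow; rewrite ?ltr01 // ReD ReN subr_gt0.
apply: eq_cintegral => x; rewrite /damp.
have -> : s^* - 1 = (s - 1)^* by case: s {s1} => a b; apply: eqC => /=; ring.
by rewrite conj_tpow; case: (tpow _ _) => a b; apply: eqC => /=; ring.
Qed.

Lemma cGamma_int s : cGamma s =
  (\int[mu]_(t in `]0, +oo[) (t `^ (Re s - 1) * cos (Im s * ln t) * expR (- t))) +i*
  (\int[mu]_(t in `]0, +oo[) (t `^ (Re s - 1) * sin (Im s * ln t) * expR (- t))).
Proof.
have E t : 0 < t -> damp 1 (tpow (s - 1)) t = 
    (t `^ (Re s - 1) * cos (Im s * ln t) * expR (- t)) +i*
    (t `^ (Re s - 1) * sin (Im s * ln t) * expR (- t)).
  move=> t0; rewrite /damp tpow_gt0 // /powR gt_eqF // mulN1r.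
  have -> : (s - 1) * (ln t)%:C = ((Re s - 1) * ln t)%:C + 'i * (Im s * ln t)%:C.
    by case: s => a b; apply: eqC => /=; ring.
  by rewrite cexpD cexp_real cexp_i; apply: eqC => /=; ring.
rewrite /cGamma /cintegral; apply: eqC; rewrite /= [RHS]Rintegral_mkcond; apply: eq_Rintegral => t _;
  (rewrite patchE mem_setE in_itv /= andbT; have [t0|t0] := ltP 0 t; first by rewrite E);
  by rewrite /damp tpow_le0 // mulr0.
Qed.

Variable q : quat R.
Hypothesis q_gt1 : 1 < Sc q.
Variables j1 j2 j3 : R.
Hypothesis jj : j1 ^+ 2 + j2 ^+ 2 + j3 ^+ 2 = 1.
Hypothesis qj : along j1 j2 j3 q.
Local Notation emb := (emb j1 j2 j3).
Local Notation s1 := (ord1 q).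
Local Notation s2 := (ord2 q).

Lemma Gammaq_emb : qC (Gammaq q) = emb (cGamma s1) (cGamma s2).
Proof.
have -> : cGamma s2 = (cGamma s1)^* by rewrite -cGamma_conj.
have gE := cGamma_int s1; have [h1 h2 h3] := qj.
rewrite /Gammaq; set x := Rintegral _ _ _ in gE *; set y := Rintegral _ _ _ in gE *.
have y0 : vnorm q = 0 -> y = 0.
  move=> b0; rewrite /y; under eq_Rintegral do rewrite /= b0 mul0r sin0 mulr0 mul0r.
  by rewrite /Rintegral integral0_eq.
have h : 2 != 0 :> R[i] by rewrite pnatr_eq0.
have e0 : (cGamma s1 + (cGamma s1)^*) / 2 = x%:C.
  have -> : cGamma s1 + (cGamma s1)^* = 2 * x%:C by rewrite gE; apply: eqC => /=; ring.
  by field.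
have e1 : 'i * ((cGamma s1)^* - cGamma s1) / 2 = y%:C.
  have -> : 'i * ((cGamma s1)^* - cGamma s1) = 2 * y%:C by rewrite gE; apply: eqC => /=; ring.
  by field.
have key (a b : R) : a = vnorm q * b -> x * 0 + y / vnorm q * a = y * b.
  move=> ->; rewrite mulr0 add0r; have [b0|b0] := eqVneq (vnorm q) 0.
    by rewrite y0 // !mul0r.
  by rewrite mulrA divfK.
by apply: eqQ; rewrite /= ?(key _ _ h1) ?(key _ _ h2) ?(key _ _ h3) ?e0 ?e1 ?rmorphM //= mulr1 mulr0 addr0.
Qed.

Lemma GammaqV_emb : qC (Gammaq q)^-1 = emb (cGamma s1)^-1 (cGamma s2)^-1.
Proof. by rewrite qCV Gammaq_emb embV // cGamma_neq0. Qed.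

Lemma spline_term_emb k t : spline_coef q k * ppowq (t - k%:R) (q - 1) =
  emb (bcoef s1 k * tpow (s1 - 1) (t - k%:R)) (bcoef s2 k * tpow (s2 - 1) (t - k%:R)).
Proof.
by rewrite (spline_coef_emb jj) // (ppowq_emb _ (alongB qj)) embM // ord1B ord2B.
Qed.

Lemma fsum_ord (V : zmodType) (F : nat -> V) (N : nat) :
  (forall k, (N <= k)%N -> F k = 0) -> \sum_(k \in [set: nat]) F k = \sum_(k < N) F k.
Proof.
move=> h; rewrite fsbig_ord; apply/esym/fsbig_widen => // k [_ /= /negP].
by rewrite -leqNgt; exact: h.
Qed.

Lemma spline_sum_emb (N : nat) t : t <= N%:R ->
  \sum_(k \in [set: nat]) (spline_coef q k * ppowq (t - k%:R) (q - 1)) =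
  emb (psum s1 N t) (psum s2 N t).
Proof.
move=> tN; rewrite (@fsum_ord _ _ N) => [|k Nk].
  by under eq_bigr do rewrite spline_term_emb; rewrite emb_sum.
rewrite spline_term_emb !tpow_le0 ?mulr0 ?emb0 // subr_le0 (le_trans tN) // ler_nat //.
Qed.

Lemma spline_series_emb t : spline_series q t =
  emb ((cGamma s1)^-1 * cspline s1 t) ((cGamma s2)^-1 * cspline s2 t).
Proof.
have tN : t <= (Num.truncn t).+1%:R by rewrite ltW // truncnS_gt.
by rewrite /spline_series (spline_sum_emb tN) GammaqV_emb embM.
Qed.

Lemma spline_symbol_emb xi :
  spline_symbol q xi = emb (csymbol s1 xi) (csymbol s2 xi).
Proof. exact: cpowq_emb. Qed.

End Embedding.

Section QIntegral.
Variable R : realType.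
Variables j1 j2 j3 : R.
Local Notation emb := (emb j1 j2 j3).

Lemma qintegral_emb (f g : R -> R[i]) : cintegr f -> cintegr g ->
  qintegral (fun x => emb (f x) (g x)) = emb (cintegral f) (cintegral g).
Proof.
move=> fi gi.
have h (z : R[i]) : cintegral (fun x => 'i * (g x - f x) / 2 * z) =
    'i * (cintegral g - cintegral f) / 2 * z.
  transitivity (cintegral (fun x => 'i / 2 * z * g x + (- ('i / 2 * z)) * f x)).
    by apply: eq_cintegral => x; ring.
  rewrite cintegralD; [|exact: cintegrZ|exact: cintegrZ].
  by rewrite (cintegralZ _ gi) (cintegralZ _ fi); ring.
have h0 : cintegral (fun x => (f x + g x) / 2) = (cintegral f + cintegral g) / 2.
  transitivity (cintegral (fun x => 2^-1 * f x + 2^-1 * g x)).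
    by apply: eq_cintegral => x; ring.
  rewrite cintegralD; [|exact: cintegrZ|exact: cintegrZ].
  by rewrite (cintegralZ _ gi) (cintegralZ _ fi); ring.
by apply: eqQ => /=; [exact: h0|exact: h|exact: h|exact: h].
Qed.

Lemma eq_qintegral (f g : R -> quat R[i]) : f =1 g -> qintegral f = qintegral g.
Proof. by move=> /funext ->. Qed.

Lemma regular_emb (f g phi : R -> R[i]) (F : R -> quat R[i]) :
  (forall x, F x = emb (f x) (g x)) ->
  cintegr (fun x => phi x * f x) -> cintegr (fun x => phi x * g x) ->
  regular F phi = emb (cintegral (fun x => phi x * f x)) (cintegral (fun x => phi x * g x)).
Proof.
move=> FE fi gi; rewrite -qintegral_emb //.
by apply: eq_qintegral => x; rewrite FE embZ.
Qed.

End QIntegral.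

(** * Square integrable functions *)

Section SquareIntegrable.
Variable R : realType.
Local Notation Re := (@complex.Re R).
Local Notation Im := (@complex.Im R).
Local Notation mu := (@lebesgue_measure R).
Implicit Types (f g phi psi : R -> R[i]) (h : R -> R) (B : R -> quat R[i]).

Lemma Lfun2P h : h \in Lfun mu 2%:E <->
  measurable_fun setT h /\ integr (fun x => h x ^+ 2).
Proof.
split=> [lh|[mh ih]].
  split; last exact: Lfun2_integrable_sqr.
  by have := set_mem (sub_Lfun_mfun lh).
rewrite inE; apply/andP; split; first by rewrite inE.
rewrite inE /= /finite_norm unlock poweR_lty //.
have := integrableP _ _ _ ih => -[_]; apply: le_lt_trans.
rewrite le_eqVlt; apply/orP; left; apply/eqP; apply: eq_integral => x _ /=.
by rewrite powR_mulrn ?normr_ge0 // normrX.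
Qed.

Lemma cL2P f : cL2 f <-> cmeasurable f /\ integr (fun x => cabs (f x) ^+ 2).
Proof.
split=> [[/Lfun2P[m1 i1] /Lfun2P[m2 i2]]|[[m1 m2] i]].
  split=> //; apply: integr_ext (integrD i1 i2) => x.
  by rewrite sqr_cabs.
by split; apply/Lfun2P; split=> //; apply: integr_le i; try exact: measurable_funX;
  move=> x; rewrite ger0_norm ?sqr_ge0 //= sqr_cabs ?lerDl ?lerDr sqr_ge0.
Qed.

Lemma cL2_measurable f : cL2 f -> cmeasurable f.
Proof. by case/cL2P. Qed.

Lemma cL2_ext f g : f =1 g -> cL2 f -> cL2 g.
Proof. by move=> /funext ->. Qed.

Lemma cL2Z z f : cL2 f -> cL2 (fun x => z * f x).
Proof.
move=> /cL2P[mf i]; apply/cL2P; split.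
  by apply: cmeasurableM => //; exact: cmeasurable_cst.
apply: integr_ext (integrZ (cabs z ^+ 2) i) => x.
by rewrite cabsM exprMn.
Qed.

Lemma cL2D f g : cL2 f -> cL2 g -> cL2 (fun x => f x + g x).
Proof.
move=> /cL2P[mf i] /cL2P[mg i']; apply/cL2P.
have mfg := cmeasurableD mf mg; split=> //.
apply: (integr_le _ _ (integrZ 2 (integrD i i'))).
  exact/measurable_funX/measurable_cabs.
move=> x; rewrite ger0_norm ?sqr_ge0 //.
have := cabsD (f x) (g x); have := cabs_ge0 (f x + g x).
move: (cabs (f x + _)) (cabs (f x)) (cabs (g x)) => a b c a0 abc.
have : a ^+ 2 <= (b + c) ^+ 2 by rewrite lerXn2r ?nnegrE // (le_trans a0 abc).
by have := sqr_ge0 (b - c); nra.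
Qed.

Lemma cL2B f g : cL2 f -> cL2 g -> cL2 (fun x => f x - g x).
Proof.
move=> hf /(cL2Z (-1)) /(cL2D hf); apply: cL2_ext => x; by rewrite mulN1r.
Qed.

Lemma cintegr_cL2M f g : cL2 f -> cL2 g -> cintegr (fun x => f x * g x).
Proof.
move=> /cL2P[mf i] /cL2P[mg i'].
apply: (cintegr_le (cmeasurableM mf mg) _ (integrD i i')) => x.
rewrite [leLHS]cabsM; move: (cabs _) (cabs _) (cabs_ge0 (f x)) (cabs_ge0 (g x)) => a b a0 b0.
by have := sqr_ge0 (a - b); nra.
Qed.

Lemma cL2_wgt f (a C : R) : 1 <= a -> cmeasurable f ->
  (forall x, cabs (f x) <= C * wgt a x) -> cL2 f.
Proof.
move=> a1 mf b; apply/cL2P; split=> //.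
apply: (integr_le _ _ (integrZ (C ^+ 2) (integr_wgt2 R))).
  exact/measurable_funX/measurable_cabs.
move=> x; rewrite ger0_norm ?sqr_ge0 //.
have w2 : wgt a x ^+ 2 <= wgt 2%:R x.
  by rewrite expr2 wgtM wgt_le //; lra.
apply: (@le_trans _ _ ((C * wgt a x) ^+ 2)).
  by rewrite lerXn2r ?nnegrE ?cabs_ge0 // (le_trans _ (b x)) ?cabs_ge0.
by rewrite exprMn ler_wpM2l ?sqr_ge0.
Qed.

(** * Modulated Gaussians are Schwartz functions *)

Lemma derive1n_seq (F : nat -> R -> R) :
  (forall n (x : R), is_derive x 1 (F n) (F n.+1 x)) ->
  smooth (F 0) /\ forall n x, derive1n n (F 0) x = F n x.
Proof.
move=> hF; have E n : derive1n n (F 0) = F n.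
  elim: n => // n ih; rewrite derive1nS ih; apply/funext => x.
  by rewrite derive1E (@derive_val _ _ _ _ _ _ _ (hF n x)).
by split=> n x; rewrite E //; exact: (@ex_derive _ _ _ _ _ _ _ (hF n x)).
Qed.

Lemma csmooth_seq (F : nat -> R -> R[i]) :
  (forall n x, is_cderive (F n) x (F n.+1 x)) ->
  csmooth (F 0) /\ forall n x, cderiven n (F 0) x = F n x.
Proof.
move=> hF.
have [s1 e1] := @derive1n_seq (fun n => Re \o F n) (fun n x => (hF n x).1).
have [s2 e2] := @derive1n_seq (fun n => Im \o F n) (fun n x => (hF n x).2).
by split=> // n x; apply: eqC; [exact: e1|exact: e2].
Qed.

Lemma is_cderive_horner (p : {poly R[i]}) (x : R) :
  is_cderive (fun x => p.[x%:C]) x p^`().[x%:C].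
Proof.
elim/poly_ind: p => [|p c ih].
  by apply: is_cderive_ext (is_cderive_cst 0 x) => [t|]; rewrite ?deriv0 horner0.
apply: is_cderive_ext (is_cderiveD (is_cderiveM ih (is_cderive_id x)) (is_cderive_cst c x)) => [t|].
  by rewrite hornerMXaddC.
rewrite derivMXaddC hornerD hornerMX addr0 mulr1; exact: addrC.
Qed.

Lemma horner_bound (p : {poly R[i]}) : exists C, exists n,
  0 <= C /\ forall x : R, cabs p.[x%:C] <= C * (1 + `|x|) ^+ n.
Proof.
elim/poly_ind: p => [|p c [C [n [C0 h]]]].
  by exists 0, 0%N; split=> // x; rewrite horner0 cabs0 mul0r.
exists (C + cabs c), n.+1; split; first by rewrite addr_ge0 ?cabs_ge0.
move=> x; rewrite hornerMXaddC (le_trans (cabsD _ _)) // mulrDl lerD //.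
  rewrite cabsM cabs_real exprSr mulrA ler_pM ?cabs_ge0 //.
  by rewrite lerDr.
by rewrite ler_peMr ?cabs_ge0 // exprn_ege1 // lerDl.
Qed.

(** The derivatives of a modulated Gaussian are polynomial multiples of it. *)
Fixpoint wpoly (y c : R) (n : nat) : {poly R[i]} :=
  if n is n'.+1 then (wpoly y c n')^`() + wpoly y c n' * (('i * y%:C)%:P - (c ^+ 2)%:C *: 'X)
  else 1.

Lemma is_cderive_wave (y c x : R) :
  is_cderive (wave y c) x (('i * y%:C - (c ^+ 2)%:C * x%:C) * wave y c x).
Proof.
have dg : is_derive x 1 (fun t => gs (c * t)) (c * (- (c * x) * gs (c * x))).
  have d1 : is_derive x 1 (fun t : R => c * t) c.
    by apply: is_derive_ext (is_deriveZ c (is_derive_id x 1)) => //; rewrite /GRing.scale /= mulr1.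
  have := @is_derive1_comp _ (@gs R) (fun t : R => c * t) x _ _ (is_derive_gs (c * x)) d1.
  by apply: is_derive_ext => //=; rewrite mulrC.
apply: is_cderive_ext (is_cderiveM (is_cderive_fker (- y) x) (is_cderive_real dg)) => //.
rewrite /wave; move: (fker _) (gs _) => k g.
by rewrite !(rmorphM, rmorphN, rmorphXn) /=; ring.
Qed.

Lemma wave_schwartz (y c : R) : 0 < c -> is_schwartz (wave y c).
Proof.
move=> c0.
have hF n x : is_cderive (fun x => (wpoly y c n).[x%:C] * wave y c x) x
    ((wpoly y c n.+1).[x%:C] * wave y c x).
  apply: is_cderive_ext (is_cderiveM (is_cderive_horner _ x) (is_cderive_wave y c x)) => //.
  rewrite /= hornerD hornerM hornerD hornerN hornerZ hornerX hornerC.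
  by rewrite [RHS]mulrDl; congr (_ + _); exact: mulrA.
have [h1 h2] := csmooth_seq hF.
have e0 : (fun x => (wpoly y c 0).[x%:C] * wave y c x) = wave y c.
  by apply/funext => x; rewrite /= hornerC mul1r.
rewrite e0 in h1 h2; split=> // m n.
have [C [k [C0 hC]]] := horner_bound (wpoly y c n).
have [D hD] := gs_bound R (m + k).
exists (C * ((1 + c^-1) ^+ (m + k) * D)) => x; rewrite h2 [cabs _]cabsM.
have -> : cabs (wave y c x) = gs (c * x).
  by rewrite /wave [LHS]cabsM cabs_fker mul1r cabs_real ger0_norm ?gs_ge0.
have x1 : 0 <= 1 + `|x| by rewrite addr_ge0.
have b1 : `|x| ^+ m * cabs (wpoly y c n).[x%:C] <= C * (1 + `|x|) ^+ (m + k).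
  rewrite exprD mulrCA ler_pM ?exprn_ge0 ?cabs_ge0 //.
  by rewrite lerXn2r ?nnegrE ?lerDr.
rewrite mulrA (le_trans (ler_wpM2r (gs_ge0 _) b1)) // -mulrA ler_wpM2l //.
have b2 : 1 + `|x| <= (1 + c^-1) * (1 + `|c * x|).
  have ci : 0 < c^-1 by rewrite invr_gt0.
  have -> : `|x| = c^-1 * `|c * x| by rewrite normrM gtr0_norm // mulrA mulVf ?mul1r ?gt_eqF.
  by have := normr_ge0 (c * x); nra.
have b3 := hD (c * x).
apply: (@le_trans _ _ ((1 + c^-1) ^+ (m + k) * ((1 + `|c * x|) ^+ (m + k) * gs (c * x)))).
  rewrite mulrA -exprMn ler_wpM2r ?gs_ge0 // lerXn2r ?nnegrE //.
  exact: le_trans b2.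
by rewrite ler_wpM2l // exprn_ge0 // addr_ge0 // invr_ge0 ltW.
Qed.

End SquareIntegrable.

(** * Existence and uniqueness of the B-spline *)

Section SplineExists.
Variable R : realType.
Local Notation Re := (@complex.Re R).
Local Notation Im := (@complex.Im R).
Local Notation mu := (@lebesgue_measure R).

Lemma csymbol_bound (s : R[i]) : 1 < Re s ->
  exists M, forall xi, cabs (csymbol s xi) <= M.
Proof.
move=> s1; exists (cbound s + cabs (csymbol s 0)) => xi.
have [->|x0] := eqVneq xi 0; first by rewrite lerDr expR_ge0.
apply: (@le_trans _ _ (cbound s)); last by rewrite lerDl cabs_ge0.
have cv := cvg_cabs (ccvg_csymbol s1 x0).
rewrite -(cvg_lim _ cv) //; apply: limr_le; first by apply/cvg_ex; eexists; exact: cv.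
apply: nearW => n; have n0 : 0 < n.+1%:R^-1 :> R by rewrite invr_gt0 ltr0n.
rewrite (le_trans (cabs_cexp_lbase s1 xi n0)) // ler_piMr ?expR_ge0 //.
by rewrite wgt_le1 // ltW // (lt_trans _ s1).
Qed.

Lemma cL2_cspline (s : R[i]) : 1 < Re s -> cL2 (fun t => (cGamma s)^-1 * cspline s t).
Proof.
move=> s1; apply: cL2Z; apply/cL2P; split; first exact: cmeasurable_cspline.
exact: cspline_L2.
Qed.

Lemma cL2_fourier_schwartz (psi : R -> R[i]) : is_schwartz psi -> cL2 (fourier psi).
Proof.
move=> hp; have [C hC] := fourier_schwartz_wgt hp; apply: cL2_wgt hC => //.
have := cintegr_schwartz 0 hp; rewrite (_ : cderiven 0 psi = psi).
  exact: cmeasurable_fourier.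
by apply/funext => x; rewrite cderiven0.
Qed.

Lemma cintegr_symbol (s : R[i]) (psi : R -> R[i]) : 1 < Re s -> is_schwartz psi ->
  cintegr (fun xi => psi xi * csymbol s xi).
Proof.
move=> s1 hp; have [M hM] := csymbol_bound s1.
have := cintegr_schwartz 0 hp; rewrite (_ : cderiven 0 psi = psi); last first.
  by apply/funext => x; rewrite cderiven0.
move=> pi; apply: cintegr_ext (cintegrMl pi (cmeasurable_csymbol s1) hM) => xi.
exact: mulrC.
Qed.

Lemma qL2_emb (j1 j2 j3 : R) (f g : R -> R[i]) (B : R -> quat R[i]) :
  (forall x, B x = emb j1 j2 j3 (f x) (g x)) -> cL2 f -> cL2 g -> qL2 B.
Proof.
move=> BE hf hg.
have h (z : R[i]) : cL2 (fun x => 'i * (g x - f x) / 2 * z).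
  apply: cL2_ext (cL2Z ('i / 2 * z) (cL2B hg hf)) => x; ring.
split.
- apply: cL2_ext (cL2Z 2^-1 (cL2D hf hg)) => x; rewrite /= BE /=; exact: mulrC.
- by apply: cL2_ext (h j1%:C) => x; rewrite /= BE.
- by apply: cL2_ext (h j2%:C) => x; rewrite /= BE.
- by apply: cL2_ext (h j3%:C) => x; rewrite /= BE.
Qed.

Lemma qL2_spline (q : quat R) : 1 < Sc q -> qL2 (spline_series q).
Proof.
move=> q1; have [j1 [j2 [j3 [jj qj]]]] := direction q.
apply: (qL2_emb (spline_series_emb q1 jj qj)); exact: cL2_cspline.
Qed.

Lemma spline_is_Bspline (q : quat R) : 1 < Sc q -> is_Bspline q (spline_series q).
Proof.
move=> q1; split=> [|psi hp]; first exact: qL2_spline.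
have [j1 [j2 [j3 [jj qj]]]] := direction q.
have hF := cL2_fourier_schwartz hp.
have o1 : 1 < Re (ord1 q) by []. have o2 : 1 < Re (ord2 q) by [].
rewrite (regular_emb (spline_series_emb q1 jj qj)); last 2 first.
- exact: cintegr_cL2M (cL2_cspline o1).
- exact: cintegr_cL2M (cL2_cspline o2).
rewrite (regular_emb (spline_symbol_emb qj)); [|exact: cintegr_symbol|exact: cintegr_symbol].
by rewrite !cspline_fourier.
Qed.

(** The Fourier transforms of Schwartz functions include all translated and
    dilated Gaussians, namely the transforms of the [wave y c]. *)
Lemma cL2_fourier_inj (f g : R -> R[i]) : cL2 f -> cL2 g ->
  (forall psi, is_schwartz psi ->
     cintegral (fun x => fourier psi x * f x) = cintegral (fun x => fourier psi x * g x)) ->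
  {ae mu, forall x, f x = g x}.
Proof.
move=> hf hg h; have hd := cL2B hf hg.
have key y c : 0 < c -> cintegral (fun x => (gs ((x - y) / c))%:C * (f x - g x)) = 0.
  move=> c0; have hp := wave_schwartz y c0; have hF := cL2_fourier_schwartz hp.
  have fi := cintegr_cL2M hF hf; have gi := cintegr_cL2M hF hg.
  have [k [k0 FE]] : exists k : R[i], k != 0 /\
      forall x, fourier (wave y c) x = k * (gs ((x - y) / c))%:C.
    exists (gsint R / c)%:C; split=> [|x]; last by rewrite fourier_wave // rmorphM.
    by rewrite realC_eq0 mulf_neq0 ?invr_neq0 ?gt_eqF ?gsint_gt0.
  have e : cintegral (fun x => fourier (wave y c) x * f x - fourier (wave y c) x * g x) = 0.
    by rewrite cintegralB // h // subrr.
  have i3 : cintegr (fun x => (gs ((x - y) / c))%:C * (f x - g x)).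
    apply: cintegr_ext (cintegrZ k^-1 (cintegr_cL2M hF hd)) => x.
    by rewrite FE mulrA mulKf.
  apply: (mulfI k0); rewrite mulr0 -(cintegralZ _ i3) -[RHS]e; apply: eq_cintegral => x.
  by rewrite FE -mulrBr mulrA.
have [[m1 m2] _] : cmeasurable (fun x => f x - g x) /\ True by split=> //; exact: cL2_measurable.
have /cL2P[_ i2] := hd.
have k1 : {ae mu, forall x, Re (f x - g x) = 0}.
  apply: ae_eq0_gs => //.
    apply: (integr_le _ _ i2); first exact: measurable_funX.
    by move=> x; rewrite ger0_norm ?sqr_ge0 // sqr_cabs lerDl sqr_ge0.
  move=> y c c0; have := congr1 Re (key y c c0) => /= <-.
  by apply: eq_Rintegral => x _; rewrite [in RHS]ReM /= mul0r subr0 mulrC.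
have k2 : {ae mu, forall x, Im (f x - g x) = 0}.
  apply: ae_eq0_gs => //.
    apply: (integr_le _ _ i2); first exact: measurable_funX.
    by move=> x; rewrite ger0_norm ?sqr_ge0 // sqr_cabs lerDr sqr_ge0.
  move=> y c c0; have := congr1 Im (key y c c0) => /= <-.
  by apply: eq_Rintegral => x _; rewrite [in RHS]ImM /= mul0r addr0 mulrC.
apply: (@filterS2 _ _ (ae_filter_ringOfSetsType mu) _ _ _ _ k1 k2) => x a b.
by apply/eqP; rewrite -subr_eq0; apply/eqP; apply: eqC.
Qed.

Lemma Bspline_unique (q : quat R) (B F : R -> quat R[i]) :
  is_Bspline q B -> is_Bspline q F -> {ae mu, forall t, B t = F t}.
Proof.
move=> [[b0 b1 b2 b3] hB] [[f0 f1 f2 f3] hF].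
have h psi : is_schwartz psi -> regular B (fourier psi) = regular F (fourier psi).
  by move=> hp; rewrite hB // hF.
have k0 := cL2_fourier_inj b0 f0 (fun psi hp => congr1 (@q0 _) (h psi hp)).
have k1 := cL2_fourier_inj b1 f1 (fun psi hp => congr1 (@q1 _) (h psi hp)).
have k2 := cL2_fourier_inj b2 f2 (fun psi hp => congr1 (@q2 _) (h psi hp)).
have k3 := cL2_fourier_inj b3 f3 (fun psi hp => congr1 (@q3 _) (h psi hp)).
have fl := ae_filter_ringOfSetsType mu.
apply: (@filterS2 _ _ fl _ _ _ _ (@filterI _ _ fl _ _ k0 k1) (@filterI _ _ fl _ _ k2 k3)) => x [a b] [c d].
exact: eqQ.
Qed.

End SplineExists.

(** * Test functions and regular distributions *)

Section TestFunctions.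
Variable R : realType.
Local Notation Re := (@complex.Re R).
Local Notation Im := (@complex.Im R).
Local Notation mu := (@lebesgue_measure R).
Implicit Types (f g phi psi : R -> R[i]) (B F : R -> quat R[i]) (q : quat R).

Lemma csmooth_continuous phi : csmooth phi -> ccontinuous phi.
Proof.
move=> [h1 h2]; split=> x; apply: differentiable_continuous; apply/derivable1_diffP.
  exact: (h1 0%N).
exact: (h2 0%N).
Qed.

Lemma cbounded_compact f (K : R) : ccontinuous f ->
  (forall x, K < `|x| -> f x = 0) -> exists M, forall x, cabs (f x) <= M.
Proof.
move=> [c1 c2] hK; pose h x := `|Re (f x)| + `|Im (f x)|.
have ch : continuous h.
  move=> x; apply: (@cvgD _ R) ; apply: cvg_norm; [exact: c1|exact: c2].
have K0 : - `|K| <= `|K| by rewrite ge0_cp // normr_ge0.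
have [c _ hc] := EVT_max K0 (continuous_subspaceT ch).
exists (h c) => x; have [Kx|xK] := ltP K `|x|.
  by rewrite hK // cabs0 addr_ge0.
rewrite (le_trans (cabs_ReIm _)) //; apply: hc.
by rewrite in_itv /= -ler_norml (le_trans xK) // ler_norm.
Qed.

Lemma wgt_compact (K x : R) : `|x| <= `|K| -> 1 <= (1 + `|K|) ^+ 2 * wgt 2%:R x.
Proof.
move=> xK; rewrite wgtn ler_pdivlMr ?exprn_gt0 ?gt0_1Dnorm // mul1r.
by rewrite lerXn2r ?nnegrE ?addr_ge0 // lerD2l.
Qed.

Lemma cabs_compact f (K M x : R) : (forall x, K < `|x| -> f x = 0) ->
  (forall x, cabs (f x) <= M) -> cabs (f x) <= M * (1 + `|K|) ^+ 2 * wgt 2%:R x.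
Proof.
move=> hK hM; have M0 := le_trans (cabs_ge0 _) (hM 0).
have [Kx|xK] := ltP K `|x|.
  by rewrite hK // cabs0 !mulr_ge0 ?exprn_ge0 ?addr_ge0 ?wgt_ge0.
rewrite -mulrA (le_trans (hM x)) // ler_peMr // wgt_compact //.
by rewrite (le_trans xK) // ler_norm.
Qed.

Lemma cintegr_compact f (K : R) : ccontinuous f ->
  (forall x, K < `|x| -> f x = 0) -> cintegr f.
Proof.
move=> cf hK; have [M hM] := cbounded_compact cf hK.
apply: (cintegr_le (ccontinuous_measurable cf) _ (integrZ (M * (1 + `|K|) ^+ 2) (integr_wgt2 R))).
by move=> x; exact: cabs_compact.
Qed.

Lemma cL2_compact f (K : R) : ccontinuous f ->
  (forall x, K < `|x| -> f x = 0) -> cL2 f.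
Proof.
move=> cf hK; have [M hM] := cbounded_compact cf hK.
apply: (@cL2_wgt _ _ 2%:R (M * (1 + `|K|) ^+ 2)); first by rewrite ler1n.
  exact: ccontinuous_measurable.
by move=> x; exact: cabs_compact.
Qed.

Lemma cL2_test phi : is_test phi -> cL2 phi.
Proof. by move=> [/csmooth_continuous c [K hK]]; exact: cL2_compact c hK. Qed.

Lemma cintegr_testM phi g : is_test phi -> ccontinuous g -> cintegr (fun x => phi x * g x).
Proof.
move=> [/csmooth_continuous c [K hK]] cg.
apply: (@cintegr_compact _ K (ccontinuousM c cg)) => x Kx.
by rewrite hK // mul0r.
Qed.

Lemma dist_eq_ae B F : qL2 B -> qL2 F -> {ae mu, forall x, B x = F x} ->
  dist_eq (regular B) (regular F).
Proof.
move=> [b0 b1 b2 b3] [f0 f1 f2 f3] h phi hp.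
have mp := cL2_measurable (cL2_test hp).
have key f g : cL2 f -> cL2 g -> {ae mu, forall x, f x = g x} ->
    cintegral (fun x => phi x * f x) = cintegral (fun x => phi x * g x).
  move=> hf hg fg; apply: cintegral_ext_ae.
  - by apply: (ae_mono _ fg) => x ->.
  - exact: cmeasurableM mp (cL2_measurable hf).
  - exact: cmeasurableM mp (cL2_measurable hg).
have S (T : Type) (p : quat R[i] -> T) : {ae mu, forall x, p (B x) = p (F x)}.
  by apply: (ae_mono _ h) => x ->.
by apply: eqQ; apply: key => //; exact: S.
Qed.

Lemma qabs_le (p : quat R[i]) :
  qabs p <= cabs (q0 p) + cabs (q1 p) + cabs (q2 p) + cabs (q3 p).
Proof.
rewrite /qabs; move: (cabs_ge0 (q0 p)) (cabs_ge0 (q1 p)) (cabs_ge0 (q2 p)) (cabs_ge0 (q3 p)).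
move: (cabs (q0 p)) (cabs (q1 p)) (cabs (q2 p)) (cabs (q3 p)) => a b c d a0 b0 c0 d0.
have s0 : 0 <= a + b + c + d by rewrite !addr_ge0.
apply: (@le_trans _ _ (Num.sqrt ((a + b + c + d) ^+ 2))); last by rewrite sqrtr_sqr ger0_norm.
apply: ler_wsqrtr.
have := mulr_ge0 a0 b0; have := mulr_ge0 a0 c0; have := mulr_ge0 a0 d0.
have := mulr_ge0 b0 c0; have := mulr_ge0 b0 d0; have := mulr_ge0 c0 d0; nra.
Qed.

(** The order is 0: for [phi] supported in [-K, K] and bounded by [M], the
    integrand is at most [M (1 + |K|) ^ 2] times the integrable function
    [wgt 2 * |B|]. *)
Lemma regular_distribution B : qL2 B -> is_distribution (regular B).
Proof.
move=> [b0 b1 b2 b3]; split=> [a phi psi hp hs|K].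
  have key f : cL2 f -> cintegral (fun x => (a * phi x + psi x) * f x) =
      a * cintegral (fun x => phi x * f x) + cintegral (fun x => psi x * f x).
    move=> hf; have i1 := cintegr_cL2M (cL2_test hp) hf.
    have i2 := cintegr_cL2M (cL2_test hs) hf.
    rewrite -(cintegralZ a i1) -(cintegralD (cintegrZ a i1) i2).
    by apply: eq_cintegral => x; rewrite mulrDl mulrA.
  by apply: eqQ; exact: key.
have w2 : cL2 (fun x => (wgt 2%:R x)%:C : R[i]).
  apply: (@cL2_wgt _ _ 2%:R 1); first by rewrite ler1n.
    by apply: cmeasurable_real; exact: measurable_wgt.
  by move=> x; rewrite cabs_real ger0_norm ?wgt_ge0 // mul1r.
have key f : cL2 f -> exists C, forall phi (M : R), is_test phi ->
    (forall x, K < `|x| -> phi x = 0) ->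
    (forall n x, (n <= 0)%N -> cabs (cderiven n phi x) <= M) ->
    cabs (cintegral (fun x => phi x * f x)) <= C * M.
  move=> hf; have iw := integr_cabs (cintegr_cL2M w2 hf).
  exists (2 * ((1 + `|K|) ^+ 2 * \int[mu]_x cabs ((wgt 2%:R x)%:C * f x))) => phi M hp hK hM.
  have hM' x : cabs (phi x) <= M by have := hM 0%N x (leqnn _); rewrite cderiven0.
  have -> : 2 * ((1 + `|K|) ^+ 2 * \int[mu]_x cabs ((wgt 2%:R x)%:C * f x)) * M =
      2 * \int[mu]_x (M * (1 + `|K|) ^+ 2 * cabs ((wgt 2%:R x)%:C * f x)).
    rewrite RintegralZl //; move: (Rintegral _ _ _) => I; ring.
  apply: cabs_cintegral; [exact: cintegr_cL2M (cL2_test hp) hf| |exact: integrZ].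
  move=> x; rewrite [leLHS]cabsM (cabsM (wgt 2%:R x)%:C) cabs_real (ger0_norm (wgt_ge0 _ _)) [leRHS]mulrA.
  by rewrite ler_wpM2r ?cabs_ge0 // cabs_compact.
have [[C0 h0] [C1 h1] [C2 h2] [C3 h3]] := And4 (key _ b0) (key _ b1) (key _ b2) (key _ b3).
exists (C0 + C1 + C2 + C3), 0%N => phi M hp hK hM.
apply: le_trans (qabs_le _) _; rewrite !mulrDl.
exact: lerD (lerD (lerD (h0 _ _ hp hK hM) (h1 _ _ hp hK hM)) (h2 _ _ hp hK hM)) (h3 _ _ hp hK hM).
Qed.

End TestFunctions.

(** * The spline as a distribution *)

Section SplineDistribution.
Variable R : realType.
Local Notation Re := (@complex.Re R).
Local Notation Im := (@complex.Im R).
Local Notation mu := (@lebesgue_measure R).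
Implicit Types (phi psi : R -> R[i]) (s : R[i]).
Variable q : quat R.
Hypothesis q_gt1 : 1 < Sc q.
Variables j1 j2 j3 : R.
Hypothesis jj : j1 ^+ 2 + j2 ^+ 2 + j3 ^+ 2 = 1.
Hypothesis qj : along j1 j2 j3 q.
Local Notation emb := (emb j1 j2 j3).
Local Notation s1 := (ord1 q).
Local Notation s2 := (ord2 q).
Let s1_gt1 : 1 < Re s1. Proof. by []. Qed.
Let s2_gt1 : 1 < Re s2. Proof. by []. Qed.

Definition shift_pair s phi (k : nat) : R[i] :=
  cintegral (fun t => phi t * tpow (s - 1) (t - k%:R)).

Lemma cintegr_shift_pair s phi (k : nat) : 1 < Re s -> is_test phi ->
  cintegr (fun t => phi t * tpow (s - 1) (t - k%:R)).
Proof. by move=> hs hp; apply: cintegr_testM => //; exact: ccontinuous_tpow_shift. Qed.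

Lemma shift_pair_eq0 s phi (K : R) (k : nat) : (forall x, K < `|x| -> phi x = 0) ->
  K <= k%:R -> shift_pair s phi k = 0.
Proof.
move=> hK Kk; rewrite -[RHS](@cintegral0 R); apply: eq_cintegral => t.
have [tk|kt] := leP t k%:R; first by rewrite tpow_le0 ?mulr0 // subr_le0.
by rewrite hK ?mul0r // (le_lt_trans Kk) // (lt_le_trans kt) // ler_norm.
Qed.

(** On the support of [phi] the spline is a finite sum. *)
Lemma cspline_pair s phi (K : R) (N : nat) : 1 < Re s -> is_test phi ->
  (forall x, K < `|x| -> phi x = 0) -> K <= N%:R ->
  cintegral (fun x => phi x * ((cGamma s)^-1 * cspline s x)) =
  (cGamma s)^-1 * \sum_(k < N) bcoef s k * shift_pair s phi k.
Proof.
move=> hs hp hK KN.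
have i k := cintegrZ (bcoef s k) (cintegr_shift_pair k hs hp).
transitivity (cintegral (fun x => (cGamma s)^-1 *
    \sum_(k < N) (bcoef s k * (phi x * tpow (s - 1) (x - k%:R))))).
  apply: eq_cintegral => x; have [xN|Nx] := leP x N%:R.
    rewrite (csplineE s xN) // mulrCA; congr (_ * _); rewrite /psum mulr_sumr.
    by apply: eq_bigr => k _; rewrite mulrCA.
  rewrite hK ?mul0r ?big1 ?mulr0 // => [k _|]; first by rewrite mul0r mulr0.
  by rewrite (le_lt_trans KN) // (lt_le_trans Nx) // ler_norm.
rewrite (cintegralZ _ (cintegr_sum _ (fun k : 'I_N => i k))); congr (_ * _).
rewrite (cintegral_sum _ (fun k : 'I_N => i k)); apply: eq_bigr => k _.
by rewrite (cintegralZ _ (cintegr_shift_pair k hs hp)).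
Qed.

Lemma spline_pair phi (K : R) (N : nat) : is_test phi ->
  (forall x, K < `|x| -> phi x = 0) -> K <= N%:R ->
  regular (spline_series q) phi =
  emb ((cGamma s1)^-1 * \sum_(k < N) bcoef s1 k * shift_pair s1 phi k)
      ((cGamma s2)^-1 * \sum_(k < N) bcoef s2 k * shift_pair s2 phi k).
Proof.
move=> hp hK KN; rewrite (regular_emb (spline_series_emb q_gt1 jj qj)).
- by rewrite (cspline_pair s1_gt1 hp hK KN) (cspline_pair s2_gt1 hp hK KN).
- exact: cintegr_cL2M (cL2_test hp) (cL2_cspline s1_gt1).
- exact: cintegr_cL2M (cL2_test hp) (cL2_cspline s2_gt1).
Qed.

Lemma test_bound phi : is_test phi ->
  exists K : R, exists N : nat, (forall x, K < `|x| -> phi x = 0) /\ K <= N%:R.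
Proof.
move=> [_ [K hK]]; exists K, (Num.truncn K).+1; split=> //.
by rewrite ltW // truncnS_gt.
Qed.

Lemma spline_dseries_eq : dist_eq (regular (spline_series q)) (spline_dseries q).
Proof.
move=> phi hp; have [K [N [hK KN]]] := test_bound hp.
rewrite (spline_pair hp hK KN) /spline_dseries /dseries.
have E k : spline_coef q k * regular (fun t => ppowq (t - k%:R) (q - 1)) phi =
    emb (bcoef s1 k * shift_pair s1 phi k) (bcoef s2 k * shift_pair s2 phi k).
  have pE t : ppowq (t - k%:R) (q - 1) =
      emb (tpow (s1 - 1) (t - k%:R)) (tpow (s2 - 1) (t - k%:R)).
    by rewrite (ppowq_emb _ (alongB qj)) ord1B ord2B.
  rewrite (regular_emb pE) ?(spline_coef_emb jj) ?embM //; exact: cintegr_shift_pair.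
rewrite (@fsum_ord _ _ N) => [|k Nk].
  by rewrite (eq_bigr _ (fun (k : 'I_N) _ => E k)) emb_sum (GammaqV_emb q_gt1 jj qj) embM.
by rewrite E !(shift_pair_eq0 _ hK) ?mulr0 ?emb0 // (le_trans KN) // ler_nat.
Qed.

Lemma spline_supported : supported_from 0 (regular (spline_series q)).
Proof.
move=> phi hp [b b0 hb].
rewrite (regular_emb (spline_series_emb q_gt1 jj qj)); last 2 first.
- exact: cintegr_cL2M (cL2_test hp) (cL2_cspline s1_gt1).
- exact: cintegr_cL2M (cL2_test hp) (cL2_cspline s2_gt1).
have z s : 1 < Re s -> cintegral (fun x => phi x * ((cGamma s)^-1 * cspline s x)) = 0.
  move=> hs; rewrite -[RHS](@cintegral0 R); apply: eq_cintegral => x.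
  have [x0|x0] := leP x 0; first by rewrite cspline_le0 // !mulr0.
  by rewrite hb ?mul0r // (le_trans (ltW b0)) // ltW.
by rewrite !z ?emb0.
Qed.

(** * The combination of Dirac masses and the fractional integral *)

Local Notation dirac_comb := (dseries (spline_coef q) (fun k => delta k%:R)).

Lemma dirac_term k (z : R[i]) : spline_coef q k * (z *: (1 : quat R[i])) =
  emb (bcoef s1 k * z) (bcoef s2 k * z).
Proof. by rewrite (spline_coef_emb jj) // -qscaleAr mulr1 -embZ ![z * _]mulrC. Qed.

Lemma dirac_combE phi (K : R) (N : nat) : (forall x, K < `|x| -> phi x = 0) ->
  K < N%:R -> dirac_comb phi =
  emb (\sum_(k < N) bcoef s1 k * phi k%:R) (\sum_(k < N) bcoef s2 k * phi k%:R).
Proof.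
move=> hK KN; rewrite /dseries (@fsum_ord _ _ N) => [|k Nk].
  by under eq_bigr do rewrite /delta dirac_term; rewrite emb_sum.
rewrite /delta hK ?scale0r ?mulr0 // ger0_norm // (lt_le_trans KN) // ler_nat //.
Qed.

Lemma qabs_emb_le : exists C : R, 0 <= C /\
  forall u v : R[i], qabs (emb u v) <= C * (cabs u + cabs v).
Proof.
exists (1 + `|j1| + `|j2| + `|j3|); split; first by rewrite !addr_ge0.
move=> u v; rewrite (le_trans (qabs_le _)) // !mulrDl mul1r.
have h2 : 0 <= 2^-1 :> R by rewrite invr_ge0.
have a2 : cabs (2^-1 : R[i]) = 2^-1 by rewrite cabsV cabs_nat.
have le2 (x : R) : 0 <= x -> x * 2^-1 <= x by move=> x0; lra.
have hj (j : R) : cabs ('i * (v - u) / 2 * j%:C) <= `|j| * (cabs u + cabs v).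
  rewrite !cabsM cabsi mul1r a2 cabs_real mulrC ler_wpM2l //.
  have := cabsB v u; have := cabs_ge0 (v - u); lra.
rewrite !lerD //= cabsM a2; have := cabsD u v; have := cabs_ge0 (u + v); lra.
Qed.

(** Finitely many masses meet a given compact set, so the order is 0. *)
Lemma dirac_comb_distribution : is_distribution dirac_comb.
Proof.
split=> [a phi psi hp hs|K].
  have [K [N [hK KN]]] := test_bound hp; have [K' [N' [hK' KN']]] := test_bound hs.
  pose L := Num.max K K'; have kL : K <= L by rewrite le_max lexx.
  have kL' : K' <= L by rewrite le_max lexx orbT.
  have h1 x : L < `|x| -> phi x = 0 by move=> h; apply: hK; exact: le_lt_trans h.
  have h2 x : L < `|x| -> psi x = 0 by move=> h; apply: hK'; exact: le_lt_trans h.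
  have LN : L < (Num.truncn L).+1%:R by rewrite truncnS_gt.
  rewrite (dirac_combE h1 LN) (dirac_combE h2 LN) (@dirac_combE _ L _ _ LN) => [|x Lx].
    rewrite -embZ -embD; congr emb; rewrite mulr_sumr -big_split; apply: eq_bigr => k _ /=;
    by rewrite mulrDr mulrCA.
  by rewrite h1 // h2 // mulr0 addr0.
have [C [C0 hC]] := qabs_emb_le; pose N := (Num.truncn K).+1.
have KN : K < N%:R by rewrite truncnS_gt.
exists (C * (\sum_(k < N) cabs (bcoef s1 k) + \sum_(k < N) cabs (bcoef s2 k))), 0%N.
move=> phi M hp hK hM; rewrite (dirac_combE hK KN) (le_trans (hC _ _)) // -mulrA ler_wpM2l //.
have b s : cabs (\sum_(k < N) bcoef s k * phi k%:R) <= (\sum_(k < N) cabs (bcoef s k)) * M.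
  rewrite (le_trans (cabs_sum _ _ _)) // mulr_suml; apply: ler_sum => k _.
  rewrite cabsM ler_wpM2l ?cabs_ge0 //.
  by have := hM 0%N k%:R (leqnn _); rewrite cderiven0.
by rewrite mulrDl lerD.
Qed.

Lemma dirac_comb_supported : supported_from 0 dirac_comb.
Proof.
move=> phi _ [b b0 hb]; rewrite /dseries (@fsum_ord _ _ 0%N) ?big_ord0 // => k _.
by rewrite /delta hb ?scale0r ?mulr0 // (le_trans (ltW b0)).
Qed.

Lemma cutoff_nat (k : nat) : cutoff 0 k%:R = 1 :> R.
Proof.
rewrite /cutoff subr0 [flat (0 - 1 - k%:R)]/flat.
rewrite ltNge (_ : 0 - 1 - k%:R <= 0 = true); last first.
  by rewrite sub0r -opprD oppr_le0 addr_ge0.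
rewrite addr0 divff // /flat ltr_wpDl //; exact: lt0r_neq0 (expR_gt0 _).
Qed.

Lemma shift_pair_translate s phi (k : nat) : 1 < Re s -> is_test phi ->
  cintegral (fun y => phi (k%:R + y) * ((cGamma s)^-1 * tpow (s - 1) y)) =
  (cGamma s)^-1 * shift_pair s phi k.
Proof.
move=> hs hp; have i := cintegr_shift_pair k hs hp.
have c : ccontinuous (fun t => phi t * tpow (s - 1) (t - k%:R)).
  apply: ccontinuousM (csmooth_continuous hp.1) _.
  exact: ccontinuous_tpow_shift.
rewrite /shift_pair (cintegral_affine k%:R ltr01 c i) mul1r.
rewrite -(cintegralZ _ (cintegr_affine k%:R ltr01 c i)); apply: eq_cintegral => y.
by rewrite mul1r [k%:R + y]addrC addrK mulrCA.
Qed.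

Lemma kernel_pair phi (k : nat) : is_test phi ->
  qintegral (fun y => phi (k%:R + y) *: frac_kernel q y) =
  emb ((cGamma s1)^-1 * shift_pair s1 phi k) ((cGamma s2)^-1 * shift_pair s2 phi k).
Proof.
move=> hp; have i s : 1 < Re s ->
    cintegr (fun y => phi (k%:R + y) * ((cGamma s)^-1 * tpow (s - 1) y)).
  move=> hs; have i := cintegr_shift_pair k hs hp.
  have c : ccontinuous (fun t => phi t * tpow (s - 1) (t - k%:R)).
    apply: ccontinuousM (csmooth_continuous hp.1) _.
    exact: ccontinuous_tpow_shift.
  apply: cintegr_ext (cintegrZ (cGamma s)^-1 (cintegr_affine k%:R ltr01 c i)) => y.
  by rewrite mul1r [k%:R + y]addrC addrK mulrCA.
rewrite -!shift_pair_translate // -qintegral_emb; [|exact: i|exact: i].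
apply: eq_qintegral => y.
by rewrite /frac_kernel (GammaqV_emb q_gt1 jj qj) (ppowq_emb _ (alongB qj)) ord1B ord2B embM // embZ.
Qed.

(** The extension to quaternion-valued functions is left linear, hence the value
    of the function ends up to the left of the coefficient. *)
Lemma qpair_sum (N : nat) (c : nat -> quat R[i]) (F : R -> quat R[i]) :
  (forall k, (N <= k)%N -> F k%:R = 0) ->
  qpair (dseries c (fun k => delta k%:R)) F = \sum_(k < N) F k%:R * c k.
Proof.
move=> hF; have S (p : quat R[i] -> R[i]) : p 0 = 0 ->
    dseries c (fun k => delta k%:R) (p \o F) = \sum_(k < N) c k * (p (F k%:R) *: (1 : quat R[i])).
  move=> p0; rewrite /dseries (@fsum_ord _ _ N) // => k Nk.
  by rewrite /delta /= hF // p0 scale0r mulr0.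
rewrite /qpair !S // !mulr_sumr -!big_split; apply: eq_bigr => k _ /=.
by move: (F _) (c k) => p r; apply: eqQ => /=; ring.
Qed.

(** The Dirac masses evaluate the convolution of the kernel with [phi] at the
    integers [k >= 0]. There the cutoff is 1, and a translation turns the value
    into the pairing of [phi] with [(t - k)_+ ^ (q - 1)]. Kernel and coefficients
    commute since both lie in the image of [emb]. *)
Lemma spline_frac_int :
  dist_eq (regular (spline_series q)) (frac_int q 0 dirac_comb).
Proof.
move=> phi hp; have [K [N [hK KN]]] := test_bound hp.
rewrite (spline_pair hp hK KN) /frac_int /Defs.conv.
have E (k : nat) : (cutoff 0 k%:R)%:C *: qintegral (fun y => phi (k%:R + y) *: frac_kernel q y) =
    emb ((cGamma s1)^-1 * shift_pair s1 phi k) ((cGamma s2)^-1 * shift_pair s2 phi k).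
  by rewrite cutoff_nat scale1r kernel_pair.
rewrite (@qpair_sum N) => [|k Nk]; last first.
  by rewrite E !(shift_pair_eq0 _ hK) ?mulr0 ?emb0 // (le_trans KN) // ler_nat.
rewrite !mulr_sumr -emb_sum; apply: eq_bigr => k _.
by rewrite E (spline_coef_emb jj) // embM // ![bcoef _ k * _]mulrC !mulrA.
Qed.

End SplineDistribution.

Theorem theorem2 (R : realType) (q : quat R) (hq : 1 < Sc q) :
  (exists B : R -> quat R[i], is_Bspline q B) /\
  (forall B : R -> quat R[i], is_Bspline q B ->
    [/\ dist_eq (regular B) (regular (spline_series q)),
        dist_eq (regular B) (spline_dseries q),
        qL2 (spline_series q) /\
          {ae (@lebesgue_measure R), forall t : R, B t = spline_series q t}
      & frac_deriv_eq q (regular B)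
          (dseries (spline_coef q) (fun k => delta k%:R))]).
Proof.
have hF := spline_is_Bspline hq; have LF := qL2_spline hq.
split=> [|B hB]; first by exists (spline_series q).
have [j1 [j2 [j3 [jj qj]]]] := direction q.
have ae := Bspline_unique hB hF; have BF := dist_eq_ae hB.1 LF ae.
split=> //.
- by move=> phi hp; rewrite BF // (spline_dseries_eq hq jj qj).
- exists 0; split.
  + exact: regular_distribution hB.1.
  + by move=> phi hp h; rewrite BF // (spline_supported hq jj qj).
  + exact: dirac_comb_distribution jj qj.
  + exact: dirac_comb_supported.
  + by move=> phi hp; rewrite BF // (spline_frac_int hq jj qj).
Qed.
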